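(* Let $r\ge 2$ and $k\ge r$ be integers, let $F$ be a $(k+1)$-color critical graph, and let $F^{r}$ be the $r$-expansion of $F$. Then for all sufficiently large $n$, $$\mathrm{spex}_{r}^{\mathrm{lin}}(n,F^{r})\le \frac{n(k-1)}{k(r-1)}.$$ Moreover, this inequality holds with equality for $n=km$ whenever $m$ is sufficiently large and $m,k,r$ satisfy $$m(k-1)\equiv 0 \pmod{r-1},\qquad m^{2}k(k-1)\equiv 0 \pmod{r(r-1)}.$$
   Context: An $r$-uniform hypergraph $H$ has a vertex set $V(H)$ and an edge set $E(H)$ of $r$-element subsets of $V(H)$; it is linear if any two distinct edges share at most one vertex. A hypergraph $H$ is $F^r$-free if it has no (not necessarily induced) subhypergraph isomorphic to $F^r$. The adjacency tensor $\mathcal{A}(H)$ of an $r$-uniform hypergraph on vertices $v_1,\dots,v_n$ is the order-$r$, dimension-$n$ tensor with entry $a_{i_1\cdots i_r}=\frac{1}{(r-1)!}$ if $\{v_{i_1},\dots,v_{i_r}\}\in E(H)$ and $0$ otherwise. A number $\lambda\in\mathbb{C}$ is an eigenvalue of $\mathcal{A}$ if there is a nonzero $x\in\mathbb{C}^n$ with $(\mathcal{A}x^{r-1})_i:=\sum_{i_2,\dots,i_r}a_{i i_2\cdots i_r}x_{i_2}\cdots x_{i_r}=\lambda x_i^{r-1}$ for all $i$; the spectral radius $\rho(H)$ is the maximum modulus of eigenvalues of $\mathcal{A}(H)$. $\mathrm{spex}_r^{\mathrm{lin}}(n,F^r)$ denotes the maximum of $\rho(H)$ over all $F^r$-free linear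 $r$-uniform hypergraphs $H$ on $n$ vertices. A graph $F$ is $(k+1)$-color critical if its chromatic number is $k+1$ and there is an edge $e$ with $\chi(F-e)=k$. The $r$-expansion $F^r$ of a graph $F$ is the $r$-uniform hypergraph obtained by adding to each edge $e$ of $F$ a set $S_e$ of $r-2$ new vertices, where the sets $S_e$ are pairwise disjoint and disjoint from $V(F)$; its edges are $e\cup S_e$, $e\in E(F)$. *)

(* Defs.v *)
From HB Require Import structures.
From mathcomp Require Import all_boot all_order all_algebra.
From mathcomp Require Import classical_sets reals.
From mathcomp Require Import complex.

Set Implicit Arguments.
Unset Strict Implicit.
Unset Printing Implicit Defensive.

Import Order.TTheory GRing.Theory Num.Theory.
Import ComplexField.

Local Open Scope ring_scope.

Definition simple_graph (V : finType) (F : rel V) : Prop :=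
  symmetric F /\ irreflexive F.

Definition colorableb (V : finType) (F : rel V) (k : nat) : bool :=
  [exists c : {ffun V -> 'I_k}, [forall u, forall v, F u v ==> (c u != c v)]].

(* chromatic number: least k such that F is k-colourable
   (F is always #|V|-colourable, so the search in 0..#|V| succeeds). *)
Definition chromatic_number (V : finType) (F : rel V) : nat :=
  find (colorableb F) (iota 0 #|V|.+1).

Definition del_edge (V : finType) (F : rel V) (u v : V) : rel V :=
  fun x y => F x y && ([set x; y] != [set u; v]).

Definition color_critical (V : finType) (F : rel V) (k : nat) : Prop :=
  chromatic_number F = k.+1 /\
  exists u v, F u v /\ chromatic_number (del_edge F u v) = k.

Definition uniform (T : finType) (r : nat) (E : {set {set T}}) : Prop :=
  forall e, e \in E -> #|e| = r.

Definition linear_hg (T : finType) (E : {set {set T}}) : Prop :=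
  forall e1 e2, e1 \in E -> e2 \in E -> e1 != e2 -> (#|e1 :&: e2| <= 1)%N.

Definition is_graph_edge (V : finType) (F : rel V) (A : {set V}) : bool :=
  [exists u, exists v, F u v && (A == [set u; v])].

Definition graph_edge (V : finType) (F : rel V) := {A : {set V} | is_graph_edge F A}.

(* vertex set of the r-expansion: V(F) together with r-2 new vertices
   S_e = {(e,0), ..., (e, r-3)} for each edge e *)
Definition exp_vertex (V : finType) (F : rel V) (r : nat) : finType :=
  (V + (graph_edge F * 'I_(r - 2)))%type.

Definition expansion_edge (V : finType) (F : rel V) (r : nat) (e : graph_edge F)
  : {set exp_vertex F r} :=
  (@inl V (graph_edge F * 'I_(r - 2)) @: val e) :|:
  [set @inr V (graph_edge F * 'I_(r - 2)) (e, i) | i : 'I_(r - 2)].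

Definition expansion (V : finType) (F : rel V) (r : nat) : {set {set exp_vertex F r}} :=
  [set expansion_edge r e | e : graph_edge F].

Definition contains_copy (T U : finType) (H : {set {set T}}) (G : {set {set U}}) : Prop :=
  exists f : U -> T, injective f /\ forall e, e \in G -> f @: e \in H.

Definition free_of (T U : finType) (H : {set {set T}}) (G : {set {set U}}) : Prop :=
  ~ contains_copy H G.

Section Tensor.
Variable R : realType.
Variables (n r : nat).
Variable H : {set {set 'I_n}}.

Definition adj_entry (s : {ffun 'I_r -> 'I_n}) : R[i] :=
  if [set s j | j : 'I_r] \in H then ((r.-1)`!)%:R^-1 else 0.

(* (A x^{r-1})_i = sum_{i_2..i_r} a_{i i_2 .. i_r} x_{i_2} ... x_{i_r} *)
Definition tensor_apply (x : 'I_n -> R[i]) (i : 'I_n) : R[i] :=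
  \sum_(s : {ffun 'I_r -> 'I_n} | [forall j : 'I_r, (val j == 0%N) ==> (s j == i)])
     adj_entry s * \prod_(j : 'I_r | val j != 0%N) x (s j).

Definition is_eigenvalue (lam : R[i]) : Prop :=
  exists x : 'I_n -> R[i], (exists j, x j != 0) /\
    forall i, tensor_apply x i = lam * x i ^+ r.-1.

Definition spectral_radius : R :=
  sup [set Normc.normc lam | lam in is_eigenvalue].

End Tensor.

Definition spex_lin (R : realType) (r n : nat) (U : finType) (G : {set {set U}}) : R :=
  sup [set spectral_radius R r H | H in
        [set H : {set {set 'I_n}} | uniform r H /\ linear_hg H /\ free_of H G]].

(* Main.v *)
(* Upper bound.  If x is an eigenvector of the tensor for lambda and y_v = |x_v|^(r-1),
   then by AM-GM (r-1)|lambda| y <= A y entrywise, where A is the adjacency matrix of the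
   shadow of H (two vertices are adjacent if they share an edge).  So it suffices that a
   graph on n vertices of spectral radius larger than (1-1/k)n contains, for any fixed t
   and n large, a complete k-partite graph with parts of size t plus an edge inside a
   part: choosing vertices of it greedily, so as to avoid the finitely many points on the
   edges already used, produces a copy of F^r.  To see this take a nonempty vertex set S
   maximizing rho(S)^(q+1)/|S|^q for a large constant q.  Comparing S with S - w shows that
   no entry of the Perron vector of S is much smaller than average, which forces minimum
   degree close to (1-1/k)|S| in S.  Then either the wanted subgraph is found by
   Erdos-Stone type arguments or S is k-colourable, and in the latter case
   rho(S) <= (1-1/k)|S|, against the choice of S.

   Lower bound.  The all-ones vector is an eigenvector when the shadow of H is complete
   k-partite with parts of size m, that is, when H is an r-GDD of type m^k.  The
   congruences make every additive invariant vanish, so the complete multipartite graph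
   (with or without a hole) is an integral combination of blocks; adding a positive
   multiple of all the blocks gives an honest decomposition of a lambda-fold multigraph,
   and a linear labelling over Z_lambda turns that into a GDD whose groups are larger by a
   power of lambda.  Wilson's recursive construction, fed by the Chowla-Erdos-Straus theorem
   on orthogonal arrays, then reaches every large admissible m. *)

Require Import Defs.
From HB Require Import structures.
From mathcomp Require Import all_boot all_order all_fingroup all_algebra all_field.
From mathcomp Require Import reals complex zify ring lra.
From mathcomp Require boolp classical_sets functions topology normedtype derive.

Set Implicit Arguments.
Unset Strict Implicit.
Unset Printing Implicit Defensive.

Import Order.TTheory GRing.Theory Num.Theory.

(** * Group divisible designs and orthogonal arrays *)

(** A Perron vector may have tiny entries, so a large spectral radius alone gives no minimum degree;
    this is why a subset S is chosen. The functional rho^(q+1)/|S|^q is |S| (rho/|S|)^(q+1): a large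
    q rewards density, while rho(S) <= |S| bounds it by |S|, so the maximizer still has linear size.

    On the design side, the labelling over Z_lambda reaches only the group sizes g lambda^d, a
    sparse set. Two freedoms repair this: lambda can be made coprime to any prescribed number, and
    the same argument works with a hole of size w in each group, the condition (k-2)w < g-w coming
    from the wish for positive block weights. Holes a Q1 and a Q2 with Q1, Q2 coprime combine in
    Wilson's construction to every large multiple of a, and inflations of a third size a Q3 fill
    holes in every residue class. An admissible n is treated through a = gcd(n, r(r-1)), which
    leaves finitely many a. *)

Definition decomposable (V : finType) (adj : rel V) (r : nat) : Prop :=
  exists Phi : {set V} -> Prop,
  [/\ forall X, Phi X -> #|X| = r,
      forall X u v, Phi X -> u \in X -> v \in X -> u != v -> adj u v,
      forall u v, adj u v -> exists X, [/\ Phi X, u \in X & v \in X]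
    & forall X Y u v, Phi X -> Phi Y -> u != v ->
        u \in X -> v \in X -> u \in Y -> v \in Y -> X = Y].

Definition multipartite (I T : finType) (W : {set T}) (p q : I * T) : bool :=
  (p.1 != q.1) && ~~ ((p.2 \in W) && (q.2 \in W)).

(* A decomposition into copies of K_r of the complete multipartite graph with
   groups of size [g] indexed by [I], from which the edges between holes of size
   [w] (one hole in each group) are deleted. *)
Definition gdd (I : finType) (r g w : nat) : Prop :=
  exists (T : finType) (W : {set T}),
    [/\ #|T| = g, #|W| = w & decomposable (@multipartite I T W) r].

(* Orthogonal array of strength 2 and index 1 on [t] symbols, with columns
   indexed by [I]: equivalently, a transversal design TD(#|I|, t). *)
Definition oa (I : finType) (t : nat) : Prop :=
  exists (T : finType) (Phi : {ffun I -> T} -> Prop),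
  [/\ #|T| = t,
      forall i i' x x', i != i' -> exists f, [/\ Phi f, f i = x & f i' = x']
    & forall f f' i i', Phi f -> Phi f' -> i != i' ->
        f i = f' i -> f i' = f' i' -> f = f'].

Lemma decomposable_bij (V V' : finType) (adj : rel V) (adj' : rel V') r
    (f : V -> V') (f' : V' -> V) :
  cancel f f' -> cancel f' f -> (forall u v, adj' (f u) (f v) = adj u v) ->
  decomposable adj r -> decomposable adj' r.
Proof.
move=> fK f'K adjf [Phi [Pr Padj Pex Puniq]].
have finj := can_inj fK.
exists (fun X => exists2 Y, Phi Y & X = f @: Y); split.
- by move=> _ [Y PY ->]; rewrite card_imset // Pr.
- move=> _ u v [Y PY ->] /imsetP[x xY ->] /imsetP[y yY ->].
  by rewrite (inj_eq finj) adjf; apply: Padj PY xY yY.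
- move=> u v; rewrite -(f'K u) -(f'K v) adjf => /Pex[X [PX uX vX]].
  by exists (f @: X); split; [exists X | exact: imset_f | exact: imset_f].
- move=> _ _ u v [Y PY ->] [Y' PY' ->] uv /imsetP[x xY eu] /imsetP[y yY ev].
  subst u v; rewrite !(mem_imset _ _ finj) => xY' yY'.
  by rewrite (Puniq Y Y' x y) //; rewrite (inj_eq finj) in uv.
Qed.

Lemma bij_setP (T T' : finType) (W : {set T}) (W' : {set T'}) :
  #|T| = #|T'| -> #|W| = #|W'| ->
  exists (f : T -> T') (f' : T' -> T),
    [/\ cancel f f', cancel f' f & forall x, (f x \in W') = (x \in W)].
Proof.
move=> eT eW; case: (pickP T) => [x0 _|T0]; last first.
  have T0' : T -> False by move=> x; have := T0 x.
  have T'0 : T' -> False by move=> y; have := fintype0 y; rewrite -eT eq_card0.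
  exists (fun x => False_rect _ (T0' x)), (fun y => False_rect _ (T'0 y)).
  by split=> [x|y|x]; [case: (T0' x) | case: (T'0 y) | case: (T0' x)].
have [y0 _] : exists y0 : T', true.
  case: (pickP T') => [y _|T'0]; first by exists y.
  by have := fintype0 x0; rewrite eT eq_card0.
have list_mem (S : finType) (A : {set S}) x : x \in enum A ++ enum (~: A).
  by rewrite mem_cat !mem_enum inE orbN.
have list_uniq (S : finType) (A : {set S}) : uniq (enum A ++ enum (~: A)).
  rewrite cat_uniq !enum_uniq andbT; apply/hasPn => x.
  by rewrite !mem_enum inE.
have list_size (S : finType) (A : {set S}) : size (enum A ++ enum (~: A)) = #|S|.
  by rewrite size_cat -!cardE cardsC.
set s := enum W ++ enum (~: W); set s' := enum W' ++ enum (~: W').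
have szs : size s = size s' by rewrite !list_size.
exists (fun x => nth y0 s' (index x s)), (fun y => nth x0 s (index y s')); split.
- by move=> x; rewrite index_uniq ?list_uniq -?szs ?index_mem ?list_mem // nth_index ?list_mem.
- by move=> x; rewrite index_uniq ?list_uniq ?szs ?index_mem ?list_mem // nth_index ?list_mem.
- move=> x; have xs : index x s < size s by rewrite index_mem list_mem.
  have szW : size (enum W) = size (enum W') by rewrite -!cardE.
  have mem_lt (S : finType) (A : {set S}) z0 i : i < #|S| ->
      (nth z0 (enum A ++ enum (~: A)) i \in A) = (i < size (enum A)).
    move=> iS; rewrite nth_cat; case: ltnP => iA.
      by rewrite -mem_enum mem_nth.
    have : nth z0 (enum (~: A)) (i - size (enum A)) \in enum (~: A).
      rewrite mem_nth // ltn_subLR // -size_cat list_size //.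
    by rewrite mem_enum inE => /negbTE.
  rewrite -[in RHS](nth_index x0 (list_mem _ W x)) !mem_lt ?szW //.
    by rewrite -(list_size _ W).
  by rewrite -(list_size _ W') -szs.
Qed.

Lemma gdd_decomposable (I T : finType) (W : {set T}) r g w :
  gdd I r g w -> #|T| = g -> #|W| = w -> decomposable (@multipartite I T W) r.
Proof.
move=> [T0 [W0 [<- <- dec]]] eT eW.
have [f [f' [fK f'K fW]]] := bij_setP (esym eT) (esym eW).
apply: (decomposable_bij (f := fun p : I * T0 => (p.1, f p.2))
  (f' := fun p : I * T => (p.1, f' p.2)) _ _ _ dec).
- by move=> [i x] /=; rewrite fK.
- by move=> [i x] /=; rewrite f'K.
- by move=> [i x] [j y]; rewrite /multipartite /= !fW.
Qed.

(** The pairs left uncovered are exactly those inside the hole, and the small design placed on the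
    hole covers them. *)
Lemma gdd_fill (I : finType) r g w : gdd I r g w -> gdd I r w 0 -> gdd I r g 0.
Proof.
move=> [T [W [cT cW [Phi [Pr Padj Pex Puniq]]]]] gddW.
have [|Psi [Sr Sadj Sex Suniq]] :=
    @gdd_decomposable I {x | x \in W} set0 _ _ _ gddW _ (cards0 _).
  by rewrite card_sig.
pose f (p : I * {x | x \in W}) := (p.1, val p.2).
have finj : injective f by move=> [i x] [j y] [-> /val_inj->].
exists T, set0; split=> //; first exact: cards0.
exists (fun X => Phi X \/ exists2 Y, Psi Y & X = f @: Y); split.
- by move=> X [/Pr //|[Y /Sr <- ->]]; rewrite card_imset.
- move=> X u v [PX uX vX uv|[Y SY ->]].
    by have /andP[] := Padj X u v PX uX vX uv; rewrite /multipartite !inE /= => ->.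
  move=> /imsetP[p pY ->] /imsetP[q qY ->]; rewrite (inj_eq finj) => pq.
  have := Sadj _ _ _ SY pY qY pq.
  by rewrite /multipartite !inE /=.
- move=> [i x] [j y]; rewrite /multipartite !inE /= andbT => ij.
  case: (boolP ((x \in W) && (y \in W))) => [/andP[xW yW]|xyW].
    have [|X [SX iX jX]] := Sex (i, Sub x xW) (j, Sub y yW).
      by rewrite /multipartite /= ij !inE.
    exists (f @: X); split; first by right; exists X.
      by apply/imsetP; exists (i, Sub x xW); rewrite // /f /= SubK.
    by apply/imsetP; exists (j, Sub y yW); rewrite // /f /= SubK.
  have [|X [PX iX jX]] := Pex (i, x) (j, y); first by rewrite /multipartite ij.
  by exists X; split=> //; left.
- have aux X Y u v : Phi X -> Psi Y -> u != v -> u \in X -> v \in X ->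
      u \in f @: Y -> v \in f @: Y -> X = f @: Y.
    move=> PX SY uv uX vX /imsetP[p pY up] /imsetP[q qY vq].
    have /andP[_] := Padj _ _ _ PX uX vX uv.
    by rewrite up vq /= (valP p.2) (valP q.2).
  move=> X Y u v [PX|[X' SX ->]] [PY|[Y' SY ->]] uv uX vX uY vY.
  + exact: Puniq PX PY uv uX vX uY vY.
  + exact: aux PX SY uv uX vX uY vY.
  + by symmetry; apply: aux PY SX uv uY vY uX vX.
  + suff -> : X' = Y' by []; move: uX vX uY vY uv => /imsetP[p pX ->] /imsetP[q qX ->].
    rewrite !(mem_imset _ _ finj) (inj_eq finj) => pY qY pq.
    by apply: (Suniq X' Y' p q).
Qed.

(** A block meets each group at most once, so a single array with columns indexed by the groups
    serves all blocks: a row [f] lifts a block by attaching the symbol [f i] to its point in group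
    [i]. *)
Lemma gdd_inflate (I : finType) r g w t : gdd I r g w -> oa I t -> gdd I r (g * t) (w * t).
Proof.
move=> [T [W [<- <- [Phi [Pr Padj Pex Puniq]]]]] [S [A [<- Aex Auniq]]].
exists (T * S)%type, (setX W [set: S]); split.
- exact: card_prod.
- by rewrite cardsX cardsT.
pose emb (f : {ffun I -> S}) (p : I * T) := (p.1, (p.2, f p.1)).
have emb_inj f : injective (emb f) by move=> [i x] [j y] [-> -> _].
have memE f (X : {set I * T}) i x s : ((i, (x, s)) \in emb f @: X) = ((i, x) \in X) && (s == f i).
  apply/imsetP/andP => [[[j y] jyX [-> -> ->]]|[ixX /eqP->]]; first by [].
  by exists (i, x).
exists (fun X => exists f Y, [/\ A f, Phi Y & X = emb f @: Y]); split.
- by move=> _ [f [Y [_ /Pr <- ->]]]; rewrite card_imset.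
- move=> _ _ _ [f [Y [Af PY ->]]] /imsetP[p pY ->] /imsetP[q qY ->].
  rewrite (inj_eq (@emb_inj f)) => pq; have := Padj _ _ _ PY pY qY pq.
  by rewrite /multipartite /= !inE !andbT.
- move=> [i [x s]] [j [y s']]; rewrite /multipartite !inE /= !andbT => /andP[ij xy].
  have [f [Af fi fj]] := Aex i j s s' ij.
  have [|X [PX iX jX]] := Pex (i, x) (j, y); first by rewrite /multipartite ij.
  by exists (emb f @: X); split; [exists f, X | rewrite memE iX fi eqxx | rewrite memE jX fj eqxx].
- move=> _ _ [i [x s]] [j [y s']] [f [X [Af PX ->]]] [f' [X' [Af' PX' ->]]] uv.
  rewrite !memE => /andP[ix /eqP sfi] /andP[jy /eqP sfj] /andP[ix' /eqP sfi'] /andP[jy' /eqP sfj'].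
  have nij : (i, x) != (j, y).
    by apply: contraNneq uv => -[ei ex]; rewrite ex sfi sfj ei.
  have /andP[/= ij _] := Padj _ _ _ PX ix jy nij.
  rewrite (Puniq _ _ _ _ PX PX' nij ix jy ix' jy').
  apply: eq_imset => -[l z]; rewrite /emb /=.
  by rewrite (Auniq f f' i j) //; congruence.
Qed.

Definition oa_on (I T : finType) (Phi : {ffun I -> T} -> Prop) : Prop :=
  (forall i i' x x', i != i' -> exists f, [/\ Phi f, f i = x & f i' = x'])
  /\ (forall f f' i i', Phi f -> Phi f' -> i != i' ->
        f i = f' i -> f i' = f' i' -> f = f').

Lemma oa_map (I I' T T' : finType) (e : I' -> I) (g : T -> T') (g' : T' -> T) Phi :
  injective e -> cancel g g' -> cancel g' g -> @oa_on I T Phi ->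
  exists Phi', @oa_on I' T' Phi'.
Proof.
move=> einj gK g'K [ex uq].
exists (fun f' => exists2 f, Phi f & f' = [ffun i => g (f (e i))]); split.
- move=> i i' x x' ii'; have [|f [Pf fi fi']] := ex (e i) (e i') (g' x) (g' x').
    by rewrite (inj_eq einj).
  exists [ffun i => g (f (e i))]; split; first by exists f.
    by rewrite ffunE fi g'K.
  by rewrite ffunE fi' g'K.
- move=> _ _ i i' [f Pf ->] [f' Pf' ->] ii'; rewrite !ffunE => /(can_inj gK) fi /(can_inj gK) fi'.
  by rewrite (uq f f' (e i) (e i')) // (inj_eq einj).
Qed.

Lemma oaP (I T : finType) t : oa I t -> #|T| = t -> exists Phi, @oa_on I T Phi.
Proof.
move=> [S [Phi [<- ex uq]]] eST.
have [f [f' [fK f'K _]]] := @bij_setP _ _ set0 set0 (esym eST) (etrans (cards0 _) (esym (cards0 _))).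
exact: (@oa_map I I S T id f f' Phi).
Qed.

Lemma oaI (I T : finType) Phi : @oa_on I T Phi -> oa I #|T|.
Proof. by case=> ex uq; exists T, Phi. Qed.

Lemma oa_le (I I' : finType) t : #|I'| <= #|I| -> oa I t -> oa I' t.
Proof.
move=> le_I' [T [Phi [<- ex uq]]].
pose e (i : I') := enum_val (widen_ord le_I' (enum_rank i)).
have einj : injective e.
  by move=> i j /enum_val_inj/(congr1 val)/= /val_inj/enum_rank_inj.
by have [Phi' /oaI] := @oa_map I I' T T e id id Phi einj (fun=> erefl) (fun=> erefl) (conj ex uq).
Qed.

(** MacNeish's product: both arrays are used coordinatewise. *)
Lemma oa_prod (I : finType) t t' : oa I t -> oa I t' -> oa I (t * t').
Proof.
move=> [T [Phi [<- ex uq]]] [T' [Phi' [<- ex' uq']]]; rewrite -card_prod.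
apply: (@oaI I _ (fun f => Phi [ffun i => (f i).1] /\ Phi' [ffun i => (f i).2])); split.
  move=> i i' [x y] [x' y'] ii'.
  have [f [Pf fi fi']] := ex i i' x x' ii'; have [g [Pg gi gi']] := ex' i i' y y' ii'.
  exists [ffun i => (f i, g i)]; rewrite !ffunE fi fi' gi gi'; split=> //; split.
    by congr (Phi _): Pf; apply/ffunP => l; rewrite !ffunE.
  by congr (Phi' _): Pg; apply/ffunP => l; rewrite !ffunE.
move=> f f' i i' [P1 P2] [P1' P2'] ii' fi fi'.
have e1 := uq _ _ _ _ P1 P1' ii'; have e2 := uq' _ _ _ _ P2 P2' ii'.
rewrite !ffunE fi fi' in e1, e2.
apply/ffunP => l; have /ffunP/(_ l) := e1 erefl erefl; have /ffunP/(_ l) := e2 erefl erefl.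
by rewrite !ffunE; case: (f l) (f' l) => [a b] [c d] /= -> ->.
Qed.

(** Wilson's construction. Columns [Some i] are the groups, each symbol being blown up to [M]
    points; a symbol [h] of the extra column [None] is replaced by [w h] hole points in every group.
    Over a row [f] one places the ingredient with hole size [w (f None)], and the column [None] as a
    whole becomes the new hole. *)
Lemma gdd_wilson (I H : finType) r M (w : H -> nat) :
  oa (option I) #|H| -> (forall h, gdd I r (M + w h) (w h)) ->
  gdd I r (M * #|H| + \sum_h w h) (\sum_h w h).
Proof.
move=> /oaP-/(_ H erefl)[A [Aex Auniq]] D.
pose hole a b := [set x : 'I_a + 'I_b | if x is inr _ then true else false].
have Dh h : decomposable (@multipartite I _ (hole M (w h))) r.
  apply: gdd_decomposable (D h) _ _; first by rewrite card_sum !card_ord.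
  have -> : hole M (w h) = inr @: [set: 'I_(w h)].
    apply/setP => -[x|x]; rewrite !inE; symmetry; first by apply/imsetP => -[].
    exact: imset_f.
  by rewrite card_imset ?cardsT ?card_ord // => x y [].
have {Dh}[Phi Dh] := fin_all_exists Dh.
pose T := ('I_M * H + {h : H & 'I_(w h)})%type.
pose W := [set x : T | if x is inr _ then true else false].
pose emb (f : {ffun option I -> H}) (p : I * ('I_M + 'I_(w (f None)))) : I * T :=
  (p.1, match p.2 with inl x => inl (x, f (Some p.1)) | inr z => inr (Tagged (fun h => 'I_(w h)) z) end).
have tag_inj h : injective (@Tagged H h (fun h => 'I_(w h))).
  by move=> x y /eqP; rewrite eq_Tagged => /eqP.
have emb_inj f : injective (@emb f).
  by move=> [i [x|x]] [j [y|y]] [] //; [move=> -> -> | move=> -> /tag_inj ->].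
exists T, W; split.
- rewrite card_sum card_prod card_ord card_tagged sumnE big_map big_enum /=.
  by congr (_ + _); apply: eq_bigr => h _; rewrite card_ord.
- have -> : W = inr @: [set: {h : H & 'I_(w h)}].
    apply/setP => -[x|x]; rewrite !inE; symmetry; first by apply/imsetP => -[].
    exact: imset_f.
  rewrite card_imset; last by move=> x y [].
  rewrite cardsT card_tagged sumnE big_map big_enum /=.
  by apply: eq_bigr => h _; rewrite card_ord.
exists (fun Y => exists f X, [/\ A f, Phi (f None) X & Y = @emb f @: X]); split.
- move=> _ [f [X [_ PX ->]]]; rewrite (card_imset _ (@emb_inj f)).
  by have [Dr _ _ _] := Dh (f None); apply: Dr.
- move=> _ _ _ [f [X [_ PX ->]]] /imsetP[p pX ->] /imsetP[q qX ->].
  rewrite (inj_eq (@emb_inj f)) => pq; have [_ Dadj _ _] := Dh (f None).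
  have := Dadj _ _ _ PX pX qX pq; rewrite /multipartite !inE /=.
  by case: p.2 => ?; case: q.2.
- have ex_block f i j x y : A f -> multipartite (hole M (w (f None))) (i, x) (j, y) ->
      exists X, [/\ exists g Y, [/\ A g, Phi (g None) Y & X = @emb g @: Y],
        @emb f (i, x) \in X & @emb f (j, y) \in X].
    move=> Af ijxy; have [_ _ Dex _] := Dh (f None).
    have [X [PX ix jy]] := Dex _ _ ijxy.
    by exists (@emb f @: X); split; [exists f, X | exact: imset_f | exact: imset_f].
  move=> [i [[x c]|[h z]]] [j [[y d]|[h' z']]]; rewrite /multipartite !inE /= ?andbT ?andbF // => ij.
  + have [f [Af fi fj]] := Aex (Some i) (Some j) c d ij.
    rewrite -fi -fj; apply: (ex_block f i j (inl x) (inl y)) => //.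
    by rewrite /multipartite ij !inE.
  + have [f [Af fi fj]] := Aex (Some i) None c h' isT; subst.
    apply: (ex_block f i j (inl x) (inr z')) => //.
    by rewrite /multipartite ij !inE.
  + have [f [Af fi fj]] := Aex None (Some j) h d isT; subst.
    apply: (ex_block f i j (inr z) (inl y)) => //.
    by rewrite /multipartite ij !inE.
- move=> _ _ u v [f [X [Af PX ->]]] [f' [X' [Af' PX' ->]]] uv.
  move=> /imsetP[[i x] iX eu] /imsetP[[j y] jX ev] /imsetP[[i' x'] iX' eu'] /imsetP[[j' y'] jX' ev'].
  have [_ Dadj _ Duniq] := Dh (f None).
  have nij : (i, x) != (j, y) by apply: contraNneq uv => e; rewrite eu ev e.
  have := Dadj _ _ _ PX iX jX nij; rewrite /multipartite !inE /= => /andP[ij xy].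
  have ei : i' = i by move: eu'; rewrite eu => -[].
  have ej : j' = j by move: ev'; rewrite ev => -[].
  subst i' j'.
  have coord l a b : @emb f (l, a) = @emb f' (l, b) ->
      let c := if a is inl _ then Some l else None in f c = f' c.
    by case: a => a; case: b => b [] // ? ?.
  (* An ordinary point of group [i] fixes the row at column [Some i], a hole point fixes it at
     [None]. The two columns differ, since the groups differ and the points are not both in the
     hole. *)
  have ff' : f = f'.
    apply: (Auniq f f' (if x is inl _ then Some i else None) (if y is inl _ then Some j else None)) => //.
    - by case: (x) (y) xy => [?|?] [?|?].
    - by apply: (coord _ _ x'); rewrite -eu.
    - by apply: (coord _ _ y'); rewrite -ev.
  subst f'.
  have -> // : X = X'.
  have ex : (i, x) = (i, x') by apply: (@emb_inj f); rewrite -eu.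
  have ey : (j, y) = (j, y') by apply: (@emb_inj f); rewrite -ev.
  by apply: (Duniq _ _ _ _ PX PX' nij iX jX); rewrite ?ex ?ey.
Qed.

(** The rows are the affine functions evaluated at the points [a i]; invertible differences make two
    values determine the function. *)
Lemma oa_ring (I : finType) (R : finComUnitRingType) (a : I -> R) :
  (forall i j, i != j -> (a i - a j)%R \is a GRing.unit) -> oa I #|R|.
Proof.
move=> au.
apply: (@oaI I R (fun f => exists b c, f = [ffun i => b + c * a i]%R)); split.
- move=> i j x y ij; have uij := au i j ij.
  pose c := ((x - y) / (a i - a j))%R.
  exists [ffun l => (x - c * a i) + c * a l]%R; split; first by exists (x - c * a i)%R, c.
    by rewrite ffunE subrK.
  have e : (c * (a i - a j) = x - y)%R by rewrite divrK.
  have ey : (x - c * a i + c * a j = x - c * (a i - a j))%R by ring.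
  by rewrite ffunE ey e subKr.
- move=> _ _ i j [b [c ->]] [b' [c' ->]] ij; rewrite !ffunE => e1 e2.
  have e : ((c - c') * (a i - a j) = 0)%R.
    transitivity ((b + c * a i) - (b + c * a j) - ((b' + c' * a i) - (b' + c' * a j)))%R; first by ring.
    by rewrite e1 e2 subrr.
  have /eqP : (c - c' = 0)%R by rewrite -[LHS](mulrK (au i j ij)) e mul0r.
  rewrite subr_eq0 => /eqP cc'; subst c'.
  by move/addIr: e1 => ->.
Qed.

Lemma oa1 (I : finType) : oa I 1.
Proof.
rewrite -card_unit; apply: (@oaI I _ (fun=> True)); split=> [i j [] [] _|f f' *].
  by exists [ffun=> tt]; rewrite !ffunE.
by apply/ffunP => l; case: (f l) (f' l) => [] [].
Qed.

Lemma oa_prime_power (I : finType) p k : prime p -> 0 < k -> #|I| <= p ^ k -> oa I (p ^ k).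
Proof.
move=> pp k0 le_I; have [F _ cF] := pPrimePowerField pp k0.
rewrite -cF in le_I *.
apply: (@oa_ring I F (fun i => enum_val (widen_ord le_I (enum_rank i)))) => i j ij.
rewrite unitfE subr_eq0; apply: contra ij.
by move=> /eqP/enum_val_inj/(congr1 val) /= /val_inj/enum_rank_inj->.
Qed.

(** MacNeish's theorem: prime power parts are split off one at a time and recombined by
    [oa_prod]. *)
Lemma oa_partn (I : finType) n :
  0 < n -> (forall p, prime p -> p %| n -> #|I| <= n`_p) -> oa I n.
Proof.
elim/ltn_ind: n => n IH n0 np.
case: (ltngtP n 1) => [|n1|->]; [by lia| |exact: oa1].
have pp := pdiv_prime n1; have pn := pdiv_dvd n; set p := pdiv n in pp pn.
rewrite -(partnC p n0); apply: oa_prod.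
  rewrite p_part; apply: oa_prime_power => //; first by rewrite logn_gt0 mem_primes pp n0 pn.
  by rewrite -p_part np.
have lt1 : 1 < n`_p by rewrite p_part -(expn0 p) ltn_exp2l ?prime_gt1 // logn_gt0 mem_primes pp n0 pn.
apply: IH; rewrite ?part_gt0 //.
  by rewrite -[X in _ < X](partnC p n0) ltn_Pmull ?part_gt0.
move=> q pq qn; have qn' : q %| n by apply: dvdn_trans qn (dvdn_part _ _).
rewrite partn_part ?np // => x; rewrite !inE => /eqP->.
apply: contraTN qn => /eqP->; rewrite -prime_coprime //.
exact: pnat_coprime (pnat_id pp) (part_pnat _ _).
Qed.

(** A block with as many points as there are groups meets every group exactly once, so it is the
    graph of a function. *)
Lemma oa_of_gdd (I : finType) g : gdd I #|I| g 0 -> oa I g.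
Proof.
move=> [T [W [<- /cards0_eq-> [Phi [Pr Padj Pex Puniq]]]]].
have graphP X : Phi X -> exists f : {ffun I -> T}, X = [set (i, f i) | i : I].
  move=> PX.
  have fst_inj : {in X &, injective fst}.
    move=> [i x] [j y] iX jX /= eij; apply/eqP; apply: contraT => nij.
    by have := Padj _ _ _ PX iX jX nij; rewrite /multipartite /= eij eqxx.
  have surj i : exists x, (i, x) \in X.
    have /eqP : fst @: X = [set: I].
      by apply/eqP; rewrite eqEcard subsetT card_in_imset // (Pr _ PX) cardsT leqnn.
    by move/eqP/setP/(_ i); rewrite inE => /imsetP[[j x] jX ->]; exists x.
  have [f fX] := fin_all_exists surj.
  exists [ffun i => f i]; apply/setP => -[i x]; apply/idP/imsetP => [iX|[j _ [-> ->]]].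
    by exists i => //; rewrite ffunE; apply: fst_inj.
  by rewrite ffunE.
apply: (@oaI I T (fun f => Phi [set (i, f i) | i : I])); split.
- move=> i j x y ij; have [|X [PX iX jX]] := Pex (i, x) (j, y).
    by rewrite /multipartite ij !inE.
  have [f eX] := graphP X PX; exists f; rewrite -eX; split=> //.
    by move: iX; rewrite eX => /imsetP[l _ [-> ->]].
  by move: jX; rewrite eX => /imsetP[l _ [-> ->]].
- move=> f f' i j Pf Pf' ij fi fj.
  have : [set (i, f i) | i : I] = [set (i, f' i) | i : I].
    apply: (Puniq _ _ (i, f i) (j, f j)) => //; rewrite ?imset_f //.
    + by rewrite xpair_eqE negb_and ij.
    + by rewrite fi imset_f.
    + by rewrite fj imset_f.
  move=> e; apply/ffunP => l.
  have : (l, f l) \in [set (i, f' i) | i : I] by rewrite -e imset_f.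
  by case/imsetP => l' _ [-> ->].
Qed.

Lemma gdd_of_oa_hole (I : finType) g :
  1 < #|I| -> 0 < g -> oa I g -> gdd I #|I| g 1.
Proof.
move=> I1 g0 [T [Phi [cT ex uq]]].
have [z _] : exists z : T, true.
  by case: (pickP T) => [z _|T0]; [exists z | rewrite -cT eq_card0 in g0].
have [i0 [j0 ij0]] : exists i j : I, i != j.
  have [i _] : exists i : I, true.
    by case: (pickP I) => [z' _|T0]; [exists z' | rewrite eq_card0 in I1].
  case: (pickP (predC1 i)) => [j ji|ni]; first by exists j, i.
  by have := cardC1 i; rewrite eq_card0 //; lia.
have [f0 [Pf0 _ _]] := ex i0 j0 z z ij0.
(* Relabel the symbols columnwise so that the row [f0] becomes constant: it is
   the row to be deleted. *)
pose s i (x : T) := if x == f0 i then z else if x == z then f0 i else x.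
have sK i : involutive (s i).
  move=> x; rewrite /s; case: (x =P f0 i) => [->|/eqP xf].
    by rewrite eqxx; case: eqP.
  case: (x =P z) => [->|/eqP xz]; first by rewrite eqxx.
  by rewrite (negbTE xf) (negbTE xz).
have sinj i : injective (s i) := inv_inj (sK i).
have sf0 i : s i (f0 i) = z by rewrite /s eqxx.
exists T, [set z]; split; rewrite ?cards1 //.
have memE (f : {ffun I -> T}) i x :
    ((i, x) \in [set (l, s l (f l)) | l : I]) = (x == s i (f i)).
  by apply/imsetP/eqP => [[l _ [-> ->]]|->] //; exists i.
exists (fun X => exists f, [/\ Phi f, f != f0 & X = [set (i, s i (f i)) | i : I]]); split.
- by move=> _ [f [_ _ ->]]; rewrite card_imset ?cardsT // => i j [].
- move=> _ [i x] [j y] [f [Pf nf ->]]; rewrite !memE => /eqP-> /eqP->.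
  rewrite xpair_eqE negb_and => ijf.
  have ij : i != j by case: eqP ijf => //= ->; rewrite eqxx.
  rewrite /multipartite ij /= !inE -(sf0 i) (inj_eq (sinj i)) (sf0 i) -(sf0 j) (inj_eq (sinj j)).
  by apply: contra nf => /andP[/eqP fi /eqP fj]; rewrite (uq f f0 i j).
- move=> [i x] [j y]; rewrite /multipartite /= !inE => /andP[ij nxy].
  have [f [Pf fi fj]] := ex i j (s i x) (s j y) ij.
  exists [set (l, s l (f l)) | l : I]; rewrite !memE fi fj !sK !eqxx; split=> //.
  exists f; split=> //; apply: contra nxy => /eqP ef.
  by rewrite -[x](sK i) -[y](sK j) -fi -fj ef !sf0 !eqxx.
- move=> _ _ [i x] [j y] [f [Pf _ ->]] [f' [Pf' _ ->]]; rewrite !memE => uv.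
  move=> /eqP ex1 /eqP ey1 /eqP ex2 /eqP ey2.
  have ij : i != j.
    by apply: contraNneq uv => eij; rewrite ex1 ey1 eij.
  by rewrite (uq f f' i j) //; [apply: (sinj i); rewrite -ex1 | apply: (sinj j); rewrite -ey1].
Qed.

Lemma gdd_of_oa (I : finType) g : oa I g -> gdd I #|I| g 0.
Proof.
move=> [T [Phi [cT ex uq]]]; exists T, set0; split; rewrite ?cards0 //.
have memE (f : {ffun I -> T}) i x : ((i, x) \in [set (l, f l) | l : I]) = (x == f i).
  by apply/imsetP/eqP => [[l _ [-> ->]]|->] //; exists i.
exists (fun X => exists2 f : {ffun I -> T}, Phi f & X = [set (i, f i) | i : I]); split.
- by move=> _ [f _ ->]; rewrite card_imset ?cardsT // => i j [].
- move=> _ [i x] [j y] [f Pf ->]; rewrite !memE => /eqP-> /eqP->.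
  rewrite /multipartite !inE andbT xpair_eqE negb_and.
  by case: eqP => //= ->; rewrite eqxx.
- move=> [i x] [j y]; rewrite /multipartite !inE andbT /= => ij.
  have [f [Pf fi fj]] := ex i j x y ij.
  by exists [set (l, f l) | l : I]; rewrite !memE fi fj; split=> //; exists f.
- move=> _ _ [i x] [j y] [f Pf ->] [f' Pf' ->]; rewrite !memE => uv.
  move=> /eqP ex1 /eqP ey1 /eqP ex2 /eqP ey2.
  have ij : i != j by apply: contraNneq uv => eij; rewrite ex1 ey1 eij.
  by rewrite (uq f f' i j) //; congruence.
Qed.

Lemma oa_large_parts s n :
  0 < n -> (forall p, prime p -> p <= s -> p %| n -> p ^ s %| n) -> oa 'I_s n.
Proof.
move=> n0 np; apply: oa_partn => // p pp pn; rewrite card_ord.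
have [ps|sp] := leqP p s; last first.
  rewrite p_part (leq_trans (ltnW sp)) // -[X in X <= _]expn1 leq_exp2l ?prime_gt1 //.
  by rewrite logn_gt0 mem_primes pp n0.
have := np p pp ps pn; rewrite p_part pfactor_dvdn // => sl.
apply: (leq_trans (ltnW (ltn_expl s (prime_gt1 pp)))).
by rewrite leq_exp2l ?prime_gt1.
Qed.

(* Wilson's proof of the Chowla-Erdos-Straus theorem: write n = m t + u with
   u <= t where m, m + 1, t, u are all products of large prime powers. *)
Theorem oa_eventually s : exists N, forall n, N <= n -> oa 'I_s n.
Proof.
wlog s1 : s / 1 < s.
  move=> H; case: (H s.+2 isT) => N HN; exists N => n /HN.
  by apply: oa_le; rewrite !card_ord; lia.
pose P := s.+1`!; pose Q := P ^ s.+1.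
have P0 : 0 < P by apply: fact_gt0.
have P1 : 1 < P by rewrite /P factS; have := fact_gt0 s; nia.
have Q0 : 0 < Q by rewrite expn_gt0 P0.
exists (2 * Q + 2 * Q * P * (2 * Q) + 1) => n nN.
have n0 : 0 < n by apply: leq_trans nN; rewrite addn1.
have dvP p : prime p -> p <= s.+1 -> p %| P.
  by move=> pp ps; apply: dvdn_fact; rewrite ps prime_gt0.
pose Q1 := Q`_(\pi(n)); pose Q2 := Q`_(\pi(n)^').
have cop : coprime Q1 Q2 by apply: coprime_partC.
have Q1Q2 : Q1 * Q2 = Q by apply: partnC.
(* [m] is -1 modulo [Q1] and 0 modulo [Q2]. Hence a prime up to [s.+1] divides [m.+1] if it divides
   [n], and [m] if it does not, in both cases to the power [s.+1] at least. *)
pose c := chinese Q1 Q2 Q1.-1 0; pose m := c %% Q + Q.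
have mQ1 : Q1 %| m.+1.
  have Q10 : 0 < Q1 by apply: part_gt0.
  rewrite /dvdn -addSn -modnDmr -Q1Q2 modnMr addn0 -addn1 -modnDml.
  rewrite modn_dvdm ?dvdn_mulr // chinese_modl // modnDml.
  by rewrite addn1 prednK // modnn.
have mQ2 : Q2 %| m.
  rewrite /dvdn -modnDmr -Q1Q2 modnMl addn0.
  by rewrite modn_dvdm ?dvdn_mull // chinese_modr // mod0n.
have mgt : Q <= m < 2 * Q by rewrite leq_addl mul2n -addnn ltn_add2r ltn_mod.
have [Q_le m_lt] := andP mgt; have m0 : 0 < m := leq_trans Q0 Q_le.
have m_le_n : m <= n.
  by apply: leq_trans (ltnW m_lt) (leq_trans _ nN); rewrite -addnA leq_addr.
have pQ1 p : prime p -> p <= s.+1 -> p %| n -> p ^ s.+1 %| Q1.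
  move=> pp ps pn; have pin : p \in \pi(n) by rewrite mem_primes pp n0 pn.
  have <- : (p ^ s.+1)`_(\pi(n)) = p ^ s.+1.
    by rewrite part_pnat_id // pnatX pnatE ?pin.
  by rewrite partn_dvd // dvdn_exp2r // dvP.
have pQ2 p : prime p -> p <= s.+1 -> ~~ (p %| n) -> p ^ s.+1 %| Q2.
  move=> pp ps pn; have pin : p \in \pi(n)^' by rewrite inE /= mem_primes (negbTE pn) !andbF.
  have <- : (p ^ s.+1)`_(\pi(n)^') = p ^ s.+1.
    by rewrite part_pnat_id // pnatX pnatE ?pin.
  by rewrite partn_dvd // dvdn_exp2r // dvP.
have dvd_pow p : p %| p ^ s.+1 by rewrite dvdn_exp.
have not_both p : prime p -> p %| m -> p %| m.+1 -> False.
  by move=> pp pm; rewrite -addn1 dvdn_addr // dvdn1 => /eqP p1; rewrite p1 in pp.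
have pmn p : prime p -> p <= s.+1 -> (p %| m) = ~~ (p %| n).
  move=> pp ps; apply/idP/idP => [pm|pn]; last first.
    exact: dvdn_trans (dvdn_trans (dvd_pow p) (pQ2 p pp ps pn)) mQ2.
  apply/negP => pn; apply: (not_both p pp pm).
  exact: dvdn_trans (dvdn_trans (dvd_pow p) (pQ1 p pp ps pn)) mQ1.
(* [t] is prime to all primes up to [s.+1], and [j] is the largest value with [m * t <= n], so the
   remainder is below [m * P]. The threshold on [n] was chosen to force [m <= j], which turns this
   into [u <= t]. *)
pose j := (n - m) %/ (m * P); pose t := 1 + P * j.
have mP0 : 0 < m * P by rewrite muln_gt0 m0.
have jlo : j * (m * P) <= n - m := leq_divM _ _.
have jhi : n - m < j.+1 * (m * P) by rewrite -ltn_divLR.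
have mtE : m * t = m + j * (m * P) by rewrite /t; lia.
have uhi : n - m * t < m * P by rewrite mtE subnDA ltn_subLR // addnC -mulSn.
have mj : m <= j.
  rewrite leq_divRL //.
  have : m * (m * P) <= 2 * Q * (2 * Q * P) by rewrite !leq_mul // ltnW.
  have -> : 2 * Q * (2 * Q * P) = 2 * Q * P * (2 * Q) by rewrite mulnC.
  move=> le_Q; rewrite leq_subRL //; apply: leq_trans nN.
  by rewrite -addnA leq_add ?(ltnW m_lt) // addn1 leqW.
have mtn : m * t <= n by rewrite mtE -leq_subRL.
pose u := n - m * t.
have ut : u <= t.
  apply: leq_trans (ltnW uhi) _; rewrite /t (leq_trans _ (leqnSn _)) // mulnC leq_mul //.
have tP p : prime p -> p <= s.+1 -> ~~ (p %| t).
  move=> pp ps; apply/negP; rewrite /t addnC dvdn_addr ?dvdn1.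
    by move=> /eqP p1; rewrite p1 in pp.
  by rewrite dvdn_mulr // dvP.
have nE : n = m * t + u by rewrite subnKC.
(* A small prime divides exactly one of [m] and [n] and never divides [t], so it cannot divide
   [n - m * t]. *)
have uP p : prime p -> p <= s.+1 -> ~~ (p %| u).
  move=> pp ps; apply/negP => pu.
  have : (p %| n) = (p %| m).
    by rewrite nE dvdn_addl // Euclid_dvdM // (negbTE (tP p pp ps)) orbF.
  by rewrite pmn //; case: (p %| n).
(* Being odd, [u] is nonzero. *)
have u0 : 0 < u by have := uP 2 isT (leqW s1); case: (u).
have oat : oa (option 'I_s) t.
  apply: (@oa_le 'I_s.+1); first by rewrite card_option !card_ord.
  apply: oa_large_parts => // p pp ps pt.
  by have := tP p pp ps; rewrite pt.
have oau : oa 'I_s u.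
  apply: oa_large_parts => // p pp ps pu.
  by have := uP p pp (leqW ps); rewrite pu.
have oam : oa 'I_s m.
  apply: oa_large_parts => // p pp ps pm.
  rewrite (pmn p pp (leqW ps)) in pm.
  by apply: dvdn_trans (dvdn_trans (pQ2 p pp (leqW ps) pm) mQ2); rewrite dvdn_exp2l.
have oam1 : oa 'I_s m.+1.
  apply: oa_large_parts => // p pp ps pm.
  have pn : p %| n.
    by rewrite -[p %| n]negbK -(pmn p pp (leqW ps)); apply/negP => /(not_both p pp)/(_ pm).
  by apply: dvdn_trans (dvdn_trans (pQ1 p pp (leqW ps) pn) mQ1); rewrite dvdn_exp2l.
have := @gdd_wilson 'I_s 'I_t s m (fun h => (h < u) : nat); rewrite card_ord => /(_ oat).
have -> : \sum_(h < t) ((h < u) : nat) = u.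
  rewrite -big_mkcond /= sum1_card; transitivity #|[set widen_ord ut i | i : 'I_u]|.
    apply: eq_card => h; apply/idP/imsetP => [hu|[i _ ->]]; last exact: (ltn_ord i).
    by exists (Ordinal (hu : h < u)) => //; apply: val_inj.
  rewrite card_imset; first by rewrite card_ord.
  by move=> i i' e; apply: val_inj; have := congr1 val e.
move=> W; have card_s : #|'I_s| = s by rewrite card_ord.
have /gdd_fill : gdd 'I_s s (m * t + u) u.
  apply: W => h; case: (h < u).
    by rewrite addn1 -[X in gdd _ X]card_s; apply: gdd_of_oa_hole; rewrite ?card_ord.
  by rewrite addn0 -[X in gdd _ X]card_s; apply: gdd_of_oa.
rewrite -nE -[X in gdd _ X]card_s => fill.
by apply: oa_of_gdd; apply: fill; apply: gdd_of_oa.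
Qed.

(** * Decomposing a blow-up of a complete multipartite graph *)

Lemma numbering (J K : finType) (A : {set J}) (c0 : K) : #|A| = #|K| ->
  exists p : J -> K, {in A &, injective p} /\ forall c, exists2 j, j \in A & p j = c.
Proof.
move=> AK; have idx j : j \in A -> index j (enum A) < size (enum K).
  by rewrite -cardE -AK cardE index_mem mem_enum.
exists (fun j => nth c0 (enum K) (index j (enum A))); split.
  move=> j j' jA j'A /eqP; rewrite nth_uniq ?enum_uniq ?idx // => /eqP e.
  by rewrite -[j](nth_index j (s := enum A)) ?mem_enum // e nth_index ?mem_enum.
move=> c; have [j0 j0A] : exists j, j \in A.
  by apply/card_gt0P; rewrite AK; apply/card_gt0P; exists c0.
have cA : index c (enum K) < size (enum A) by rewrite -cardE AK cardE index_mem mem_enum.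
exists (nth j0 (enum A) (index c (enum K))); first by rewrite -mem_enum mem_nth.
by rewrite index_uniq ?enum_uniq // nth_index ?mem_enum.
Qed.

(** * Index reduction: from a decomposition covering each edge #|K| times to an exact one on a
    blow-up *)

Section IndexReduction.
Local Open Scope ring_scope.
Variables (V J : finType) (K : finComUnitRingType) (adj : rel V) (r : nat).
Variables (bl : J -> {set V}) (iota : V -> K).
Hypothesis adj_irr : irreflexive adj.
Hypothesis bl_card : forall j, #|bl j| = r.
Hypothesis bl_adj : forall j u v, u \in bl j -> v \in bl j -> u != v -> adj u v.
Hypothesis bl_count : forall u v, adj u v -> #|[set j | (u \in bl j) && (v \in bl j)]| = #|K|.
Hypothesis iota_unit : forall x, iota x \is a GRing.unit.
Hypothesis iotaB_unit : forall x y, x != y -> iota x - iota y \is a GRing.unit.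

Let E := {f : {set V} | #|f| == 2%N}.

(* A block [j] is lifted to the blocks {(x, theta(-, x) z + c_j(-, x) + b)}, with
   z ranging over the vectors of K^E of sum zero and b over K^E.  For an edge
   f = {u, v} the f-coordinate of the difference of the labels of u and v only
   depends on [j], and it runs over K when [j] runs over the blocks through f;
   the other coordinates then determine z. *)
Let theta (f : E) x : K := if x \in val f then 0 else iota x.
Let shift (p : E -> J -> K) j (f : E) x : K :=
  if [pick y in val f] == Some x then p f j else 0.
Let lab p j (z b : {ffun E -> K}) x : {ffun E -> K} :=
  [ffun f => theta f x * z f + shift p j f x + b f].

Lemma index_reduction :
  decomposable (fun q q' : V * {ffun E -> K} => adj q.1 q'.1) r.
Proof.
have edge u v : adj u v -> #|[set u; v]| == 2%N.
  by rewrite cards2; case: (u =P v) => // ->; rewrite adj_irr.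
have [p [p_inj p_surj]] : exists p : E -> J -> K,
    (forall u v (uv : #|[set u; v]| == 2%N), adj u v -> {in [set j | (u \in bl j) && (v \in bl j)] &, injective (p (Sub [set u; v] uv))})
    /\ (forall u v (uv : #|[set u; v]| == 2%N), adj u v -> forall c, exists2 j, (u \in bl j) && (v \in bl j) & p (Sub [set u; v] uv) j = c).
  have ex (f : E) : exists pf : J -> K, #|[set j | val f \subset bl j]| = #|K| ->
      {in [set j | val f \subset bl j] &, injective pf} /\ forall c, exists2 j, j \in [set j | val f \subset bl j] & pf j = c.
    case: (altP (#|[set j | val f \subset bl j]| =P #|K|)) => [e|ne].
      by have [pf ?] := numbering 0 e; exists pf.
    by exists (fun=> 0) => e; rewrite e eqxx in ne.
  have [p pP] := fin_all_exists ex; exists p.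
  have subE u v j : ([set u; v] \subset bl j) = (u \in bl j) && (v \in bl j).
    by rewrite subUset !sub1set.
  split=> u v uv auv; have [|inj surj] := pP (Sub [set u; v] uv).
  - by rewrite -(bl_count auv); apply: eq_card => j; rewrite !inE SubK subE.
  - by move=> j j'; rewrite !inE => jP j'P; apply: inj; rewrite inE SubK subE.
  - by rewrite -(bl_count auv); apply: eq_card => j; rewrite !inE SubK subE.
  - move=> c; have [j] := surj c; rewrite inE SubK subE => jP <-; by exists j.
(* An edge other than {u, v} omits one of the two vertices, so the difference is [iota u - iota v]
   or plus or minus a single value of [iota]. *)
have theta_unit f u v (uv : #|[set u; v]| == 2%N) : u != v -> f != (Sub [set u; v] uv : E) ->
    theta f u - theta f v \is a GRing.unit.
  move=> nuv; rewrite /theta; case: ifPn => uf; case: ifPn => vf.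
  - move=> /eqP[]; apply: val_inj; rewrite SubK; apply/esym/eqP.
    by rewrite eqEcard subUset !sub1set uf vf (eqP (valP f)) (eqP uv).
  - by rewrite sub0r unitrN iota_unit.
  - by rewrite subr0 iota_unit.
  - by rewrite iotaB_unit.
have pickE u v (uv : #|[set u; v]| == 2%N) : u != v -> exists2 e : bool,
   forall j, shift p j (Sub [set u; v] uv) u - shift p j (Sub [set u; v] uv) v = (-1) ^+ e * p (Sub [set u; v] uv) j & true.
  move=> nuv; rewrite /shift SubK; case: pickP => [y|/(_ u)]; last by rewrite !inE eqxx.
  rewrite !inE => /orP[]/eqP->.
    exists false => // j; rewrite eqxx (inj_eq Some_inj) (negbTE nuv); ring.
  exists true => // j; rewrite eqxx (inj_eq Some_inj) eq_sym (negbTE nuv); ring.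
have labE u v j z b f : lab p j z b u f - lab p j z b v f =
    (theta f u - theta f v) * z f + (shift p j f u - shift p j f v).
  by rewrite !ffunE; ring.
exists (fun X => exists j (z b : {ffun E -> K}), \sum_f z f = 0 /\ X = [set (x, lab p j z b x) | x in bl j]); split.
- by move=> _ [j [z [b [_ ->]]]]; rewrite card_imset // => x y [].
- move=> _ u v [j [z [b [_ ->]]]] /imsetP[x xj ->] /imsetP[y yj ->] /= nxy.
  by apply: bl_adj xj yj _; apply: contraNneq nxy => ->.
- move=> [u a] [v a'] /= auv.
  have nuv : u != v by apply: contraTneq auv => ->; rewrite adj_irr.
  have uv := edge _ _ auv; pose f0 : E := Sub [set u; v] uv.
  have [e shE _] := pickE u v uv nuv.
  have [j /andP[uj vj] pj] := p_surj u v uv auv ((-1) ^+ e * (a f0 - a' f0)).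
  pose z0 f := ((a f - a' f) - (shift p j f u - shift p j f v)) / (theta f u - theta f v).
  (* Since [theta f0] vanishes at both [u] and [v], the coordinate of [z] at [f0] does not affect
     their labels; it is spent on making the sum zero. *)
  pose z : {ffun E -> K} := [ffun f => if f == f0 then - \sum_(f | f != f0) z0 f else z0 f].
  pose b : {ffun E -> K} := [ffun f => a f - (theta f u * z f + shift p j f u)].
  have labu : lab p j z b u = a by apply/ffunP => f; rewrite !ffunE; ring.
  have labv : lab p j z b v = a'.
    apply/ffunP => f; suff e' : lab p j z b u f - lab p j z b v f = a f - a' f.
      by move: e'; rewrite labu => /addrI/oppr_inj.
    rewrite labE; have [->|ff0] := eqVneq f f0.
      rewrite shE pj mulrA -expr2 sqrr_sign mul1r /theta SubK !inE !eqxx orbT subr0; ring.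
    by rewrite ffunE (negbTE ff0) mulrC divrK ?theta_unit // subrK.
  exists [set (x, lab p j z b x) | x in bl j]; split.
  + exists j, z, b; split=> //; rewrite (bigD1 f0) //= ffunE eqxx.
    by rewrite [X in _ + X](eq_bigr z0) ?addNr // => f ff0; rewrite ffunE (negbTE ff0).
  + by rewrite -labu; apply: imset_f.
  + by rewrite -labv; apply: imset_f.
- move=> _ _ [u a] [v a'] [j [z [b [z0 ->]]]] [j' [z' [b' [z'0 ->]]]] uv.
  move=> /imsetP[x1 uj [e1 ea]] /imsetP[x2 vj [e2 ea']] /imsetP[x3 uj' [e3 ea1]] /imsetP[x4 vj' [e4 ea1']].
  subst x1 x2 x3 x4.
  have nuv : u != v by apply: contraNneq uv => euv; rewrite ea ea' euv.
  have auv := bl_adj uj vj nuv; have ef0 := edge _ _ auv; pose f0 : E := Sub [set u; v] ef0.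
  have diff f : (theta f u - theta f v) * z f + (shift p j f u - shift p j f v) =
     (theta f u - theta f v) * z' f + (shift p j' f u - shift p j' f v).
    by rewrite -(labE u v j z b) -(labE u v j' z' b') -ea -ea' -ea1 -ea1'.
  have [e shE _] := pickE u v ef0 nuv.
  have jj' : j = j'.
    apply: (p_inj u v ef0 auv); rewrite ?inE ?uj ?vj ?uj' ?vj' //.
    have := diff f0; rewrite !shE /theta SubK !inE !eqxx orbT subr0 !mul0r !add0r.
    by move/(congr1 (fun c => (-1) ^+ e * c)); rewrite !mulrA -expr2 sqrr_sign !mul1r.
  subst j'.
  have zz' f : f != f0 -> z f = z' f.
    move=> ff0; have := diff f; move/addIr => /(congr1 (fun c => (theta f u - theta f v)^-1 * c)).
    by rewrite !mulKr ?theta_unit.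
  have {}zz' : z = z'.
    apply/ffunP => f; have [->|] := eqVneq f f0; last exact: zz'.
    move: z0 z'0; rewrite (bigD1 f0) //= [in X in _ -> X](bigD1 f0) //=.
    rewrite (eq_bigr z') // => /eqP; rewrite addr_eq0 => /eqP-> /eqP.
    by rewrite addr_eq0 => /eqP->.
  subst z'; suff -> : b = b' by [].
  apply/ffunP => f; have /ffunP/(_ f) := ea; rewrite ea1 !ffunE => /esym.
  by move/addrI.
Qed.
End IndexReduction.

Lemma subset_card (T : finType) (U : {set T}) s : s <= #|U| ->
  exists2 K : {set T}, K \subset U & #|K| = s.
Proof.
move=> sU; exists [set x in take s (enum U)].
  by apply/subsetP => x; rewrite inE => /mem_take; rewrite mem_enum.
rewrite cardsE (card_uniqP _) ?take_uniq ?enum_uniq //.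
by rewrite size_takel // -cardE.
Qed.

(** * Edge weightings with values in an abelian group that vanish on every block *)

Section AbelianSums.
Local Open Scope ring_scope.
Variable A : zmodType.

(** Exchanging one element of an [s]-subset for another, which is possible because [s < #|U|], shows
    that [F] is constant on [U]. *)
Lemma subset_sum_const (T : finType) (U : {set T}) s (F : T -> A) : (0 < s < #|U|)%N ->
  (forall K : {set T}, K \subset U -> #|K| = s -> \sum_(l in K) F l = 0) ->
  forall a b, a \in U -> b \in U -> F a = F b /\ F a *+ s = 0.
Proof.
move=> /andP[s0 sU] F0.
have Fab a b : a \in U -> b \in U -> F a = F b.
  move=> aU bU; have [->//|ab] := eqVneq a b.
  have [|L LU cL] := @subset_card _ (U :\ a :\ b) s.-1.
    have := cardsD1 a U; have := cardsD1 b (U :\ a); rewrite !inE eq_sym ab aU bU /=; lia.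
  have aL : a \notin L by apply/negP => /(subsetP LU); rewrite !inE eqxx andbF.
  have bL : b \notin L by apply/negP => /(subsetP LU); rewrite !inE eqxx.
  have LU' : L \subset U by apply: subset_trans LU _; rewrite !(subset_trans (subsetDl _ _)) ?subsetDl.
  apply: (@addIr _ (\sum_(l in L) F l)); rewrite -!big_setU1 //.
  by rewrite !F0 ?subUset ?sub1set ?aU ?bU ?cardsU1 ?aL ?bL ?cL ?add1n ?prednK.
move=> a b aU bU; split; first exact: Fab.
have [K KU cK] := subset_card (ltnW sU).
rewrite -[RHS](F0 K KU cK) -cK -sumr_const.
by apply: eq_bigr => l lK; apply: Fab => //; apply: (subsetP KU).
Qed.

Lemma subset_sum_multiple (T : finType) (U : {set T}) s n (F : T -> A) : (0 < s <= #|U|)%N ->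
  (forall K : {set T}, K \subset U -> #|K| = s -> \sum_(l in K) F l = 0) ->
  (s %| n * #|U|)%N -> (\sum_(l in U) F l) *+ n = 0.
Proof.
move=> /andP[s0]; rewrite leq_eqVlt => /orP[/eqP sU F0 _|sU F0 div].
  by rewrite (F0 U) ?mul0rn.
have const := @subset_sum_const _ U s F (introT andP (conj s0 sU)) F0.
have /card_gt0P[a aU] : (0 < #|U|)%N by lia.
have -> : \sum_(l in U) F l = F a *+ #|U|.
  by rewrite -sumr_const; apply: eq_bigr => l lU; case: (const l a lU aU).
rewrite -mulrnA mulnC; have /dvdnP[q ->] := div.
by rewrite mulnC mulrnA; have [_ ->] := const a a aU aU; rewrite mul0rn.
Qed.

Variable k : nat.
Implicit Types (J K : {set 'I_k}) (g : 'I_k -> 'I_k -> A).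

Definition pair_sum g J : A := \sum_(i in J) \sum_(j in J) if (i < j)%N then g i j else 0.

Lemma pair_sumU1 g i K : (forall a b, g a b = g b a) -> i \notin K ->
  pair_sum g (i |: K) = pair_sum g K + \sum_(j in K) g i j.
Proof.
move=> gsym iK; rewrite /pair_sum big_setU1 //= big_setU1 //= ltnn add0r.
under [X in _ + X]eq_bigr do rewrite big_setU1 //=.
rewrite big_split /= addrA addrC; congr (_ + _); rewrite -big_split /=.
apply: eq_bigr => j jK; have ij : i != j by apply: contraNneq iK => ->.
rewrite [g j i]gsym; case: (ltngtP i j) => [_|_|/val_inj e]; rewrite ?addr0 ?add0r //.
by rewrite e eqxx in ij.
Qed.

Lemma ordered_pair_sum g J :
  \sum_(i in J) \sum_(j in J | j != i) g i j = pair_sum (fun i j => g i j + g j i) J.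
Proof.
rewrite /pair_sum.
transitivity (\sum_(i in J) \sum_(j in J) ((if (i < j)%N then g i j else 0) + (if (j < i)%N then g i j else 0))).
  apply: eq_bigr => i _; rewrite big_mkcondr; apply: eq_bigr => j _ /=.
  have [->|ji] := eqVneq j i; first by rewrite ltnn addr0.
  case: (ltngtP i j) => [_|_|/val_inj e]; rewrite ?addr0 ?add0r //.
  by rewrite e eqxx in ji.
under eq_bigr do rewrite big_split /=.
rewrite big_split /= [X in _ + X]exchange_big /= -big_split /=.
apply: eq_bigr => i _; rewrite -big_split /=; apply: eq_bigr => j _.
by case: ifP => //; rewrite addr0.
Qed.

Lemma pair_sumD g g' J : pair_sum (fun i j => g i j + g' i j) J = pair_sum g J + pair_sum g' J.
Proof.
rewrite /pair_sum -big_split; apply: eq_bigr => i _; rewrite -big_split; apply: eq_bigr => j _ /=.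
by case: ifP; rewrite ?addr0.
Qed.

Lemma pair_sumMn g n J : pair_sum (fun i j => g i j *+ n) J = pair_sum g J *+ n.
Proof.
rewrite /pair_sum -sumrMnl; apply: eq_bigr => i _; rewrite -sumrMnl; apply: eq_bigr => j _ /=.
by case: ifP; rewrite ?mul0rn.
Qed.

Lemma eq_pair_sum g g' J : {in J &, forall i j, i != j -> g i j = g' i j} ->
  pair_sum g J = pair_sum g' J.
Proof.
move=> gg'; apply: eq_bigr => i iJ; apply: eq_bigr => j jJ.
by case: ifP => // ij; apply: gg' => //; apply: contraTneq ij => ->; rewrite ltnn.
Qed.

Lemma pair_sum_degree (D : 'I_k -> A) J :
  pair_sum (fun i j => D i + D j) J = (\sum_(i in J) D i) *+ #|J|.-1.
Proof.
rewrite -(ordered_pair_sum (fun i _ => D i)) -sumrMnl; apply: eq_bigr => i iJ.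
rewrite sumr_const; congr (_ *+ _); rewrite (cardsD1 i) iJ add1n /=.
by apply: eq_card => j; rewrite !inE andbC.
Qed.

Lemma pair_sum_const (c : A) J : pair_sum (fun _ _ => c) J = c *+ 'C(#|J|, 2).
Proof.
have [n] := ubnP #|J|; elim: n J => // n IH J Jn.
have [->|[i iJ]] := set_0Vmem J; first by rewrite /pair_sum big_set0 cards0.
rewrite -(setD1K iJ) pair_sumU1 ?setD11 // IH; last by move: Jn; rewrite (cardsD1 i) iJ.
by rewrite sumr_const cardsU1 setD11 add1n binS bin1 mulrnDr.
Qed.

(** For k >= r+2 a weighting that vanishes on every K_r has the form w + D i + D j, where r-1 kills
    each D i and 'C(r, 2) kills w. On K_k it sums to 'C(k, 2) w + (k-1) times the sum of the D i,
    and after multiplication by [C] the two congruences kill the two parts. The cases k = r and k =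
    r+1 leave too little room for the exchanges and are separate. *)
Lemma complete_graph_sum g r C : (1 < r <= k)%N -> (forall a b, g a b = g b a) ->
  (forall J, #|J| = r -> pair_sum g J = 0) ->
  (r - 1 %| C * (k - 1))%N -> (r * (r - 1) %| C * (k * (k - 1)))%N ->
  pair_sum g [set: 'I_k] *+ C = 0.
Proof.
move=> /andP[r1 rk] gsym g0 dv1 dv2.
have split_vertex a : pair_sum g [set: 'I_k] = pair_sum g (~: [set a]) + \sum_(j in ~: [set a]) g a j.
  by rewrite -pair_sumU1 ?inE ?eqxx // setUCr.
have cardC1s (a : 'I_k) : #|[set~ a]| = k.-1 by rewrite cardsC1 card_ord.
have [ek|[ek|rk2]] : k = r \/ k = r.+1 \/ (r.+2 <= k)%N by lia.
- by rewrite g0 ?mul0rn // cardsT card_ord.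
(* Removing any vertex leaves a K_r, so each vertex degree equals the total P. Summing degrees gives
   (r+1) P = 2 P, that is (r-1) P = 0, and r-1, being prime to k-1 = r, divides [C]. *)
- have deg a : \sum_(j in ~: [set a]) g a j = pair_sum g [set: 'I_k].
    by rewrite (split_vertex a) g0 ?add0r // cardC1s ek.
  have : pair_sum g [set: 'I_k] *+ k = pair_sum g [set: 'I_k] *+ 2.
    transitivity (\sum_(a in [set: 'I_k]) \sum_(j in [set: 'I_k] | j != a) g a j).
      transitivity (\sum_(a in [set: 'I_k]) pair_sum g [set: 'I_k]).
        by rewrite sumr_const cardsT card_ord.
      by apply: eq_bigr => a _; rewrite -(deg a); apply: eq_bigl => j; rewrite !inE.
    rewrite ordered_pair_sum mulr2n -pair_sumD.
    by apply: eq_pair_sum => i j _ _ _; rewrite [g j i]gsym.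
  have k2r : k = (2 + (r - 1))%N by lia.
  move: (pair_sum g _) => P; rewrite k2r.
  rewrite mulrnDr -[RHS]addr0 => /addrI P0.
  have /dvdnP[q ->] : (r - 1 %| C)%N.
    have cop : coprime (r - 1) r by case: (r) r1 => // n _; rewrite subn1 coprimenS.
    have kr : (k - 1 = r)%N by lia.
    by move: dv1; rewrite kr Gauss_dvdl.
  by rewrite mulnC mulrnA P0 mul0rn.
(* Comparing the blocks [a |: K] and [b |: K] makes the differences sum to zero over every
   (r-1)-subset that avoids [a] and [b]. *)
have star a b : a != b -> forall l l', l \notin [set a; b] -> l' \notin [set a; b] ->
    g a l - g b l = g a l' - g b l' /\ (g a l - g b l) *+ (r - 1) = 0.
  move=> ab l l' lU l'U.
  apply: (@subset_sum_const _ (~: [set a; b]) _ (fun l => g a l - g b l)); rewrite ?inE -?in_set2 //.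
    by have := cardsC [set a; b]; rewrite cards2 ab card_ord; lia.
  move=> K /subsetP KU cK; rewrite sumrB.
  have aK : a \notin K by apply/negP => /KU; rewrite !inE eqxx.
  have bK : b \notin K by apply/negP => /KU; rewrite !inE eqxx orbT.
  have := g0 (a |: K); have := g0 (b |: K); rewrite !pair_sumU1 // !cardsU1 aK bK cK.
  rewrite add1n subn1 prednK ?(ltnW r1) // => /(_ erefl) e1 /(_ erefl) e2.
  by apply/eqP; rewrite subr_eq0; apply/eqP/(@addrI _ (pair_sum g K)); rewrite e1 e2.
have fresh (B : {set 'I_k}) : (#|B| <= 3)%N -> exists l, l \notin B.
  move=> B3; have [l lB] : exists l, l \in ~: B.
    by apply/card_gt0P; have := cardsC B; rewrite card_ord; lia.
  by exists l; rewrite inE in lB.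
have k0 : (0 < k)%N by lia.
pose o := Ordinal k0.
(* By [star] the difference [g i l - g o l] does not depend on [l]; this common value is [D i],
   normalized by [D o = 0]. *)
have [D DP] : exists D : 'I_k -> A, forall i, (D i *+ (r - 1) = 0) /\
    (i != o -> forall l, l \notin [set i; o] -> g i l - g o l = D i) /\ (i = o -> D i = 0).
  apply: (@fin_all_exists _ (fun=> A) (fun i Di => (Di *+ (r - 1) = 0) /\
    (i != o -> forall l, l \notin [set i; o] -> g i l - g o l = Di) /\ (i = o -> Di = 0))) => i.
  have [->|io] := eqVneq i o; first by exists 0; rewrite mul0rn.
  have [|l lio] := fresh [set i; o]; first by rewrite cards2; case: (i != o).
  exists (g i l - g o l); split; first by have [] := star i o io l l lio lio.
  split=> [_ l' l'io|e]; last by rewrite e eqxx in io.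
  by have [->] := star i o io l l' lio l'io.
have Do : D o = 0 by have [_ [_ ->]] := DP o.
have [|j0] := fresh [set o]; first by rewrite cards1.
rewrite inE => j0o; pose w := g o j0 - D j0.
have go j : j != o -> g o j = w + D j.
  move=> jo; have [->|jj0] := eqVneq j j0; first by rewrite subrK.
  have [|l] := fresh [set o; j; j0].
    by rewrite (leq_trans (leq_card_setU _ _)) // cards1 addn1 ltnS cards2; case: (_ == _).
  rewrite !inE !negb_or => /andP[/andP[lo lj] lj0].
  have [_ [/(_ jo l) Dj _]] := DP j; have [_ [/(_ j0o l) Dj0 _]] := DP j0.
  rewrite /w -Dj ?inE ?negb_or ?lj // -Dj0 ?inE ?negb_or ?lj0 //.
  have oN : o \notin [set j; j0].
    by rewrite !inE negb_or [o == j]eq_sym jo [o == j0]eq_sym.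
  have lN : l \notin [set j; j0] by rewrite !inE negb_or lj lj0.
  have [e _] := star j j0 jj0 o l oN lN.
  rewrite [g o j]gsym [g o j0]gsym -(subrK (g j0 o) (g j o)) e.
  by rewrite addrC -addrA; congr (_ + _); rewrite opprB addrC addrA subrK.
have gE i j : i != j -> g i j = w + (D i + D j).
  move=> ij; have [eo|io] := eqVneq i o; first by rewrite eo Do add0r go // -eo eq_sym.
  have [eo|jo] := eqVneq j o; first by rewrite eo Do addr0 gsym go.
  have [_ [/(_ io j) Di _]] := DP i.
  have jN : j \notin [set i; o] by rewrite !inE negb_or [j == i]eq_sym ij jo.
  by rewrite -(subrK (g o j) (g i j)) Di // go // addrCA.
have sumE J : pair_sum g J = w *+ 'C(#|J|, 2) + (\sum_(i in J) D i) *+ #|J|.-1.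
  rewrite -pair_sum_degree -pair_sum_const -pair_sumD.
  by apply: eq_pair_sum => i j _ _ ij; rewrite gE.
have Dr (J : {set 'I_k}) : (\sum_(i in J) D i) *+ (r - 1) = 0.
  by rewrite -sumrMnl big1 // => i _; have [] := DP i.
have wr : w *+ 'C(r, 2) = 0.
  have [|J _ cJ] := @subset_card _ [set: 'I_k] r; first by rewrite cardsT card_ord.
  by have := g0 J cJ; rewrite sumE cJ -subn1 Dr addr0.
have binE n : ('C(n, 2) * 2 = n * (n - 1))%N by rewrite mulnC -mul_bin_diag bin1 subn1.
rewrite sumE cardsT card_ord mulrnDl -!mulrnA.
have /dvdnP[q ->] : (r - 1 %| k.-1 * C)%N by rewrite mulnC -subn1.
rewrite [X in _ + X](_ : _ = 0) ?addr0; last by rewrite mulnC mulrnA Dr mul0rn.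
have /dvdnP[q' ->] : ('C(r, 2) %| 'C(k, 2) * C)%N.
  by rewrite -(@dvdn_pmul2r 2) // mulnAC !binE [X in (_ %| X)%N]mulnC.
by rewrite mulnC mulrnA wr mul0rn.
Qed.

(** Moving points to a symbol [o] outside the hole writes [phi i j x y] as a term in x, a term in y
    and the constant [phi i j o o]. The terms in x, gathered over j, are counted once per admissible
    partner of x and vanish by a congruence modulo r-1. What remains is a weighting of K_k counted
    once per admissible pair (x, y), which is the case of [complete_graph_sum]. *)
Lemma multipartite_sum (T : finType) (W : {set T}) (o : T) r (phi : 'I_k -> 'I_k -> T -> T -> A) :
  (1 < r <= k)%N -> o \notin W -> (forall i j x y, phi i j x y = phi j i y x) ->
  (forall J (h : 'I_k -> T), #|J| = r ->
     (forall i j, i != j -> ~~ ((h i \in W) && (h j \in W))) ->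
     pair_sum (fun i j => phi i j (h i) (h j)) J = 0) ->
  (r - 1 %| #|T| * (k - 1))%N -> (r - 1 %| (#|T| - #|W|) * (k - 1))%N ->
  (r * (r - 1) %| (#|T| ^ 2 - #|W| ^ 2) * (k * (k - 1)))%N ->
  pair_sum (fun i j => \sum_x \sum_(y | ~~ ((x \in W) && (y \in W))) phi i j x y) [set: 'I_k] = 0.
Proof.
move=> /andP[r1 rk] oW phi_sym phi0 dv1 dv2 dv3.
have r2 : (1 + (r - 2) = r - 1)%N by clear - r1; lia.
have exchange (h : 'I_k -> T) i K : #|K| = (r - 1)%N -> i \notin K ->
    (forall a b, a != b -> ~~ ((h a \in W) && (h b \in W))) ->
    \sum_(j in K) (phi i j (h i) (h j) - phi i j o (h j)) = 0.
  move=> cK iK hW; pose h' l := if l == i then o else h l.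
  have h'K l : l \in K -> h' l = h l.
    by rewrite /h'; case: eqP => // -> iK'; rewrite iK' in iK.
  have hW' a b : a != b -> ~~ ((h' a \in W) && (h' b \in W)).
    rewrite /h'; do 2!case: ifP => _; rewrite ?(negbTE oW) ?andbF //; exact: hW.
  have ciK : #|i |: K| = r by rewrite cardsU1 iK cK add1n subn1 prednK // ltnW.
  have := phi0 _ _ ciK hW; have := phi0 _ _ ciK hW'; rewrite !pair_sumU1 //.
  rewrite (@eq_pair_sum _ (fun a b => phi a b (h a) (h b))); last by move=> a b /h'K-> /h'K->.
  have h'i : h' i = o by rewrite /h' eqxx.
  rewrite h'i (eq_bigr (fun j => phi i j o (h j))); last by move=> j /h'K->.
  move=> e1 e2; rewrite sumrB; apply/eqP; rewrite subr_eq0; apply/eqP.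
  by apply/(@addrI _ (pair_sum (fun a b => phi a b (h a) (h b)) K)); rewrite e1 e2.
have base i j x y : i != j -> ~~ ((x \in W) && (y \in W)) ->
    phi i j x y = phi i j x o + phi i j o y - phi i j o o.
  move=> ij xy.
  have [|L LU cL] := @subset_card _ (~: [set i; j]) (r - 2)%N.
    by have := cardsC [set i; j]; rewrite cards2 ij card_ord; clear - r1 rk; lia.
  have iL : i \notin L by apply/negP => /(subsetP LU); rewrite !inE eqxx.
  have jL : j \notin L by apply/negP => /(subsetP LU); rewrite !inE eqxx orbT.
  have cjL : #|j |: L| = (r - 1)%N by rewrite cardsU1 jL cL.
  have ijL : i \notin j |: L by rewrite !inE negb_or ij.
  (* The sum over [L] does not involve [z], so comparing z = y with z = o isolates the pair (i,
     j). *)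
  have key z : ~~ ((x \in W) && (z \in W)) ->
      phi i j x z - phi i j o z + \sum_(l in L) (phi i l x o - phi i l o o) = 0.
    move=> xz; pose h l := if l == i then x else if l == j then z else o.
    have := exchange h i _ cjL ijL; rewrite big_setU1 //= /h eqxx [j == i]eq_sym (negbTE ij) eqxx.
    rewrite (eq_bigr (fun l => phi i l x o - phi i l o o)); last first.
      move=> l lL; case: (l =P i) => [li|_]; first by rewrite -li lL in iL.
      by case: (l =P j) => [lj|_] //; rewrite -lj lL in jL.
    apply=> a b ab; have [ai|_] := eqVneq a i; have [bi|_] := eqVneq b i.
    + by rewrite ai bi eqxx in ab.
    + by case: ifP => _; rewrite ?(negbTE oW) ?andbF.
    + by case: ifP => _; rewrite ?(negbTE oW) ?andbF // andbC.
    + have [aj|_] := eqVneq a j; have [bj|_] := eqVneq b j; rewrite ?(negbTE oW) ?andbF //.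
      by rewrite aj bj eqxx in ab.
  have e1 := key y xy; have e0 := key o; rewrite (negbTE oW) andbF in e0.
  have e2 : phi i j x y - phi i j o y = phi i j x o - phi i j o o.
    by apply: (@addIr _ (\sum_(l in L) (phi i l x o - phi i l o o))); rewrite e1 e0.
  by rewrite addrAC -e2 subrK.
pose c x := #|[pred y | ~~ ((x \in W) && (y \in W))]|.
have cE x : c x = if x \in W then (#|T| - #|W|)%N else #|T|.
  rewrite /c; case: (x \in W) => /=; last by apply: eq_card => y; rewrite !inE.
  by rewrite -(cardC (mem W)) addKn; apply: eq_card => y; rewrite !inE.
pose C := (\sum_x c x)%N.
have CE : C = (#|T| ^ 2 - #|W| ^ 2)%N.
  rewrite /C (bigID (mem W)) /=.
  under eq_bigr => x xW do rewrite cE xW.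
  under [X in (_ + X)%N]eq_bigr => x xW do rewrite cE (negbTE xW).
  rewrite !sum_nat_const subn_sqr (_ : #|[predC W]| = (#|T| - #|W|)%N); last first.
    by rewrite -(cardC (mem W)) addKn.
  by rewrite mulnC -mulnDr addnC.
have leaf i x : (\sum_(j in [set: 'I_k] | j != i) (phi i j x o - phi i j o o)) *+ c x = 0.
  rewrite (_ : \sum_(j in _ | _) _ = \sum_(j in [set~ i]) (phi i j x o - phi i j o o)); last first.
    by apply: eq_bigl => j; rewrite !inE.
  apply: (@subset_sum_multiple _ _ (r - 1)).
  - by rewrite cardsC1 card_ord; clear - r1 rk; lia.
  - move=> K /subsetP KU cK.
    have iK : i \notin K by apply/negP => /KU; rewrite !inE eqxx.
    have := exchange (fun l => if l == i then x else o) i K cK iK; rewrite eqxx => e.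
    rewrite -[RHS]e; last first.
      move=> a b ab; have [ai|_] := eqVneq a i; have [bi|_] := eqVneq b i; rewrite ?(negbTE oW) ?andbF //.
      by rewrite ai bi eqxx in ab.
    by apply: eq_bigr => l lK; case: (l =P i) => // li; rewrite -li lK in iK.
  - by rewrite cardsC1 card_ord -subn1 cE; case: ifP.
pose psi i j := phi i j o o.
have inner i j : i != j -> \sum_x \sum_(y | ~~ ((x \in W) && (y \in W))) phi i j x y =
    (\sum_x (phi i j x o - psi i j) *+ c x) + (\sum_x (phi j i x o - psi j i) *+ c x) + psi i j *+ C.
  move=> ij.
  have psiC : psi j i = psi i j by rewrite /psi phi_sym.
  have -> : \sum_x (phi j i x o - psi j i) *+ c x =
      \sum_x \sum_(y | ~~ ((x \in W) && (y \in W))) (phi i j o y - psi i j).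
    rewrite (exchange_big_dep xpredT) //=; apply: eq_bigr => y _.
    rewrite sumr_const phi_sym psiC; congr (_ *+ _).
    by apply: eq_card => x; rewrite !inE andbC.
  rewrite -sumrMnr -!big_split /=; apply: eq_bigr => x _.
  have sumc (z : A) : z *+ c x = \sum_(y | ~~ ((x \in W) && (y \in W))) z.
    by rewrite sumr_const.
  rewrite !sumc -!big_split /=; apply: eq_bigr => y xy.
  by rewrite base // -[RHS]addrA subrK addrAC.
rewrite (eq_pair_sum (fun i j _ _ ij => inner i j ij)) pair_sumD.
rewrite -(ordered_pair_sum (fun i j => \sum_x (phi i j x o - psi i j) *+ c x)).
rewrite big1 ?add0r => [|i _].
  rewrite pair_sumMn; apply: (@complete_graph_sum _ r) => //; first exact/andP.
  - by move=> a b; rewrite /psi phi_sym.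
  - move=> J cJ; apply: (phi0 J (fun=> o)) => // a b _.
    by rewrite (negbTE oW).
  - by rewrite CE subn_sqr mulnAC dvdn_mulr.
  - by rewrite CE.
rewrite exchange_big big1 //= => x _.
by rewrite sumrMnl leaf.
Qed.

End AbelianSums.

(** * Integral combinations tested by homomorphisms to abelian groups *)

Section IntSpan.
Import boolp.
Local Open Scope ring_scope.
Local Open Scope quotient_scope.
Variables (E B : finType) (valid : pred B) (vec : B -> {ffun E -> int}).

Definition int_span : {pred {ffun E -> int}} :=
  fun f => `[< exists c : B -> int, f = \sum_(b | valid b) vec b *~ c b >].

Lemma int_span_zmod_closed : zmod_closed int_span.
Proof.
split=> [|f g /asboolP[c ->] /asboolP[d ->]]; apply/asboolP.
  by exists (fun=> 0); rewrite big1.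
exists (fun b => c b - d b); rewrite -sumrB.
by apply: eq_bigr => b _; rewrite mulrzBr.
Qed.

HB.instance Definition _ := GRing.isZmodClosed.Build _ int_span int_span_zmod_closed.

(** It is enough to test the projection onto the quotient by the span: it kills all generators, and
    its kernel is the span. *)
Lemma int_spanP (t : {ffun E -> int}) :
  (forall (A : zmodType) (f : {additive {ffun E -> int} -> A}),
     (forall b, valid b -> f (vec b) = 0) -> f t = 0) ->
  exists c : B -> int, t = \sum_(b | valid b) vec b *~ c b.
Proof.
pose L : zmodClosed {ffun E -> int} := int_span.
move/(_ (Quotient.quot L) (\pi_(Quotient.quot L)))=> H.
have mem_pi f : (f \in L) = (\pi_(Quotient.quot L) f == 0).
  by rewrite -[f in LHS]subr0 Quotient.idealrBE; congr (_ == _); exact: raddf0.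
suff : t \in L by move/asboolP.
rewrite mem_pi H // => b vb; apply/eqP; rewrite -mem_pi; apply/asboolP.
exists (fun b' => (b' == b)%:R); rewrite (bigD1 b) //= eqxx mulr1z big1 ?addr0 // => b' /andP[_ /negbTE->].
by rewrite mulr0z.
Qed.
End IntSpan.

(** * Signed and positive weightings of the transversal blocks *)

Section TransversalBlocks.
Variables (k r : nat) (T : finType) (W : {set T}).

(* [(J, h)] stands for the block with the vertices (i, h i), i in J. *)
Definition tblock := ({set 'I_k} * {ffun 'I_k -> T})%type.

(** The hole condition is imposed at all indices and not only on [b.1]. The same vertex set is then
    carried by several [h], which only adds multiplicities, and counting the [h] becomes independent
    of [b.1]. *)
Definition tvalid (b : tblock) :=
  (#|b.1| == r) && [forall i, forall j, (i != j) ==> ~~ ((b.2 i \in W) && (b.2 j \in W))].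

Definition through (b : tblock) i j x y := [&& i \in b.1, j \in b.1, b.2 i == x & b.2 j == y].

Lemma throughC b i j x y : through b i j x y = through b j i y x.
Proof. by rewrite /through andbCA; congr [&& _, _ & _]; rewrite andbC. Qed.

Local Open Scope ring_scope.

(** By [int_spanP] a signed decomposition exists as soon as every additive map that kills the blocks
    kills the whole multipartite graph, and this is [multipartite_sum]. *)
Lemma signed_design (o : T) : (1 < r <= k)%N -> o \notin W ->
  (r - 1 %| #|T| * (k - 1))%N -> (r - 1 %| (#|T| - #|W|) * (k - 1))%N ->
  (r * (r - 1) %| (#|T| ^ 2 - #|W| ^ 2) * (k * (k - 1)))%N ->
  exists c : tblock -> int, forall i j x y, i != j -> ~~ ((x \in W) && (y \in W)) ->
    \sum_(b | tvalid b && through b i j x y) c b = 1.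
Proof.
move=> r1k oW dv1 dv2 dv3.
pose E : finType := (('I_k * 'I_k) * (T * T))%type.
pose chi (s : 'I_k -> 'I_k -> T -> T -> bool) : {ffun E -> int} :=
  [ffun e : E => ((e.1.1 < e.1.2)%N && s e.1.1 e.1.2 e.2.1 e.2.2)%:R].
pose vec (b : tblock) := chi (through b).
pose t := chi (fun _ _ x y => ~~ ((x \in W) && (y \in W))).
have [c tc] : exists c : tblock -> int, t = \sum_(b | tvalid b) vec b *~ c b.
  apply: int_spanP => A f f0.
  pose d (e : E) : {ffun E -> int} := [ffun e' => (e' == e)%:R].
  (* The vectors record an edge only in the orientation i < j; [phi] is the value of [f] on that
     edge, symmetrized. *)
  pose phi (i j : 'I_k) (x y : T) : A := if (i < j)%N then f (d ((i, j), (x, y)))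
    else if (j < i)%N then f (d ((j, i), (y, x))) else 0.
  have expand (s : 'I_k -> 'I_k -> T -> T -> bool) :
      f (chi s) = pair_sum (fun i j => \sum_x \sum_(y | s i j x y) phi i j x y) [set: 'I_k].
    have -> : chi s = \sum_(e : E) if (e.1.1 < e.1.2)%N && s e.1.1 e.1.2 e.2.1 e.2.2 then d e else 0.
      apply/ffunP => e; rewrite ffunE sum_ffunE (bigD1 e) //= big1 ?addr0.
        by case: ifP; rewrite !ffunE ?eqxx.
      by move=> e' e'e; case: ifP; rewrite !ffunE // eq_sym (negbTE e'e).
    rewrite raddf_sum /pair_sum -(pair_bigA _ (fun (p : 'I_k * 'I_k) (q : T * T) => f (if (p.1 < p.2)%N && s p.1 p.2 q.1 q.2 then d (p, q) else 0))) /=.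
    rewrite -(pair_bigA _ (fun i j : 'I_k => \sum_q f (if (i < j)%N && s i j q.1 q.2 then d ((i, j), q) else 0))) /=.
    apply: eq_big => [i|i _]; first by rewrite inE.
    apply: eq_big => [j|j _]; first by rewrite inE.
    rewrite -(pair_bigA _ (fun x y : T => f (if (i < j)%N && s i j x y then d ((i, j), (x, y)) else 0))) /=.
    case: ifP => ij /=; last by rewrite big1 // => x _; rewrite big1 // => y _; rewrite raddf0.
    apply: eq_bigr => x _; rewrite [RHS]big_mkcond; apply: eq_bigr => y _.
    by rewrite /phi ij; case: ifP => _ //; rewrite raddf0.
  rewrite /t expand.
  apply: (@multipartite_sum _ _ _ _ o r phi) => //.
    move=> i j x y; rewrite /phi; case: ltngtP => //.
  move=> J h cJ hW.
  have vb : tvalid (J, finfun h).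
    rewrite /tvalid cJ eqxx /=; apply/forallP => i; apply/forallP => j; apply/implyP => ij.
    by rewrite !ffunE hW.
  rewrite -(f0 _ vb) /vec expand /pair_sum big_mkcond; apply: eq_big => [i|i _]; first by rewrite inE.
  rewrite /through; case: (boolP (i \in J)) => iJ; last first.
    by rewrite big1 // => j _; case: ifP => // _; rewrite big1 // => x _; rewrite big1.
  rewrite big_mkcond; apply: eq_big => [j|j _]; first by rewrite inE.
  case: (boolP (j \in J)) => jJ; last first.
    by case: ifP => // _; rewrite big1 // => x _; rewrite big1.
  case: ifP => // ij; rewrite /= (bigD1 (h i)) //= (big_pred1 (h j)); last first.
    by move=> y; rewrite !ffunE eqxx eq_sym.
  rewrite big1 ?addr0 // => x xi; rewrite big1 // => y /andP[].
  by rewrite ffunE eq_sym (negbTE xi).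
have lt_case (i j : 'I_k) x y : (i < j)%N -> ~~ ((x \in W) && (y \in W)) ->
    \sum_(b | tvalid b && through b i j x y) c b = 1.
  move=> ij xy; have <- : t ((i, j), (x, y)) = 1 by rewrite ffunE /= ij xy.
  rewrite tc sum_ffunE big_mkcondr; apply: eq_bigr => b _ /=.
  by rewrite ffunMzE ffunE /= ij /=; case: ifP => _; rewrite ?mul0rz // intz.
exists c => i j x y ij xy; case: (ltngtP i j) => [lij|lji|/val_inj e].
- exact: lt_case.
- under eq_bigl => b do rewrite throughC.
  by apply: lt_case; rewrite // andbC.
- by rewrite e eqxx in ij.
Qed.

Local Close Scope ring_scope.

Let hvalid (h : {ffun 'I_k -> T}) := [forall i, forall j, (i != j) ==> ~~ ((h i \in W) && (h j \in W))].

Section CountExtensions.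
Variables (i j : 'I_k) (x y : T).
Hypothesis ij : i != j.
Let w := #|W|.
Let m := #|~: W|.
Let G (l : option 'I_k) (q : 'I_k) : {pred T} :=
  [pred z | [&& (q == i) ==> (z == x), (q == j) ==> (z == y) & (z \in W) == (l == Some q)]].
Let weight (l : option 'I_k) := if l is None then m - (k - 2) * w else m.

Let family_pick h l : (h \in family (G l)) =
  [&& hvalid h, h i == x, h j == y & l == [pick q | h q \in W]].
Proof.
apply/familyP/and4P => [hG|[hv /eqP hi /eqP hj /eqP->] q].
  have hW q : (h q \in W) = (l == Some q).
    by have := hG q; rewrite inE => /and3P[_ _ /eqP].
  split.
  - apply/forallP => a; apply/forallP => b; apply/implyP => ab; rewrite !hW.
    by apply: contra ab => /andP[/eqP-> /eqP[->]].
  - by have := hG i; rewrite inE eqxx => /andP[].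
  - by have := hG j; rewrite inE eqxx => /and3P[].
  - case: pickP => [q|none]; first by rewrite hW.
    by case: l hW {hG} => // q /(_ q); rewrite none eqxx.
rewrite inE; apply/and3P; split; first by apply/implyP => /eqP->; rewrite hi.
  by apply/implyP => /eqP->; rewrite hj.
case: pickP => [q' hq'|->] //; rewrite (inj_eq Some_inj); have [<-|q'q] := eqVneq q' q; first by rewrite hq'.
by move/forallP/(_ q')/forallP/(_ q): hv; rewrite q'q hq' /= => /negbTE->.
Qed.

Let card_ext l : #|family (G l)| = \prod_q #|G l q|.
Proof. by rewrite card_family foldrE big_map big_enum. Qed.

Let card_G_other l q : q != i -> q != j -> #|G l q| = if l == Some q then w else m.
Proof.
move=> qi qj; case: ifP => lq; rewrite /w /m; apply: eq_card => z;
  by rewrite !inE (negbTE qi) (negbTE qj) lq /=; case: (z \in W).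
Qed.

Let card_pin (z0 : T) (b : bool) : #|[pred z | (z == z0) && ((z \in W) == b)]| = ((z0 \in W) == b).
Proof.
case: eqP => zb.
  by rewrite -[RHS](card1 z0); apply: eq_card => z; rewrite !inE; case: (z =P z0) => // ->; rewrite zb eqxx.
by apply: eq_card0 => z; rewrite !inE; case: eqP => // ->; apply/negbTE/eqP.
Qed.

Let card_G_i l : #|G l i| = ((x \in W) == (l == Some i)).
Proof. by rewrite -card_pin; apply: eq_card => z; rewrite !inE eqxx (negbTE ij). Qed.

Let card_G_j l : #|G l j| = ((y \in W) == (l == Some j)).
Proof. by rewrite -card_pin; apply: eq_card => z; rewrite !inE eqxx eq_sym (negbTE ij). Qed.

Let A := m ^ (k - 2).

Let card_rest : #|[pred q : 'I_k | (q != i) && (q != j)]| = k - 2.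
Proof.
have e2 : #|[pred q : 'I_k | (q == i) || (q == j)]| = 2.
  by rewrite -(_ : #|[set i; j]| = 2); [apply: eq_card => q; rewrite !inE | rewrite cards2 ij].
have := cardC [pred q : 'I_k | (q == i) || (q == j)]; rewrite e2 card_ord => e.
rewrite (eq_card (B := [predC [pred q : 'I_k | (q == i) || (q == j)]])); last first.
  by move=> q; rewrite !inE negb_or.
have k2 : 2 <= k by rewrite -e leq_addr.
by apply: (@addnI 2); rewrite [LHS]e subnKC.
Qed.

Let prod_other l : weight l * \prod_(q | (q != i) && (q != j)) #|G l q| =
  if l is Some q0 then (if (q0 != i) && (q0 != j) then w * A else m * A) else (m - (k - 2) * w) * A.
Proof.
have AE : \prod_(q | (q != i) && (q != j)) m = A by rewrite prod_nat_const card_rest.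
rewrite (eq_bigr (fun q => if l == Some q then w else m)); last by move=> q /andP[qi qj]; apply: card_G_other.
case: l => [q0|] /=; last by rewrite -AE.
case: ifP => q0ij.
  rewrite -AE (bigD1 q0) //= eqxx [in RHS](bigD1 q0) //= mulnCA; congr (_ * (_ * _)).
  by apply: eq_bigr => q /andP[_ qq0]; rewrite (inj_eq Some_inj) eq_sym (negbTE qq0).
rewrite -AE; congr (_ * _); apply: eq_bigr => q qij.
by case: eqP => // -[q0q]; rewrite q0q qij in q0ij.
Qed.

(** At most one coordinate of [h] lies in the hole. If x or y does, the m^(k-2) extensions all have
    weight m. Otherwise extensions avoiding the hole contribute (m - (k-2) w) m^(k-2), and those
    with one hole point (k-2) w m^(k-2). The weights are chosen so that the totals agree. *)
Lemma extension_count : ~~ ((x \in W) && (y \in W)) -> (k - 2) * w <= m ->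
  \sum_(h | [&& hvalid h, h i == x & h j == y]) weight [pick q | h q \in W] = m * A.
Proof.
move=> xy wm.
transitivity (\sum_h \sum_l if h \in family (G l) then weight l else 0).
  rewrite big_mkcond; apply: eq_bigr => h _.
  case: ifP => hP; last first.
    rewrite big1 // => l _; rewrite family_pick; case: ifP => // /and4P[h1 h2 h3 _].
    by rewrite h1 h2 h3 in hP.
  rewrite -big_mkcond (big_pred1 [pick q | h q \in W]) // => l.
  by rewrite family_pick; have /and3P[-> -> ->] := hP.
rewrite exchange_big.
transitivity (\sum_l #|G l i| * (#|G l j| * (weight l * \prod_(q | (q != i) && (q != j)) #|G l q|))).
  apply: eq_bigr => l _; rewrite -big_mkcond sum_nat_const card_ext.
  rewrite (bigD1 i) //= (bigD1 j) 1?eq_sym ?ij //=; lia.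
under eq_bigr do rewrite card_G_i card_G_j prod_other.
have [xW|xW] := boolP (x \in W).
  rewrite (bigD1 (Some i)) //= big1 ?addn0.
    rewrite !eqxx /= mul1n; move: xy; rewrite xW /= => /negbTE->.
    by rewrite (inj_eq Some_inj) (negbTE ij) eqxx /= mul1n.
  by move=> l li; rewrite (negbTE li).
have [yW|yW] := boolP (y \in W).
  rewrite (bigD1 (Some j)) //= big1 ?addn0.
    have -> : (Some j == Some i) = false by rewrite (inj_eq Some_inj) eq_sym (negbTE ij).
    by rewrite !eqxx /= !mul1n andbF.
  by move=> l lj; rewrite (negbTE lj) muln0.
rewrite (bigD1 None) //= !mul1n (reindex_omap Some id); last by case.
rewrite (eq_bigl xpredT); last by move=> q; rewrite /= eqxx.
rewrite (bigID (fun q => (q != i) && (q != j))) /= [X in _ + (_ + X)]big1 ?addn0.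
  rewrite (eq_bigr (fun=> w * A)) ?sum_nat_const ?card_rest; last first.
    move=> q /andP[qi qj].
    by rewrite !(inj_eq Some_inj) (negbTE qi) (negbTE qj) /= !mul1n.
  by rewrite mulnA -mulnDl subnK.
move=> q; rewrite negb_and !negbK => /orP[]/eqP->; rewrite !eqxx ?muln0 //.
Qed.
End CountExtensions.

(** The weights of [extension_count] depend on [h] alone, so each of the 'C(k - 2, r - 2) index sets
    through [i] and [j] contributes the same amount. The strict inequality makes them positive. *)
Lemma positive_design : 1 < r -> r <= k -> (k - 2) * #|W| < #|~: W| ->
  exists (P : tblock -> nat) (L : nat), (forall b, 0 < P b) /\
    forall i j x y, i != j -> ~~ ((x \in W) && (y \in W)) ->
      \sum_(b | tvalid b && through b i j x y) P b = L.
Proof.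
move=> r1 rk wm.
exists (fun b : tblock => if [pick q | b.2 q \in W] is None then #|~: W| - (k - 2) * #|W| else #|~: W|).
exists ('C(k - 2, r - 2) * (#|~: W| * #|~: W| ^ (k - 2))); split.
  by move=> b /=; case: pickP => [q _|_] /=; [exact: leq_ltn_trans wm | rewrite subn_gt0].
move=> i j x y ij xy; rewrite -(extension_count ij xy (ltnW wm)).
transitivity (\sum_(J : {set 'I_k} | [&& i \in J, j \in J & #|J| == r])
    \sum_(h | [&& hvalid h, h i == x & h j == y])
      if [pick q | h q \in W] is None then #|~: W| - (k - 2) * #|W| else #|~: W|).
  rewrite pair_big_dep /=; apply: eq_bigl => -[J h] /=.
  rewrite /tvalid /through /hvalid /=.
  by case: (i \in J); case: (j \in J); case: (_ == r); case: [forall _, _].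
rewrite sum_nat_const; congr (_ * _).
pose S := [set B : {set 'I_k} | (B \subset ~: [set i; j]) & #|B| == r - 2].
have -> : 'C(k - 2, r - 2) = #|S|.
  rewrite cards_draws; congr 'C(_, _).
  by have := cardsC [set i; j]; rewrite card_ord cards2 ij; lia.
have notin (B : {set 'I_k}) : B \subset ~: [set i; j] -> (i \notin B) && (j \notin B).
  by rewrite subsetC subUset !sub1set !inE.
have addK (B : {set 'I_k}) : B \subset ~: [set i; j] -> (i |: (j |: B)) :\ i :\ j = B.
  move=> /notin/andP[iB jB]; rewrite setU1K ?setU1K //.
  by rewrite !inE negb_or ij.
have <- : #|[set i |: (j |: B) | B in S]| = #|S|.
  apply: card_in_imset.
  move=> B B'; rewrite !inE => /andP[BU _] /andP[B'U _] /(congr1 (fun S => S :\ i :\ j)).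
  by rewrite !addK.
apply: eq_card => J; apply/and3P/imsetP => [[iJ jJ /eqP cJ]|[B]].
  exists (J :\ i :\ j).
    rewrite inE; apply/andP; split.
      by apply/subsetP => q; rewrite !inE negb_or => /and3P[-> ->].
    have := cardsD1 i J; have := cardsD1 j (J :\ i).
    by rewrite !inE iJ jJ eq_sym ij cJ /= => e1 e2; apply/eqP; lia.
  by rewrite [j |: _]setD1K ?setD1K // !inE eq_sym ij.
rewrite inE => /andP[/notin/andP[iB jB] /eqP cB] ->.
rewrite !inE !eqxx orbT; split=> //.
by rewrite !cardsU1 !inE negb_or ij iB jB cB /=; apply/eqP; lia.
Qed.

End TransversalBlocks.

Lemma card_ord_ltn n m : m <= n -> #|[pred i : 'I_n | i < m]| = m.
Proof.
move=> mn; rewrite -[RHS]card_ord -(@card_imset _ _ (widen_ord mn)).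
  apply: eq_card => i; rewrite inE; apply/idP/imsetP => [im|[j _ ->]] //=.
  by exists (Ordinal im) => //; apply: val_inj.
by move=> i i' e; apply: val_inj; have := congr1 val e.
Qed.

Lemma natr_Zp_unit lam n d : 1 < lam -> coprime lam n`! -> 0 < d -> d <= n ->
  (d%:R : 'Z_lam)%R \is a GRing.unit.
Proof.
move=> lam1 cop d0 dn; rewrite unitZpE //.
by apply: coprime_dvdr cop; rewrite dvdn_fact // d0.
Qed.

(** Index reduction over Z_lam, with each block [b] repeated [y b] times. The label of a vertex is
    its rank plus one: labels and their differences are, up to sign, integers between 1 and the
    number of vertices, hence units. *)
Lemma blocks_blowup k r (T : finType) (W : {set T}) (y : tblock k T -> nat) lam :
  1 < lam -> coprime lam #|{: 'I_k * T}|`! ->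
  (forall i j (x x' : T), i != j -> ~~ ((x \in W) && (x' \in W)) ->
     \sum_(b | tvalid r W b && through b i j x x') y b = lam) ->
  exists d, gdd 'I_k r (#|T| * lam ^ d) (#|W| * lam ^ d).
Proof.
move=> lam1 cop ysum.
pose Bd := (\sum_b y b).+1.
have yBd b : y b < Bd by rewrite ltnS (bigD1 b) //= leq_addr.
pose J : finType := {p : tblock k T * 'I_Bd | tvalid r W p.1 && (p.2 < y p.1)}.
pose bl (p : J) : {set 'I_k * T} := [set (i, (val p).1.2 i) | i in (val p).1.1].
have blE p i x : ((i, x) \in bl p) = (i \in (val p).1.1) && ((val p).1.2 i == x).
  by apply/imsetP/andP => [[j jJ [-> ->]]|[iJ /eqP<-]]; [rewrite eqxx | exists i].
have cardZ : #|'Z_lam| = lam by rewrite card_ord Zp_cast.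
have [||||||Phi [P1 P2 P3 P4]] := @index_reduction _ J 'Z_lam (@multipartite 'I_k T W) r bl
    (fun x => ((enum_rank x).+1%:R)%R).
- by move=> x; rewrite /multipartite eqxx.
- move=> p; have /andP[/andP[/eqP cr _] _] := valP p.
  by rewrite card_imset ?cr // => i j [].
- move=> p [i x] [j x']; rewrite !blE => /andP[iJ /eqP <-] /andP[jJ /eqP <-] ne.
  have /andP[/andP[_ /forallP/(_ i)/forallP/(_ j)/implyP hW] _] := valP p.
  have ij : i != j by apply: contraNneq ne => ->.
  by rewrite /multipartite ij hW.
- move=> [i x] [j x'] /andP[/= ij xx']; rewrite cardZ -(ysum i j x x' ij xx').
  rewrite -(card_imset _ val_inj).
  transitivity #|[pred p : tblock k T * 'I_Bd | (tvalid r W p.1 && through p.1 i j x x') && (p.2 < y p.1)]|.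
    apply: eq_card => p; rewrite inE /=; apply/imsetP/idP => [[q]|/andP[/andP[pv pt] py]].
      rewrite inE !blE => /andP[/andP[q1 q2] /andP[q3 q4]] ->; have /andP[q5 q6] := valP q.
      by rewrite /through q1 q2 q3 q4 q5 q6.
    have pJ : tvalid r W p.1 && (p.2 < y p.1) by rewrite pv.
    exists (Sub p pJ) => //; rewrite inE !blE SubK.
    by have /and4P[-> -> -> ->] := pt.
  rewrite -sum1_card.
  rewrite -(pair_big_dep (fun b => tvalid r W b && through b i j x x') (fun b (n : 'I_Bd) => n < y b) (fun _ _ => 1)) /=.
  apply: eq_bigr => b _; rewrite sum1_card.
  exact: card_ord_ltn (ltnW (yBd b)).
- by move=> x; apply: natr_Zp_unit cop _ _.
- move=> x x' ne.
  wlog lt : x x' ne / (enum_rank x < enum_rank x').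
    move=> H; case: (ltngtP (enum_rank x) (enum_rank x')) => [||/val_inj/enum_rank_inj e].
    + exact: H.
    + by rewrite -opprB unitrN; apply: H; rewrite eq_sym.
    + by rewrite e eqxx in ne.
  rewrite -opprB unitrN -natrB ?ltnS 1?ltnW // subSS.
  apply: natr_Zp_unit cop _ _ => //; first by rewrite subn_gt0.
  by rewrite (leq_trans (leq_subr _ _)) // ltnW.
pose A : finType := {ffun {f : {set 'I_k * T} | #|f| == 2} -> 'Z_lam}.
have cardA : exists d, #|{: A}| = lam ^ d by rewrite card_ffun cardZ; eexists.
have [d dE] := cardA; exists d; rewrite -dE.
exists (T * A)%type, (setX W [set: A]); split.
- by rewrite card_prod.
- by rewrite cardsX cardsT.
apply: (@decomposable_bij _ _ (fun q q' : ('I_k * T) * A => multipartite W q.1 q'.1) _ r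
  (fun p => (p.1.1, (p.1.2, p.2))) (fun p => ((p.1, p.2.1), p.2.2))).
- by move=> [[]].
- by move=> [? []].
- by move=> [[i x] a] [[j x'] a']; rewrite /multipartite /= !inE !andbT.
- by exists Phi; split.
Qed.

(** For large [N] the weights [c + N P] are nonnegative and cover each pair exactly [lam = 1 + N L]
    times. Taking [N] a multiple of both the factorial and [X] makes [lam] coprime to them. *)
Lemma gdd_blowup k r g w X : 1 < r -> r <= k -> w < g -> (k - 2) * w < g - w ->
  r - 1 %| g * (k - 1) -> r - 1 %| (g - w) * (k - 1) ->
  r * (r - 1) %| (g ^ 2 - w ^ 2) * (k * (k - 1)) -> 0 < X ->
  exists Q, [/\ 0 < Q, coprime Q X & gdd 'I_k r (g * Q) (w * Q)].
Proof.
move=> r1 rk wg wm dv1 dv2 dv3 X0.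
pose W := [set i : 'I_g | i < w].
have cW : #|W| = w.
  by rewrite -[RHS](card_ord_ltn (ltnW wg)); apply: eq_card => i; rewrite inE.
have cW' : #|~: W| = g - w by have := cardsC W; rewrite cW card_ord => e; apply: (@addnI w); rewrite e subnKC // ltnW.
pose o := Ordinal wg.
have oW : o \notin W by rewrite inE ltnn.
have [|||||c cP] := @signed_design k r _ W o; rewrite ?cW ?card_ord ?r1 //.
have [|P [L [P0 PL]]] := @positive_design k r _ W r1 rk; first by rewrite cW cW'.
pose F := #|{: 'I_k * 'I_g}|`! * X.
have F0 : 0 < F by rewrite muln_gt0 fact_gt0.
pose N := F * (\sum_b `|c b|%N).+1.
have cN b : (- (N%:Z) <= c b)%R.
  have : `|c b|%N <= N.
    rewrite (leq_trans _ (leq_pmull _ F0)) // (leq_trans _ (leqnSn _)) //.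
    by rewrite (bigD1 b) //= leq_addr.
  by move: (c b) N => z n; clear; lia.
have yE b : (c b + (N * P b)%:Z)%R = Posz `|(c b + (N * P b)%:Z)%R|%N.
  by rewrite gez0_abs //; have := cN b; have := leq_pmulr N (P0 b); clear cN; move: N (c b) (N * P b) => n z m; clear; lia.
pose y b := `|(c b + (N * P b)%:Z)%R|%N.
pose lam := 1 + N * L.
have sumy i j (x x' : 'I_g) : i != j -> ~~ ((x \in W) && (x' \in W)) ->
     \sum_(b | tvalid r W b && through b i j x x') y b = lam.
  move=> ij xx'; apply/eqP; rewrite -(eqr_nat int) natr_sum.
  rewrite (eq_bigr (fun b => c b + (N * P b)%:Z)%R); last by move=> b _; rewrite yE natz.
  rewrite big_split /= cP // /lam -(PL i j x x' ij xx') natrD natrM natr_sum mulr_sumr.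
  by apply/eqP; congr (_ + _)%R; apply: eq_bigr => b _; rewrite PoszM -!natz.
have i01 : exists i j : 'I_k, i != j.
  by exists (Ordinal (leq_trans (ltnW r1) rk)), (Ordinal (leq_trans r1 rk)).
(* Were [L] zero, positivity of [P] would leave no valid block through a pair, whereas the signed
   weights there sum to 1. *)
have L0 : 0 < L.
  rewrite lt0n; apply/eqP => L0; have [i [j ij]] := i01.
  have xy : ~~ ((o \in W) && (o \in W)) by rewrite (negbTE oW).
  have := PL i j o o ij xy; rewrite L0 => /eqP; rewrite sum_nat_eq0 => /forallP H.
  have := cP i j o o ij xy; rewrite big_pred0 // => b.
  by have := H b; have := P0 b; case: (P b) => // n _; rewrite implybF => /negbTE.
have lam1 : 1 < lam by rewrite /lam -[X in X < _]addn0 ltn_add2l muln_gt0 L0 andbT muln_gt0 F0.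
have copF : coprime lam F.
  have -> : lam = ((\sum_b `|c b|%N).+1 * L) * F + 1.
    by rewrite /lam /N addnC mulnC [F * _]mulnC mulnA [L * _]mulnC.
  by rewrite /coprime gcdnC gcdnMDl gcdn1.
have [|d gd] := @blocks_blowup k r _ W y lam lam1 _ sumy.
  by apply: coprime_dvdr copF; rewrite dvdn_mulr.
exists (lam ^ d); split; first by rewrite expn_gt0 (ltnW lam1).
  by apply: coprimeXl; apply: coprime_dvdr copF; rewrite dvdn_mull.
by move: gd; rewrite cW card_ord.
Qed.

(** * Group divisible designs with large groups *)

Lemma modular_inverse q m : 0 < q -> coprime q m -> exists u, forall b, q * (u * b) = b %[mod m].
Proof.
move=> q0 /(coprimeP _ q0)[[u v] /= uv]; exists u => b.
have e : u * q = v * m + 1 by lia.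
by rewrite mulnA [q * u]mulnC e mulnDl mul1n mulnAC modnMDl.
Qed.

Lemma coprime_representation q q' n : 0 < q -> 0 < q' -> coprime q q' -> q * q' <= n ->
  exists x y, n = q * x + q' * y.
Proof.
move=> q0 q'0 cop le_n; have [u uP] := modular_inverse q0 cop.
pose x := (u * n) %% q'.
have xq : q * x <= n.
  by apply: leq_trans le_n; rewrite leq_mul2l ltnW ?orbT // ltn_mod.
exists x, ((n - q * x) %/ q').
rewrite [q' * _]mulnC divnK ?subnKC // -eqn_mod_dvd //.
by rewrite /x eq_sym modnMmr uP.
Qed.

Lemma sum_two_steps t x y A B : x + y <= t ->
  \sum_(h < t) (if h < x then A else if h < x + y then B else 0) = A * x + B * y.
Proof.
move=> xyt; rewrite -(big_mkord xpredT (fun h => if h < x then A else if h < x + y then B else 0)).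
have xt : x <= t by lia.
rewrite (big_cat_nat (leq0n x) xt) /= (big_cat_nat (leq_addr y x) xyt) /=.
rewrite (eq_big_nat _ _ (F2 := fun=> A)); last by move=> h /andP[_ ->].
rewrite [X in _ + (X + _)](eq_big_nat _ _ (F2 := fun=> B)); last first.
  by move=> h /andP[xh ->]; rewrite ltnNge xh.
rewrite [X in _ + (_ + X)](eq_big_nat _ _ (F2 := fun=> 0)); last first.
  by move=> h /andP[xh _]; rewrite !ltnNge xh (leq_trans (leq_addr y x) xh).
rewrite !sum_nat_const_nat subn0 addKn muln0 addn0; lia.
Qed.

Section Existence.
Variables (k r : nat).
Hypotheses (r1 : 1 < r) (rk : r <= k).

(** A large multiple n of [a] is written M t + a Q3 s, where a design with groups of size a Q3 s
    exists by inflation. Wilson's construction, with x symbols of weight a Q1, y of weight a Q2 and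
    Q1 x + Q2 y = Q3 s, creates a hole of exactly that size, which is then filled. *)
Lemma gdd_multiples a : 0 < a -> r - 1 %| a * (k - 1) -> r * (r - 1) %| a ^ 2 * (k * (k - 1)) ->
  exists M, forall n, M <= n -> a %| n -> gdd 'I_k r n 0.
Proof.
move=> a0 dv1 dv2.
have [t0 oat] := oa_eventually k.+1.
have oa_opt t : t0 <= t -> oa (option 'I_k) t.
  by move=> /oat; apply: oa_le; rewrite card_option !card_ord.
have oa_k t : t0 <= t -> oa 'I_k t.
  by move=> /oat; apply: oa_le; rewrite !card_ord.
have base0 X : 0 < X -> exists Q, [/\ 0 < Q, coprime Q X & gdd 'I_k r (a * Q) 0].
  move=> X0; have [|||||Q [Q0 cQ]] := @gdd_blowup k r a 0 X r1 rk a0; rewrite ?muln0 ?subn0 //.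
  by exists Q.
have [Q0 [Q0_gt0 _ gddQ0]] := base0 1 isT.
(* Three demands meet in [m]: it is a multiple of [l], so adding it to a group size keeps the
   congruences; it exceeds (k-2) a, so a hole of size [a] is allowed; and m t is an inflation of a
   Q0 by a factor of at least [t0]. *)
pose l := r * (r - 1); pose m := a * Q0 * (l * (k + t0).+1).
have l0 : 0 < l by rewrite muln_gt0; lia.
have lk0 : 0 < l * (k + t0).+1 by rewrite muln_gt0 l0.
have m0 : 0 < m by rewrite /m muln_gt0 lk0 andbT muln_gt0 a0.
have gdd_m t : 0 < t -> gdd 'I_k r (m * t) 0.
  move=> tpos; rewrite -mulnA -(mul0n (l * (k + t0).+1 * t)); apply: gdd_inflate => //.
  have := leq_mul l0 tpos; rewrite muln1 => lt; apply: oa_k.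
  by rewrite mulnAC (leq_trans _ (leq_pmull _ lt)) //; lia.
have lm : l %| m by rewrite /m mulnCA dvdn_mulr.
have r1m : r - 1 %| m by apply: dvdn_trans lm; rewrite dvdn_mull.
have hole X : 0 < X -> exists Q, [/\ 0 < Q, coprime Q X & gdd 'I_k r (m * Q + a * Q) (a * Q)].
  move=> X0; have [|||||//|Q [Qpos cQ gQ]] := @gdd_blowup k r (m + a) a X r1 rk.
  - by rewrite -[X in X < _]add0n ltn_add2r.
  - rewrite addnK mulnC /m -mulnA ltn_pmul2l //.
    apply: (@leq_trans (k + t0).+1); first by clear; lia.
    by apply: leq_trans (leq_pmull _ Q0_gt0); apply: leq_pmull.
  - by rewrite mulnDl dvdn_add // dvdn_mulr.
  - by rewrite addnK dvdn_mulr.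
  - by rewrite subn_sqr addnK; do 2!apply: dvdn_mulr; exact: lm.
  by exists Q; split; rewrite -?mulnDl.
have [Q1 [Q1_gt0 _ gddQ1]] := hole 1 isT.
have [Q2 [Q2_gt0 cQ gddQ2]] := hole Q1 Q1_gt0.
(* One symbol has weight a Q and all others weight 0: the hole is kept while the rest of each group
   grows by the factor [t]. *)
have extend Q t : 0 < Q -> t0 < t -> gdd 'I_k r (m * Q + a * Q) (a * Q) ->
    gdd 'I_k r (m * Q * t + a * Q) (a * Q).
  move=> Qpos tt0 gQ.
  have := @gdd_wilson 'I_k 'I_t r (m * Q) (fun h => if h < 1 then a * Q else if h < 1 + 0 then 0 else 0).
  rewrite card_ord sum_two_steps; last by rewrite addn0 (leq_ltn_trans (leq0n _) tt0).
  rewrite !muln0 !addn0 !muln1.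
  apply; first exact: oa_opt (ltnW tt0).
  by move=> h; case: ifP => _ //; rewrite if_same addn0; apply: gdd_m.
(* [M] is a multiple of both m Q1 and m Q2, so the ingredients with hole a Q1, with hole a Q2 and
   without hole share the same [M]. *)
pose M' := Q0 * (l * (k + t0).+1) * Q1 * Q2 * t0.+1; pose M := a * M'.
have M'0 : 0 < M'.
  by rewrite /M' muln_gt0 andbT muln_gt0 Q2_gt0 andbT muln_gt0 Q1_gt0 andbT muln_gt0 lk0 andbT.
have gddM1 : gdd 'I_k r (M + a * Q1) (a * Q1).
  have -> : M = m * Q1 * (Q2 * t0.+1) by rewrite /M /M' /m !mulnA.
  by apply: extend => //; rewrite (leq_trans _ (leq_pmull _ Q2_gt0)).
have gddM2 : gdd 'I_k r (M + a * Q2) (a * Q2).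
  have -> : M = m * Q2 * (Q1 * t0.+1) by rewrite /M /M' /m -!mulnA; do 5!congr (_ * _); rewrite mulnCA.
  by apply: extend => //; rewrite (leq_trans _ (leq_pmull _ Q1_gt0)).
have gddM : gdd 'I_k r M 0.
  have -> : M = m * (Q1 * Q2 * t0.+1) by rewrite /M /M' /m !mulnA.
  by apply: gdd_m; rewrite !muln_gt0 Q1_gt0 Q2_gt0.
have [Q3 [Q3_gt0 cQ3 gddQ3]] := base0 _ M'0.
have [u uP] := modular_inverse Q3_gt0 cQ3.
(* [s >= s0] serves both the inflation by [s] and the representation of Q3 s by Q1 and Q2; [G]
   bounds Q3 s from above. *)
pose s0 := t0 + Q1 * Q2; pose G := Q3 * (s0 + M').
exists (a * (G + M' * (t0 + G).+1)) => n nM /dvdnP[n' nE].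
have n'M : G + M' * (t0 + G).+1 <= n' by rewrite -(leq_pmul2l a0) [a * n']mulnC -nE.
(* The term [(M' - 1) * s0] stands for -s0 modulo [M'], so that [s] is congruent to [u * n']. *)
pose s := s0 + (u * n' + (M' - 1) * s0) %% M'.
have s_lt : s <= s0 + M' by rewrite leq_add2l ltnW // ltn_mod.
have sP : Q3 * s = n' %[mod M'].
  rewrite -modnMmr /s modnDmr addnCA -[X in _ + (X + _)]mul1n -mulnDl subnKC //.
  by rewrite addnC [M' * s0]mulnC modnMDl modnMmr uP.
have gs : gdd 'I_k r (a * (Q3 * s)) 0.
  by rewrite mulnA -(mul0n s); apply: gdd_inflate gddQ3 _; apply: oa_k; rewrite /s /s0 -!addnA leq_addr.
have Q3s : Q3 * s <= G by rewrite leq_mul2l s_lt orbT.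
have [||x [y xyE]] := @coprime_representation Q1 Q2 (Q3 * s) Q1_gt0 Q2_gt0.
- by rewrite coprime_sym.
- by rewrite (leq_trans _ (leq_pmull _ Q3_gt0)) // /s /s0 -addnA addnCA leq_addr.
have xy_le : x + y <= G by apply: leq_trans Q3s; rewrite xyE leq_add // leq_pmull.
pose t := (n' - Q3 * s) %/ M'.
have Q3n : Q3 * s <= n' by apply: leq_trans n'M; rewrite (leq_trans Q3s) ?leq_addr.
have tE : n' = M' * t + Q3 * s.
  by rewrite [M' * t]mulnC divnK ?subnK // -eqn_mod_dvd // eq_sym sP.
have t_big : (t0 + G).+1 <= t.
  rewrite leq_divRL // mulnC leq_subRL //; apply: leq_trans n'M.
  by rewrite leq_add2r.
have nE' : n = M * t + a * (Q3 * s) by rewrite nE tE mulnC mulnDr mulnA.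
have := @gdd_wilson 'I_k 'I_t r M (fun h => if h < x then a * Q1 else if h < x + y then a * Q2 else 0).
rewrite card_ord sum_two_steps; last first.
  by apply: leq_trans t_big; rewrite (leq_trans xy_le) // leqW // leq_addl.
have -> : a * Q1 * x + a * Q2 * y = a * (Q3 * s) by rewrite xyE mulnDr !mulnA.
rewrite -nE' => W.
apply: gdd_fill gs; apply: W.
  by apply: oa_opt; rewrite (leq_trans _ t_big) // leqW // leq_addr.
by move=> h; case: ifP => // _; case: ifP => // _; rewrite addn0.
Qed.

(** Both moduli divide l = r (r-1), so the congruences pass from [n] to [gcdn n l]; this leaves
    finitely many values of [a] in [gdd_multiples]. *)
Theorem gdd_eventually : exists M, forall n, M <= n ->
  r - 1 %| n * (k - 1) -> r * (r - 1) %| n ^ 2 * (k * (k - 1)) -> gdd 'I_k r n 0.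
Proof.
pose l := r * (r - 1).
have l0 : 0 < l by rewrite muln_gt0; lia.
have ex (a : 'I_l.+1) : exists M, forall n, M <= n -> 0 < a -> r - 1 %| a * (k - 1) ->
    r * (r - 1) %| a ^ 2 * (k * (k - 1)) -> a %| n -> gdd 'I_k r n 0.
  case: (boolP [&& 0 < a, r - 1 %| a * (k - 1) & r * (r - 1) %| a ^ 2 * (k * (k - 1))]).
    case/and3P => a0 dv1 dv2; have [M MP] := gdd_multiples a0 dv1 dv2.
    by exists M => n nM _ _ _; apply: MP.
  by move=> /and3P na; exists 0 => n _ a0 dv1 dv2; case: na.
have [M MP] := fin_all_exists ex.
exists (\max_a M a) => n nM dv1 dv2.
have al : gcdn n l < l.+1 by rewrite ltnS dvdn_leq // dvdn_gcdr.
have gl c : l %| n * c -> l %| gcdn n l * c by move=> h; rewrite muln_gcdl dvdn_gcd h dvdn_mulr.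
apply: (MP (Ordinal al)) => /=.
- by apply: leq_trans nM; apply: leq_bigmax.
- by rewrite gcdn_gt0 l0 orbT.
- by rewrite muln_gcdl dvdn_gcd dv1 dvdn_mulr // dvdn_mull.
- rewrite -/l -mulnn -mulnA gl // mulnCA gl // mulnA mulnn -/l //.
- exact: dvdn_gcdl.
Qed.
End Existence.

(** * Dense graphs without an enlarged complete multipartite graph *)

Definition joined (V : finType) (e : rel V) (k : nat) (A : nat -> {set V}) : Prop :=
  forall i j x y, i < k -> j < k -> i != j -> x \in A i -> y \in A j -> e x y.

(** Disjointness of the parts is not asked for: it follows from [joined] when [e] is irreflexive. *)
Definition kplus (V : finType) (e : rel V) (k t : nat) : Prop :=
  exists (A : nat -> {set V}) (i : nat) (u v : V),
  [/\ forall j, j < k -> t <= #|A j|, joined e k A & [/\ i < k, u \in A i, v \in A i & e u v]].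

Section Graph.
Variables (V : finType) (e : rel V).
Hypotheses (esym : symmetric e).
Implicit Types (A B C : nat -> {set V}).

Definition nbr (v : V) : {set V} := [set u | e v u].

Lemma joined_sub k A B : (forall i, i < k -> B i \subset A i) -> joined e k A -> joined e k B.
Proof.
move=> BA jA i j x y ik jk ij xB yB.
by apply: (jA i j) => //; [apply: (subsetP (BA i ik)) | apply: (subsetP (BA j jk))].
Qed.

Lemma shrink k A t : (forall i, i < k -> t <= #|A i|) ->
  exists B, (forall i, i < k -> B i \subset A i) /\ (forall i, i < k -> #|B i| = t).
Proof.
move=> At; have ex (i : 'I_k) : exists B : {set V}, B \subset A i /\ #|B| = t.
  by have [B ? ?] := subset_card (At i (ltn_ord i)); exists B.
have [B BP] := fin_all_exists ex.
exists (fun i => if insub i is Some j then B j else set0); split=> i ik;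
  by rewrite insubT; case: (BP (Sub i ik)).
Qed.

Lemma kplus_pair k t B i u v : joined e k B -> (forall j, j < k -> t <= #|B j|) ->
  i < k -> e u v -> (forall j x, j < k -> j != i -> x \in B j -> e u x && e v x) ->
  kplus e k t.
Proof.
move=> jB tB ik uv nuv.
exists (fun j => if j == i then B i :|: [set u; v] else B j), i, u, v; split.
- move=> j jk /=; case: (j =P i) => [_|_]; last exact: tB.
  exact: leq_trans (tB i ik) (subset_leq_card (subsetUl _ _)).
- move=> a b x y ak bk ab; case: (a =P i) => [ai|ai] /=; case: (b =P i) => [bi|bi] /=.
  + by rewrite ai bi eqxx in ab.
  + move=> + yb; rewrite !inE => /orP[xi|].
      by apply: (jB i b) => //; rewrite eq_sym; apply/eqP.
    have /andP[uy vy] := nuv b y bk (introN eqP bi) yb.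
    by case/orP => /eqP->.
  + move=> xa; rewrite !inE => /orP[yi|].
      by apply: (jB a i) => //; apply/eqP.
    have /andP[ux vx] := nuv a x ak (introN eqP ai) xa.
    by case/orP => /eqP->; rewrite esym.
  + exact: jB.
- by rewrite eqxx !inE !eqxx orbT orbT; split; rewrite ?orbT.
Qed.

(** A neighbour of [v] in part 0 supplies the extra edge: [v] is put into part 0 and the other parts
    are cut down to its neighbours. *)
Lemma kplus_vertex k t B v : 0 < k -> 0 < t -> joined e k B ->
  (forall j, j < k -> t <= #|B j :&: nbr v|) -> kplus e k t.
Proof.
move=> k0 t0 jB tB.
have /card_gt0P[w] : 0 < #|B 0 :&: nbr v| by apply: leq_trans t0 (tB 0 k0).
rewrite !inE => /andP[wB vw].
apply: (@kplus_pair k t (fun j => if j == 0 then B 0 else B j :&: nbr v) 0 v w) => //.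
- apply: joined_sub jB => i ik /=; case: (i =P 0) => [->|_] //; exact: subsetIl.
- move=> j jk /=; case: (j =P 0) => [_|_]; last exact: tB.
  exact: leq_trans (tB 0 k0) (subset_leq_card (subsetIl _ _)).
- move=> j x jk j0; rewrite (negbTE j0) !inE => /andP[xB ->].
  by apply: (jB 0 j) => //; rewrite eq_sym.
Qed.

Lemma leq_card_bigcup (I : finType) (P : pred I) (F : I -> {set V}) :
  #|\bigcup_(i | P i) F i| <= \sum_(i | P i) #|F i|.
Proof.
elim/big_rec2: _ => [|i m S _ le]; first by rewrite cards0.
exact: leq_trans (leq_card_setU _ _) (leq_add (leqnn _) le).
Qed.

Lemma greedy_joined k t D B : (forall i, i < k -> t + k * t * D <= #|B i|) ->
  (forall i j x, i < k -> j < k -> i != j -> x \in B i -> #|B j :\: nbr x| <= D) ->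
  exists C, [/\ forall i, i < k -> C i \subset B i, forall i, i < k -> #|C i| = t & joined e k C].
Proof.
move=> szB missB.
suff H j : j <= k -> exists C, [/\ forall i, i < j -> C i \subset B i,
    forall i, i < j -> #|C i| = t & joined e j C].
  exact: H.
elim: j => [|j IH] jk; first by exists (fun=> set0).
have [C [CB szC jC]] := IH (ltnW jk).
pose bad := \bigcup_(i < j) \bigcup_(x in C i) (B j :\: nbr x).
have bad_le : #|bad| <= j * (t * D).
  apply: (@leq_trans (\sum_(i < j) t * D)); last by rewrite sum_nat_const card_ord.
  apply: leq_trans (leq_card_bigcup _ _) _; apply: leq_sum => i _.
  apply: leq_trans (leq_card_bigcup _ _) _.
  rewrite -(szC i (ltn_ord i)) -sum_nat_const; apply: leq_sum => x xC.
  have ij : i < j := ltn_ord i.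
  apply: (missB i) => //; first exact: ltn_trans ij jk.
    by rewrite neq_ltn ij.
  exact: (subsetP (CB i ij)).
have [|K KB cK] := @subset_card _ (B j :\: bad) t.
  rewrite cardsD; have := szB j jk; have := subset_leq_card (subsetIr (B j) bad).
  have : j * (t * D) <= k * t * D by rewrite mulnA !leq_mul2r ltnW ?orbT.
  by move: bad_le; clear; lia.
exists (fun i => if i == j then K else C i); split.
- move=> i; rewrite ltnS leq_eqVlt; case: (i =P j) => [-> _|_ /= ij]; last exact: CB.
  by apply: subset_trans KB _; apply: subsetDl.
- by move=> i; rewrite ltnS leq_eqVlt; case: (i =P j) => [_ _|_ /= ij] //; apply: szC.
have CK i x y : i < j -> x \in C i -> y \in K -> e x y.
  move=> ij xC /(subsetP KB); rewrite inE => /andP[+ yB]; apply: contraNT => nxy.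
  apply/bigcupP; exists (Ordinal ij) => //; apply/bigcupP; exists x => //.
  by rewrite !inE nxy.
move=> a b x y; rewrite [a < _]ltnS [b < _]ltnS [a <= j]leq_eqVlt [b <= j]leq_eqVlt.
case: (a =P j) => [->|_] /=; case: (b =P j) => [->|_] /=.
- by rewrite eqxx.
- by move=> _ bj _ xK yC; rewrite esym; apply: CK yC xK.
- by move=> aj _ _ xC yK; apply: CK xC yK.
- by move=> aj bj ab xC yC; apply: (jC a b).
Qed.

Lemma sum_missing k T nu A : (forall i, i < k -> #|A i| = T) ->
  (forall v, #|~: nbr v| <= nu) ->
  \sum_v \sum_(i < k) #|A i :\: nbr v| <= k * T * nu.
Proof.
move=> cA nbr_nu.
have -> : \sum_v \sum_(i < k) #|A i :\: nbr v| = \sum_(i < k) \sum_(x in A i) #|~: nbr x|.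
  rewrite exchange_big; apply: eq_bigr => i _.
  under eq_bigr do rewrite -sum1dep_card.
  rewrite (exchange_big_dep (mem (A i))) /=; last by move=> v x _; rewrite !inE => /andP[].
  apply: eq_bigr => x xA; rewrite -sum1dep_card; apply: eq_bigl => v.
  by rewrite !inE xA andbT esym.
apply: (@leq_trans (\sum_(i < k) T * nu)); last by rewrite sum_nat_const card_ord mulnA.
apply: leq_sum => i _; rewrite -(cA i (ltn_ord i)) -sum_nat_const; exact: leq_sum.
Qed.

Lemma pigeonhole (S : finType) (P : {set V}) (Q : {set S}) (f : V -> S) T :
  (forall v, v \in P -> f v \in Q) -> 0 < T -> #|Q| * T <= #|P| -> 0 < #|P| ->
  exists q, T <= #|[set v in P | f v == q]|.
Proof.
move=> fQ T0 QT P0; apply/existsP; apply: contraT; rewrite negb_exists => /forallP small.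
have : #|P| <= #|Q| * T.-1.
  rewrite -sum1_card (partition_big f (mem Q)) //= -sum_nat_const.
  apply: leq_sum => q _; rewrite sum1dep_card -ltnS prednK // ltnNge.
  by have := small q; congr (~~ (_ <= _)); apply: eq_card => v; rewrite !inE.
have [p pP] : exists p, p \in P by apply/card_gt0P.
have Q0 : 0 < #|Q| by apply/card_gt0P; exists (f p); apply: fQ.
by move: QT; rewrite -{1}(prednK T0) mulnS => QT; clear - QT Q0; lia.
Qed.

Section Classes.
Variables (k t nu : nat).
Hypotheses (k0 : 0 < k) (t0 : 0 < t) (nkp : ~ kplus e k t).
Hypothesis nbr_nu : forall v, #|~: nbr v| <= nu.

(** [D] is the total slack. An independent class has at most [nu] vertices, so by the covering
    hypothesis each has at least nu - D, and a vertex of one class misses at most [D] vertices of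
    another. Every vertex has few neighbours in some class, which becomes its colour; it then sees
    nearly all of the other classes, so two adjacent vertices of one colour would give a [kplus]. *)
Lemma classes_colourable (U : nat -> {set V}) (b : nat) :
  let D := k * nu + b - #|V| in
  (forall i u v, i < k -> u \in U i -> v \in U i -> ~~ e u v) ->
  (forall i j u, i < k -> j < k -> i != j -> u \in U i -> u \notin U j) ->
  #|V| <= \sum_(i < k) #|U i| + b ->
  b + 3 * (k * D) + 3 * (k * (t + k * t * D)) <= #|V| ->
  exists c : V -> 'I_k, forall u v, e u v -> c u != c v.
Proof.
move=> D indU disjU coverU big.
pose F := t + k * t * D.
have U_nu i : i < k -> #|U i| <= nu.
  move=> ik; case: (set_0Vmem (U i)) => [->|[u uU]]; first by rewrite cards0.
  apply: leq_trans (nbr_nu u); apply: subset_leq_card; apply/subsetP => v vU.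
  by rewrite !inE (indU i).
have sumU i : i < k -> \sum_(j < k) #|U j| <= #|U i| + k.-1 * nu.
  move=> ik; rewrite (bigD1 (Ordinal ik)) //= leq_add2l.
  apply: leq_trans (_ : \sum_(j < k | j != Ordinal ik) nu <= _); first by apply: leq_sum => j _; apply: U_nu.
  by rewrite sum_nat_const cardC1 card_ord.
have U_ge i : i < k -> nu <= #|U i| + D.
  move=> ik; have := sumU i ik; move: coverU.
  have : k * nu = nu + k.-1 * nu by rewrite -mulSn prednK.
  rewrite /D; clear; lia.
have miss i v c : i < k -> #|U i :&: nbr v| <= c ->
    forall j, j < k -> j != i -> #|U j :\: nbr v| <= D + c.
  move=> ik vc j jk ji.
  have dis : [disjoint U j :\: nbr v & U i :\: nbr v].
    rewrite -setI_eq0; apply/eqP/setP => x; rewrite !inE.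
    by apply/negbTE/negP => /andP[/andP[_ xj] /andP[_ xi]]; have := disjU j i x jk ik ji xj; rewrite xi.
  have : #|(U j :\: nbr v) :|: (U i :\: nbr v)| <= nu.
    apply: leq_trans (nbr_nu v); apply: subset_leq_card; apply/subsetP => x.
    by rewrite !inE => /orP[]/andP[].
  rewrite cardsU disjoint_setI0 // cards0 subn0.
  have := U_ge i ik; have := cardsID (nbr v) (U i); move: vc; clear; lia.
have missU i j u : i < k -> j < k -> i != j -> u \in U i -> #|U j :\: nbr u| <= D.
  move=> ik jk ij uU; rewrite -[D]addn0; apply: (miss i) => //; last by rewrite eq_sym.
  rewrite leqn0 cards_eq0; apply/eqP/setP => x; rewrite !inE.
  by apply/negbTE/negP => /andP[xU]; apply/negP/(indU i).
have low v : exists i : 'I_k, #|U i :&: nbr v| < F.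
  apply/existsP; apply: contraT; rewrite negb_exists => /forallP noi; case: nkp.
  have [|i j x ik jk ij|C [CU szC jC]] := @greedy_joined k t D (fun i => U i :&: nbr v).
  - by move=> i ik; have := noi (Ordinal ik); rewrite -leqNgt.
  - rewrite inE => /andP[xU _]; apply: leq_trans (missU i j x ik jk ij xU).
    by apply: subset_leq_card; apply: setSD; apply: subsetIl.
  - apply: (@kplus_vertex k t C v) => // j jk.
    rewrite (setIidPl _) ?szC //; apply: subset_trans (CU j jk) _; exact: subsetIr.
have [c cP] := fin_all_exists low.
exists c => u v uv; apply/negP => /eqP cuv; case: nkp.
pose i := c u; have ik : i < k := ltn_ord i.
have lv : #|U i :&: nbr v| < F by rewrite /i cuv.
have lu : #|U i :&: nbr u| < F := cP u.
pose B j := if j == i :> nat then U i else U j :&: nbr u :&: nbr v.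
have nkD : #|V| <= b + k * #|U i| + k * D.
  have : k * nu <= k * #|U i| + k * D by rewrite -mulnDr leq_mul2l U_ge ?orbT.
  have : \sum_(j < k) #|U j| <= k * nu.
    rewrite -[k in X in _ <= X]card_ord -sum_nat_const; apply: leq_sum => j _; exact: U_nu.
  by move: coverU; clear; lia.
have UB j : j < k -> 2 * D + 3 * F <= #|U j|.
  move=> jk; rewrite -(leq_pmul2l k0).
  have : k * nu <= k * #|U j| + k * D by rewrite -mulnDr leq_mul2l U_ge ?orbT.
  have : \sum_(j < k) #|U j| <= k * nu.
    rewrite -[k in X in _ <= X]card_ord -sum_nat_const; apply: leq_sum => j' _; exact: U_nu.
  rewrite -/F in big; move: coverU big; clear; lia.
have [||C [CB szC jC]] := @greedy_joined k t D B.
- move=> j jk; rewrite /B -/F; case: (j =P i :> nat) => [_|/eqP ji].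
    by have := UB i ik; clear; lia.
  have mu := miss i u F ik (ltnW lu) j jk ji; have mv := miss i v F ik (ltnW lv) j jk ji.
  have := cardsID (nbr u) (U j); have := cardsID (nbr v) (U j :&: nbr u).
  have : #|U j :&: nbr u :\: nbr v| <= #|U j :\: nbr v|.
    by apply: subset_leq_card; apply: setSD; apply: subsetIl.
  by have := UB j jk; move: mu mv; clear; lia.
- move=> a a' x ak a'k aa' xB.
  have BU l : B l \subset U l.
    by rewrite /B; case: eqP => [->|_] //; rewrite -setIA subsetIl.
  apply: leq_trans (missU a a' x ak a'k aa' _); last exact: (subsetP (BU a)).
  by apply: subset_leq_card; apply: setSD; apply: BU.
- apply: (@kplus_pair k t C i u v) => //; first by move=> j jk; rewrite szC.
  move=> j x jk ji /(subsetP (CB j jk)); rewrite /B (negbTE ji) !inE.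
  by move=> /andP[/andP[_ ->] ->].
Qed.

(** Without [kplus] each vertex has fewer than [t] neighbours in some block. Class i collects those
    for which this is block i and which miss at most a quarter of every other block; two adjacent
    ones would share half of each other block. A vertex in no class misses an extra T/4, and double
    counting of missing pairs bounds their number [b]. *)
Lemma typed_classes (A : nat -> {set V}) T : (forall i, i < k -> #|A i| = T) ->
  joined e k A -> 4 * t <= T ->
  exists (U : nat -> {set V}) (b : nat),
  [/\ forall i u v, i < k -> u \in U i -> v \in U i -> ~~ e u v,
      forall i j u, i < k -> j < k -> i != j -> u \in U i -> u \notin U j,
      #|V| <= \sum_(i < k) #|U i| + b
    & b * T + 4 * (#|V| * (T - t)) <= 4 * (k * T * nu)].
Proof.
move=> cA jA tT.
pose U i := [set v | (#|A i :&: nbr v| < t) && [forall j : 'I_k, (j != i :> nat) ==> (4 * #|A j :\: nbr v| <= T)]].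
have UP i v : v \in U i -> #|A i :&: nbr v| < t /\
    forall j, j < k -> j != i -> 4 * #|A j :\: nbr v| <= T.
  rewrite inE => /andP[-> /forallP H]; split=> // j jk ji.
  by have /implyP := H (Ordinal jk); apply.
pose b := #|~: \bigcup_(i < k) U i|.
exists U, b; split.
- move=> i u v ik /UP[_ uA] /UP[_ vA]; apply/negP => uv; case: nkp.
  apply: (@kplus_pair k t (fun j => if j == i then A i else A j :&: nbr u :&: nbr v) i u v) => //.
  + apply: joined_sub jA => j jk /=; case: (j =P i) => [->|_] //; by rewrite -setIA subsetIl.
  + move=> j jk /=; case: (j =P i) => [_|/eqP ji]; first by rewrite cA //; move: tT; clear; lia.
    have := uA j jk ji; have := vA j jk ji; have := cA j jk.
    have := cardsID (nbr u) (A j); have := cardsID (nbr v) (A j :&: nbr u).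
    have : #|A j :&: nbr u :\: nbr v| <= #|A j :\: nbr v|.
      by apply: subset_leq_card; apply: setSD; apply: subsetIl.
    by move: tT; clear; lia.
  + by move=> j x jk ji; rewrite /= (negbTE ji) !inE => /andP[/andP[_ ->] ->].
- move=> i j u ik jk ij /UP[ui _]; apply/negP => /UP[_ /(_ i ik ij)].
  by have := cardsID (nbr u) (A i); rewrite (cA i ik); move: ui tT; clear; lia.
- rewrite /b -(cardsC (\bigcup_(i < k) U i)) leq_add2r; exact: leq_card_bigcup.
have typed v : exists i : 'I_k, #|A i :&: nbr v| < t.
  apply/existsP; apply: contraT; rewrite negb_exists => /forallP noi; case: nkp.
  apply: (@kplus_vertex k t A v) => // j jk.
  by have := noi (Ordinal jk); rewrite -leqNgt.
have missing v : 4 * (T - t) + (if v \in ~: \bigcup_(i < k) U i then T else 0) <= 4 * \sum_(i < k) #|A i :\: nbr v|.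
  have [i iv] := typed v; rewrite [\sum_(_ < _) _](bigD1 i) //= mulnDr.
  have le1 : 4 * (T - t) <= 4 * #|A i :\: nbr v|.
    by have := cardsID (nbr v) (A i); rewrite (cA i) //; move: iv; clear; lia.
  apply: leq_add => //; case: ifP => // vU.
  have /existsP[j /andP[ji jT]] : [exists j : 'I_k, (j != i) && (T < 4 * #|A j :\: nbr v|)].
    apply: contraT; rewrite negb_exists => /forallP H.
    move: vU; rewrite inE => /negP[]; apply/bigcupP; exists i => //.
    rewrite inE iv; apply/forallP => j; apply/implyP => ji.
    by have := H j; rewrite negb_and ji -leqNgt.
  apply: leq_trans (ltnW jT) _; rewrite leq_mul2l /=.
  by rewrite (bigD1 j) //=; apply: leq_addr.
have count := sum_missing cA nbr_nu.
have : \sum_v (4 * (T - t) + (if v \in ~: \bigcup_(i < k) U i then T else 0)) <= \sum_v 4 * \sum_(i < k) #|A i :\: nbr v|.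
  by apply: leq_sum => v _; apply: missing.
rewrite -big_distrr /= big_split /= sum_nat_const -big_mkcond sum_nat_const -/b => le.
have {count} : 4 * \sum_v \sum_(i < k) #|A i :\: nbr v| <= 4 * (k * T * nu) by rewrite leq_mul2l.
by apply: leq_trans; rewrite addnC [4 * (_ * _)]mulnCA.
Qed.

End Classes.
End Graph.

(** Erdos-Stone induction on the number of blocks: many vertices have [T] neighbours in each old
    block, and by pigeonhole [T] of them have the same neighbourhood in the blocks and form the new
    one. *)
Lemma turan_blocks k j T : 0 < k -> j <= k ->
  exists N, forall (V : finType) (e : rel V), symmetric e -> N <= #|V| ->
    (forall v, 2 * k * k * #|~: nbr e v| <= (2 * k + 1) * #|V|) ->
    exists A : nat -> {set V}, (forall i, i < j -> #|A i| = T) /\ joined e j A.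
Proof.
move=> k0; elim: j T => [|j IH] T jk; first by exists 0 => V e _ _ _; exists (fun=> set0).
case: (posnP T) => [->|T0].
  exists 0 => V e _ _ _; exists (fun=> set0); split=> [i _|i i' x y _ _ _]; first exact: cards0.
  by rewrite inE.
(* A vertex with fewer than [T] neighbours in some block misses more than 2kT of it. Since
   (k-1)(2k+1)^2 = 4k^3 - 3k - 1, double counting leaves a positive proportion of vertices that are
   not of this kind. *)
pose s := (2 * k + 1) * T; have [N NP] := IH s (ltnW jk).
exists (N + 4 * k * k * k * (T * 2 ^ (j * s)) + 1) => V e esym VN deg.
have [|A [cA jA]] := NP V e esym _ deg; first by move: VN; clear; lia.
pose nu := ((2 * k + 1) * #|V|) %/ (2 * k * k).
have kk0 : 0 < 2 * k * k by rewrite !muln_gt0 k0.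
have nbr_nu v : #|~: nbr e v| <= nu by rewrite leq_divRL // mulnC deg.
have nuE : 2 * k * k * nu <= (2 * k + 1) * #|V| by rewrite mulnC leq_divM.
pose full := [set v | [forall i : 'I_j, T <= #|A i :&: nbr e v|]].
have nonfull v : (if v \in ~: full then 2 * k * T else 0) <= \sum_(i < j) #|A i :\: nbr e v|.
  case: ifP => //; rewrite !inE negb_forall => notall; case: (existsP notall) => i; rewrite -ltnNge => lt.
  rewrite (bigD1 i) //=; apply: leq_trans (leq_addr _ _).
  by have := cardsID (nbr e v) (A i); rewrite cA // /s; move: lt; clear; lia.
have : #|~: full| * (2 * k * T) <= j * s * nu.
  apply: leq_trans (sum_missing esym cA nbr_nu).
  by rewrite -sum_nat_const big_mkcond; apply: leq_sum => v _; apply: nonfull.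
have -> : j * s * nu = j * ((2 * k + 1) * nu) * T by rewrite /s; lia.
rewrite mulnA leq_pmul2r // => le1.
have le2 : #|~: full| * (4 * k * k * k) <= k.-1 * (2 * k + 1) * (2 * k + 1) * #|V|.
  apply: (@leq_trans (j * ((2 * k + 1) * nu) * (2 * k * k))).
    have -> : 4 * k * k * k = 2 * k * (2 * k * k) by lia.
    by rewrite mulnA leq_mul2r le1 orbT.
  have -> : j * ((2 * k + 1) * nu) * (2 * k * k) = j * (2 * k + 1) * (2 * k * k * nu) by lia.
  rewrite -[X in _ <= X]mulnA; apply: leq_mul => //.
  by rewrite leq_mul2r -ltnS prednK // jk orbT.
have full_big : #|V| <= #|full| * (4 * k * k * k).
  have := cardsC full; have : k.-1 * (2 * k + 1) * (2 * k + 1) + (3 * k + 1) = 4 * k * k * k.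
    by case: (k) k0 => // k' _; rewrite succnK; clear; lia.
  move: le2; move: (4 * k * k * k) (k.-1 * _ * _) => K K' le2 KK' VC.
  have : (K' + (3 * k + 1)) * #|V| = K * (#|full| + #|~: full|) by rewrite KK' VC.
  have : #|V| <= (3 * k + 1) * #|V| by rewrite leq_pmull // addn1.
  by rewrite mulnDl mulnDr [#|full| * K]mulnC; move: le2; rewrite [_ * K]mulnC; clear; lia.
pose U := \bigcup_(i < j) A i.
have full_T : T * 2 ^ (j * s) <= #|full|.
  have K0 : 0 < 4 * k * k * k by rewrite !muln_gt0 k0.
  rewrite -(leq_pmul2r K0); apply: leq_trans full_big; apply: leq_trans VN.
  by rewrite mulnC; clear; lia.
have [||||S ST] := @pigeonhole V _ full (powerset U) (fun v => nbr e v :&: U) T.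
- by move=> v _; rewrite inE subsetIr.
- exact: T0.
- rewrite card_powerset mulnC; apply: leq_trans full_T; rewrite leq_pmul2l // leq_exp2l //.
  apply: leq_trans (leq_card_bigcup _ _) _.
  by under eq_bigr => i _ do rewrite cA //; rewrite sum_nat_const card_ord.
- by apply: leq_trans full_T; rewrite muln_gt0 T0 expn_gt0.
have [K KS cK] := subset_card ST.
have AU i : i < j -> A i \subset U by move=> ij; apply: (bigcup_sup (Ordinal ij)).
have [|B [BA cB]] := @shrink V j (fun i => A i :&: S) T.
  move=> i ij; have /set0Pn[v vS] : [set v in full | nbr e v :&: U == S] != set0.
    by rewrite -cards_eq0 -lt0n (leq_trans T0 ST).
  move: vS; rewrite !inE => /andP[/forallP/(_ (Ordinal ij)) /= + /eqP <-].
  by rewrite setIA setIAC (setIidPl (AU i ij)).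
exists (fun i => if i == j then K else B i); split.
  by move=> i; rewrite ltnS leq_eqVlt; case: (i =P j) => [_ _|_ /= ij] //; apply: cB.
have BK i x y : i < j -> x \in B i -> y \in K -> e x y.
  move=> ij /(subsetP (BA i ij)); rewrite inE => /andP[xA xS] /(subsetP KS).
  rewrite !inE => /andP[_ /eqP yS]; move: xS; rewrite -yS !inE => /andP[yx _].
  by rewrite esym.
have jB : joined e j B.
  by apply: joined_sub jA => i ij; apply: subset_trans (BA i ij) (subsetIl _ _).
move=> a b x y; rewrite [a < _]ltnS [b < _]ltnS [a <= j]leq_eqVlt [b <= j]leq_eqVlt.
case: (a =P j) => [->|_] /=; case: (b =P j) => [->|_] /=.
- by rewrite eqxx.
- by move=> _ bj _ xK yC; rewrite esym; apply: BK yC xK.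
- by move=> aj _ _ xC yK; apply: BK xC yK.
- by move=> aj bj ab xC yC; apply: (jB a b).
Qed.

(** With blocks of size t L, [typed_classes] gives b L <= 8 n and hence D L <= 9 n. The constant [c]
    adds up the resulting coefficients in the size condition of [classes_colourable], and L = 2 c k
    leaves half of n L for the term free of [D]. *)
Theorem dense_colourable k t : 0 < k -> 0 < t ->
  exists L N, 0 < L /\ forall (V : finType) (e : rel V), symmetric e -> N <= #|V| ->
    (forall v, k * L * #|~: nbr e v| <= (L + 1) * #|V|) -> ~ kplus e k t ->
    exists c : V -> 'I_k, forall u v, e u v -> c u != c v.
Proof.
move=> k0 t0; pose c := 8 + 27 * k + 27 * (k * (k * t)); pose L := 2 * c * k.
have c0 : 0 < c by rewrite /c.
have L0 : 0 < L by rewrite !muln_gt0.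
have [N NP] := @turan_blocks k k (t * L) k0 (leqnn k).
exists L, (N + 6 * k * t); split=> // V e esym VN deg nkp.
have [|v|A [cA jA]] := NP V e esym; first by move: VN; clear; lia.
  rewrite -(leq_pmul2l c0).
  have -> : c * (2 * k * k * #|~: nbr e v|) = k * L * #|~: nbr e v| by rewrite /L; lia.
  apply: leq_trans (deg v) _; rewrite mulnA leq_mul2r; apply/orP; right.
  by rewrite mulnDr muln1 mulnCA mulnA leq_add2l.
pose nu := ((L + 1) * #|V|) %/ (k * L).
have kL0 : 0 < k * L by rewrite muln_gt0 k0.
have nbr_nu v : #|~: nbr e v| <= nu by rewrite leq_divRL // mulnC deg.
have nuE : k * L * nu <= (L + 1) * #|V| by rewrite mulnC leq_divM.
have [|U [b [indU disjU coverU bad]]] := typed_classes esym k0 t0 nkp nbr_nu cA jA.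
  by rewrite mulnC leq_mul2l /L /c; apply/orP; right; clear - k0; lia.
apply: (classes_colourable esym k0 t0 nkp nbr_nu indU disjU coverU).
set D := k * nu + b - #|V|; move: #|V| VN nuE bad @D => n nN nuE bad D.
have bL : b * L <= 8 * n.
  have : t * (b * L + 4 * (n * (L - 1))) <= t * (4 * (k * L * nu)).
    apply: leq_trans (_ : _ <= 4 * (k * (t * L) * nu)) _; last by clear; lia.
    by apply: leq_trans bad; rewrite -[X in t * L - X]muln1 -mulnBr; clear; lia.
  have : n <= n * L by rewrite leq_pmulr.
  by rewrite leq_pmul2l // mulnBr muln1; move: nuE L0; clear; lia.
have DL : D * L <= 9 * n.
  rewrite /D mulnBl mulnDl [k * nu * L]mulnAC; move: bL nuE; clear; lia.
suff : b + 3 * (k * D) + 3 * (k * (t + k * t * D)) <= n by [].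
rewrite -(leq_pmul2r L0) mulnDl mulnDl.
have -> : 3 * (k * D) * L = 3 * k * (D * L) by lia.
have -> : 3 * (k * (t + k * t * D)) * L = 3 * k * t * L + 3 * k * k * t * (D * L) by lia.
have h1 : 3 * k * (D * L) <= 3 * k * (9 * n) by rewrite leq_mul2l DL orbT.
have h2 : 3 * k * k * t * (D * L) <= 3 * k * k * t * (9 * n) by rewrite leq_mul2l DL orbT.
have h3 : 3 * k * t * L <= c * k * n.
  have -> : 3 * k * t * L = c * k * (6 * k * t) by rewrite /L; lia.
  by rewrite leq_mul2l; apply/orP; right; move: nN; clear; lia.
have h4 : c * n <= c * k * n by rewrite leq_mul2r leq_pmulr ?orbT.
have -> : n * L = c * k * n + c * k * n by rewrite /L; lia.
apply: leq_trans (_ : _ <= c * n + c * k * n) _; last by rewrite leq_add2r.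
have -> : c * n = 8 * n + 3 * k * (9 * n) + 3 * k * k * t * (9 * n) by rewrite /c; lia.
by move: bL h1 h2 h3; clear; lia.
Qed.

Section Colouring.
Variables (V : finType) (F : rel V).
Hypothesis F_irr : irreflexive F.

Lemma colorable_card : colorableb F #|V|.
Proof.
apply/existsP; exists [ffun x => enum_rank x]; apply/forallP => u; apply/forallP => v.
by apply/implyP => uv; rewrite !ffunE (inj_eq enum_rank_inj); apply: contraTneq uv => ->; rewrite F_irr.
Qed.

(** * Expansions in linear hypergraphs *)

Lemma chromatic_numberP m : chromatic_number F = m ->
  colorableb F m /\ forall j, j < m -> ~~ colorableb F j.
Proof.
move=> <-; have has_col : has (colorableb F) (iota 0 #|V|.+1).
  by apply/hasP; exists #|V|; [rewrite mem_iota /= add0n ltnS | apply: colorable_card].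
have lt : find (colorableb F) (iota 0 #|V|.+1) < #|V|.+1.
  by rewrite -[X in _ < X](size_iota 0) -has_find.
split; first by have := nth_find 0 has_col; rewrite nth_iota.
move=> j jm; have := before_find 0 jm; rewrite nth_iota ?add0n => [->//|].
exact: ltn_trans jm lt.
Qed.
End Colouring.

Lemma set2_eq (T : finType) (x y a b : T) : x != y -> [set x; y] = [set a; b] ->
  (x = a /\ y = b) \/ (x = b /\ y = a).
Proof.
move=> xy e; have : (x \in [set a; b]) && (y \in [set a; b]) by rewrite -e !inE !eqxx orbT.
rewrite !inE => /andP[/orP[]/eqP xe /orP[]/eqP ye]; subst; rewrite ?eqxx // in xy *; auto.
Qed.

(** * Generic point sets in a linear hypergraph and the embedding of expansions *)

Section Linear.
Variables (T : finType) (r : nat) (H : {set {set T}}).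
Hypotheses (uH : uniform r H) (lH : linear_hg H).
Implicit Types (P : {set T}).

Definition shadow : rel T := fun x y => (x != y) && [exists h in H, (x \in h) && (y \in h)].

Lemma shadow_sym : symmetric shadow.
Proof. by move=> x y; rewrite /shadow eq_sym; under eq_existsb do rewrite [(x \in _) && _]andbC. Qed.

Lemma edge_uniq h h' (x y : T) : h \in H -> h' \in H -> x != y ->
  x \in h -> y \in h -> x \in h' -> y \in h' -> h = h'.
Proof.
move=> hH h'H xy xh yh xh' yh'; apply/eqP; apply: contraT => hh'.
have := lH hH h'H hh'; have : #|[set x; y]| <= #|h :&: h'|.
  by apply: subset_leq_card; rewrite subUset !sub1set !inE xh xh' yh yh'.
rewrite cards2 xy; lia.
Qed.

Definition line (x y : T) : {set T} := odflt set0 [pick h in H | (x != y) && (x \in h) && (y \in h)].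

Lemma lineE h (x y : T) : h \in H -> x != y -> x \in h -> y \in h -> line x y = h.
Proof.
move=> hH xy xh yh; rewrite /line; case: pickP => [h' /and3P[h'H /andP[_ xh'] yh']|/(_ h)] /=.
  exact: edge_uniq h'H hH xy xh' yh' xh yh.
by rewrite hH xy xh yh.
Qed.

Lemma mem_lineP (x y z : T) : z \in line x y -> [/\ line x y \in H, x != y, x \in line x y & y \in line x y].
Proof.
rewrite /line; case: pickP => [h' /and3P[h'H /andP[xy xh'] yh']|_] /=; last by rewrite inE.
by [].
Qed.

Lemma line_sym x y : line x y = line y x.
Proof.
by rewrite /line; congr (odflt _ _); apply: eq_pick => h; rewrite eq_sym -!andbA [(x \in h) && _]andbC.
Qed.

Lemma card_line x y : #|line x y| <= r.
Proof.
rewrite /line; case: pickP => [h /and3P[hH _ _]|_] /=; first by rewrite uH.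
by rewrite cards0.
Qed.

Definition span P := P :|: \bigcup_(x in P) \bigcup_(y in P) line x y.

Lemma card_span P m : #|P| <= m -> #|span P| <= m + m * (m * r).
Proof.
move=> Pm; apply: leq_trans (leq_card_setU _ _) _; apply: leq_add => //.
apply: leq_trans (leq_card_bigcup _ _) _.
apply: (@leq_trans (\sum_(x in P) m * r)); last by rewrite sum_nat_const leq_mul2r Pm orbT.
apply: leq_sum => x _; apply: leq_trans (leq_card_bigcup _ _) _.
apply: (@leq_trans (\sum_(y in P) r)); first by apply: leq_sum => y _; apply: card_line.
by rewrite sum_nat_const leq_mul2r Pm orbT.
Qed.

Lemma sub_span P : {subset P <= span P}.
Proof. by move=> x xP; rewrite inE xP. Qed.

Lemma line_span P x y z : x \in P -> y \in P -> z \in line x y -> z \in span P.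
Proof.
move=> xP yP zl; rewrite inE; apply/orP; right.
by apply/bigcupP; exists x => //; apply/bigcupP; exists y.
Qed.

(* No edge of H has three points in P, and disjoint pairs of P span disjoint edges. *)
Definition generic P :=
  (forall x y z, x \in P -> y \in P -> z \in P -> z \in line x y -> z = x \/ z = y) /\
  (forall x y z w s, x \in P -> y \in P -> z \in P -> w \in P ->
     x != z -> x != w -> y != z -> y != w -> s \in line x y -> s \notin line z w).

Lemma generic_pair u v : generic [set u; v].
Proof.
split=> [x y z|x y z w s].
  rewrite !inE => + + + /mem_lineP[_ xy _ _].
  by do 3![case/orP => /eqP ?]; subst; rewrite ?eqxx // in xy *; auto.
rewrite !inE => + + + _ + + + _ /mem_lineP[_ xy _ _].
by do 3![case/orP => /eqP ?]; subst; rewrite ?eqxx // in xy *.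
Qed.

(** The double span is needed for disjoint pairs: if the line through p and y met the line through z
    and w in s, then s would lie in [span P], and p, being on the line through y and s, in
    [span (span P)]. *)
Lemma generic_add P p : generic P -> p \notin span (span P) -> generic (p |: P).
Proof.
move=> [g1 g2] pS.
have pSP : p \notin span P by apply: contra pS; apply: sub_span.
have pP : p \notin P by apply: contra pSP; apply: sub_span.
have swap a b : p != a -> b \in line p a -> b != a -> p \in line a b.
  move=> pa bl ba; have [lH' _ pl al] := mem_lineP bl.
  by rewrite (lineE lH' _ al bl) // eq_sym.
have cross y z w s : y \in P -> z \in P -> w \in P -> y != z -> y != w ->
    s \in line p y -> s \in line z w -> False.
  move=> yP zP wP yz yw spy szw; have [sy|sy] := eqVneq s y.
    by have := g1 z w y zP wP yP; rewrite -sy => /(_ szw)[] e; move: yz yw; rewrite -sy e eqxx.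
  have [_ py _ _] := mem_lineP spy.
  case/negP: pS; apply: (@line_span _ y s) => //; first exact: sub_span.
    exact: line_span szw.
  exact: swap.
split=> [x y z|x y z w s].
  move=> xP' yP' zP' zl; have [lH' xy xl yl] := mem_lineP zl.
  have [->|zx] := eqVneq z x; first by left.
  have [->|zy] := eqVneq z y; first by right.
  exfalso; move: xP' yP' zP'; rewrite !inE.
  case/orP => [/eqP xp|xP]; case/orP => [/eqP yp|yP]; case/orP => [/eqP zp|zP].
  - by rewrite zp xp eqxx in zx.
  - by rewrite xp yp eqxx in xy.
  - by rewrite zp xp eqxx in zx.
  - subst x; case/negP: pSP; apply: (@line_span _ y z) => //; exact: swap.
  - by rewrite zp yp eqxx in zy.
  - subst y; case/negP: pSP; apply: (@line_span _ x z) => //.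
    by apply: swap => //; [rewrite eq_sym | rewrite line_sym].
  - by subst z; case/negP: pSP; apply: line_span zl.
  - by case: (g1 x y z xP yP zP zl) => e; [rewrite e eqxx in zx | rewrite e eqxx in zy].
move=> xP' yP' zP' wP' xz xw yz yw sxy; apply/negP => szw.
have [_ xy _ _] := mem_lineP sxy; have [_ zw _ _] := mem_lineP szw.
move: xP' yP' zP' wP'; rewrite !inE.
case/orP => [/eqP xp|xP]; [|case/orP => [/eqP yp|yP]; [|case/orP => [/eqP zp|zP]; [|case/orP => [/eqP wp|wP]]]].
- subst x; rewrite ![_ == p]eq_sym (negbTE xy) (negbTE xz) (negbTE xw) /= => yP zP wP.
  exact: cross yP zP wP yz yw sxy szw.
- subst y; rewrite ![_ == p]eq_sym (negbTE yz) (negbTE yw) /= => zP wP.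
  by apply: (cross x z w s) => //; rewrite line_sym.
- subst z; rewrite ![_ == p]eq_sym (negbTE zw) /= => wP.
  by apply: (cross w x y s) => //; rewrite 1?eq_sym // line_sym.
- by subst w; apply: (cross z x y s) => //; rewrite 1?eq_sym // line_sym.
- by have := g2 x y z w s xP yP zP wP xz xw yz yw sxy; rewrite szw.
Qed.
Definition span_bound m := m + m * (m * r).

Section Embedding.
Variables (V : finType) (F : rel V) (k : nat).
Hypotheses (F_simple : simple_graph F) (F_critical : color_critical F k).

(** Without its critical edge F is k-colourable, and the ends of that edge must get equal colours
    since F is not. They are mapped to the extra edge of the [kplus], every other vertex to a
    generic point of the part of its colour. *)
Lemma generic_embedding : 0 < k -> kplus shadow k (span_bound (span_bound #|V|)).+1 ->
  exists phi : V -> T, [/\ injective phi, forall x y : V, F x y -> shadow (phi x) (phi y)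
    & generic [set phi x | x in V]].
Proof.
move=> k0 [A [i [u [v [cA jA [ik uA vA uv]]]]]].
have [F_sym F_irr] := F_simple; have [chiF [u0 [v0 [Fuv chiD]]]] := F_critical.
have D_irr : irreflexive (del_edge F u0 v0) by move=> x; rewrite /del_edge F_irr.
have [/existsP[c /forallP cP] _] := chromatic_numberP D_irr chiD.
have cE (x y : V) : F x y -> [set x; y] != [set u0; v0] -> c x != c y.
  by move=> Fxy ne; have /forallP/(_ y)/implyP := cP x; apply; rewrite /del_edge Fxy.
have cuv : c u0 = c v0.
  apply/eqP; apply: contraT => ne; have [_ /(_ k (ltnSn k)) /negP[]] := chromatic_numberP F_irr chiF.
  apply/existsP; exists c; apply/forallP => x; apply/forallP => y; apply/implyP => Fxy.
  have nxy : x != y by apply: contraTneq Fxy => ->; rewrite F_irr.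
  have [e|] := eqVneq [set x; y] [set u0; v0]; last exact: cE.
  by case: (set2_eq nxy e) => -[-> ->]; rewrite // eq_sym.
have nuv0 : u0 != v0 by apply: contraTneq Fuv => ->; rewrite F_irr.
(* Colours are permuted so that the common colour of [u0] and [v0] becomes the part that contains
   the extra edge. *)
pose sigma (j : 'I_k) : nat := tperm (c u0) (Ordinal ik) j.
have sigma_lt j : sigma j < k by apply: ltn_ord.
have sigma_inj (j j' : 'I_k) : j != j' -> sigma j != sigma j'.
  by move=> jj'; rewrite /sigma val_eqE (inj_eq perm_inj).
have sigma_c : sigma (c u0) = i by rewrite /sigma tpermL.
have ext (s : seq V) : exists (D : {set V}) (phi : V -> T),
  [/\ {subset s <= D}, u0 \in D /\ v0 \in D, {in D &, injective phi}, phi u0 = u /\ phi v0 = v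
    & (forall x, x \in D -> phi x \in A (sigma (c x))) /\ generic [set phi x | x in D]].
  elim: s => [|x s [D [phi [sD [uD vD] inj [pu pv] [pA gen]]]]].
    have nuv : u != v by case/andP: uv.
    exists [set u0; v0], (fun x => if x == u0 then u else v).
    have e : [set (if x == u0 then u else v) | x in [set u0; v0]] = [set u; v].
      by rewrite imsetU !imset_set1 eqxx eq_sym (negbTE nuv0).
    split=> //.
    - by rewrite !inE !eqxx orbT.
    - move=> x y; rewrite !inE => /orP[]/eqP-> /orP[]/eqP->; rewrite ?eqxx ?[v0 == _]eq_sym ?(negbTE nuv0) //.
        by move=> e'; rewrite e' eqxx in nuv.
      by move=> e'; rewrite e' eqxx in nuv.
    - by rewrite eqxx eq_sym (negbTE nuv0).
    - split; last by rewrite e; apply: generic_pair.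
      by move=> x; rewrite !inE => /orP[]/eqP->; rewrite -?cuv sigma_c ?eqxx // eq_sym (negbTE nuv0).
  case: (boolP (x \in D)) => xD.
    exists D, phi; split=> // y; rewrite inE => /orP[/eqP->//|]; exact: sD.
  pose P := [set phi x | x in D].
  have P_le : #|P| <= #|V| by apply: leq_trans (leq_imset_card _ _) (max_card _).
  have [p pA' pS] : exists2 p, p \in A (sigma (c x)) & p \notin span (span P).
    have : ~~ (A (sigma (c x)) \subset span (span P)).
      apply: contraL (cA _ (sigma_lt (c x))) => /subset_leq_card le.
      by rewrite -ltnNge ltnS; apply: leq_trans le _; do 2!apply: card_span.
    by case/subsetPn => p; exists p.
  have pP : p \notin P by apply: contra pS => /sub_span/sub_span.
  have xu : u0 == x = false by apply/negbTE; apply: contraNneq xD => <-.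
  have xv : v0 == x = false by apply/negbTE; apply: contraNneq xD => <-.
  have DE y : y \in D -> y == x = false by move=> yD; apply/negbTE; apply: contraNneq xD => <-.
  exists (x |: D), (fun y => if y == x then p else phi y); split=> //.
  - by move=> y; rewrite !inE => /orP[->//|/sD->]; rewrite orbT.
  - by rewrite !inE uD vD !orbT.
  - move=> y z; rewrite !inE => /orP[/eqP->|yD] /orP[/eqP->|zD]; rewrite ?eqxx ?DE //.
    + by move=> e; case/negP: pP; rewrite e; apply: imset_f.
    + by move=> e; case/negP: pP; rewrite -e; apply: imset_f.
    + exact: inj.
  - by rewrite xu xv.
  - split; first by move=> y; rewrite !inE => /orP[/eqP->|yD]; rewrite ?eqxx ?DE //; apply: pA.
    have -> : [set (if y == x then p else phi y) | y in x |: D] = p |: P.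
      rewrite imsetU imset_set1 eqxx; congr (_ |: _); apply: eq_in_imset => y yD.
      by rewrite DE.
    exact: generic_add.
have [D [phi [sD _ inj [pu pv] [pA gen]]]] := ext (enum V).
have DT x : x \in D by apply: sD; rewrite mem_enum.
exists phi; split.
- by move=> x y; apply: inj.
- move=> x y Fxy; have nxy : x != y by apply: contraTneq Fxy => ->; rewrite F_irr.
  have [e|ne] := eqVneq [set x; y] [set u0; v0].
    by case: (set2_eq nxy e) => -[-> ->]; rewrite pu pv // shadow_sym.
  apply: (jA (sigma (c x)) (sigma (c y))); rewrite ?pA ?DT //.
  by apply: sigma_inj; apply: cE.
- have <- // : [set phi x | x in D] = [set phi x | x in V].
  by apply: eq_imset_l || (apply/setP => z; apply/imsetP/imsetP => -[x xD ->]; exists x).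
Qed.

Lemma kplus_contains_expansion : 1 < r -> 0 < k ->
  kplus shadow k (span_bound (span_bound #|V|)).+1 -> contains_copy H (expansion F r).
Proof.
move=> r1 k0 /(generic_embedding k0)[phi [phi_inj phiF [g1 g2]]].
have [F_sym F_irr] := F_simple.
have phiP x : phi x \in [set phi x | x in V] by apply: imset_f.
have edgeP (e : graph_edge F) : exists xy : V * V, F xy.1 xy.2 /\ val e = [set xy.1; xy.2].
  by have /existsP[x /existsP[y /andP[Fxy /eqP ->]]] := valP e; exists (x, y).
have [ends endsP] := fin_all_exists edgeP.
pose hyp e := line (phi (ends e).1) (phi (ends e).2).
have hypP e : [/\ hyp e \in H, phi @: val e \subset hyp e & #|phi @: val e| = 2].
  have [Fe ve] := endsP e; have /andP[nxy /exists_inP[h hH /andP[xh yh]]] := phiF _ _ Fe.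
  rewrite /hyp (lineE hH nxy xh yh); split=> //.
    by rewrite ve imsetU !imset_set1 subUset !sub1set xh.
  rewrite card_imset // ve cards2.
  by have -> // : (ends e).1 != (ends e).2; apply: contraNneq nxy => ->.
pose rest e := hyp e :\: phi @: val e.
have rest_card e : size (enum (rest e)) = r - 2.
  have [hH sub c2] := hypP e; rewrite -cardE cardsD (setIidPr sub) c2.
  by rewrite (uH hH).
pose f (z : exp_vertex F r) : T := match z with
  | inl x => phi x
  | inr (e, i) => nth (phi (ends e).1) (enum (rest e)) i end.
have f_rest e i : f (inr (e, i)) \in rest e.
  by rewrite -mem_enum mem_nth // rest_card.
have phi_hyp x e : phi x \in hyp e -> x \in val e.
  move=> xh; have [_ ->] := endsP e.
  by have := g1 _ _ _ (phiP _) (phiP _) (phiP _) xh; case=> /phi_inj->; rewrite !inE eqxx ?orbT.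
have rest_phi x e : phi x \in rest e -> False.
  by rewrite inE => /andP[/negP nx /phi_hyp xe]; apply: nx; apply: imset_f.
(* If the two graph edges share a vertex, linearity makes their hyperedges equal and genericity
   makes the edges equal; if they are disjoint, genericity keeps their hyperedges disjoint. *)
have rest_uniq e e' s : s \in rest e -> s \in rest e' -> e = e'.
  rewrite !inE => /andP[sn sh] /andP[sn' sh']; apply/eqP; apply: contraT => ee'.
  have [hH sub _] := hypP e; have [h'H sub' _] := hypP e'.
  have common x : x \in val e -> x \in val e' -> e == e'.
    move=> xe xe'; have nsx : s != phi x by apply: contraNneq sn => ->; apply: imset_f.
    have eh : hyp e = hyp e'.
      apply: (edge_uniq hH h'H nsx) => //; [apply: (subsetP sub) | apply: (subsetP sub')]; exact: imset_f.
    rewrite -val_eqE eqEsubset; apply/andP; split; apply/subsetP => y ye; apply: phi_hyp.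
      by rewrite -eh; apply: (subsetP sub); apply: imset_f.
    by rewrite eh; apply: (subsetP sub'); apply: imset_f.
  have [_ ve] := endsP e; have [_ ve'] := endsP e'.
  have ne a b : a \in val e -> b \in val e' -> phi a != phi b.
    move=> ae be; rewrite (inj_eq phi_inj); apply: contraNneq ee' => ab.
    by apply: (common a) => //; rewrite ab.
  have in1 : (ends e).1 \in val e by rewrite ve !inE eqxx.
  have in2 : (ends e).2 \in val e by rewrite ve !inE eqxx orbT.
  have in1' : (ends e').1 \in val e' by rewrite ve' !inE eqxx.
  have in2' : (ends e').2 \in val e' by rewrite ve' !inE eqxx orbT.
  have := g2 _ _ _ _ s (phiP _) (phiP _) (phiP _) (phiP _) (ne _ _ in1 in1') (ne _ _ in1 in2')
    (ne _ _ in2 in1') (ne _ _ in2 in2') sh.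
  by rewrite -/(hyp e') sh'.
exists f; split.
- move=> [x|[e i]] [y|[e' i']].
  + by move=> /phi_inj->.
  + by move=> e0; case: (@rest_phi x e'); rewrite -[phi x]/(f (inl x)) e0.
  + by move=> e0; case: (@rest_phi y e); rewrite -[phi y]/(f (inl y)) -e0.
  + move=> e0; have ee' : e = e' by apply: (@rest_uniq e e' (f (inr (e, i)))); rewrite // e0.
    subst e'; move: e0 => /= /eqP; rewrite nth_uniq ?enum_uniq ?rest_card //.
    by move/eqP/val_inj->.
- move=> _ /imsetP[e _ ->]; have [hH sub _] := hypP e.
  suff -> : f @: expansion_edge r e = hyp e by [].
  apply/setP => s; apply/imsetP/idP => [[z]|sh].
    rewrite inE => /orP[/imsetP[x xe ->] ->|/imsetP[i _ ->] ->].
      by apply: (subsetP sub); apply: imset_f.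
    by have := f_rest e i; rewrite inE => /andP[].
  case: (boolP (s \in phi @: val e)) => [/imsetP[x xe ->]|se].
    by exists (inl x) => //; rewrite inE imset_f.
  have sr : s \in rest e by rewrite inE se.
  have lt : index s (enum (rest e)) < r - 2 by rewrite -(rest_card e) index_mem mem_enum.
  exists (inr (e, Ordinal lt)); last by rewrite /= nth_index ?mem_enum.
  by rewrite inE; apply/orP; right; apply/imsetP; exists (Ordinal lt).
Qed.
End Embedding.
End Linear.

(** * The spectral bound for graphs *)

Local Open Scope ring_scope.

Section RayleighQuotient.
Import boolp classical_sets functions topology normedtype derive numFieldNormedType.Exports.
Local Open Scope classical_set_scope.

(** A continuous form attains its maximum on the compact part of the unit sphere given by the box,
    whose sides [0, 1] or [0, 0] encode sign and support; homogeneity extends the inequality to all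
    [y]. *)
Lemma quadratic_max (R : realType) (V : finType) (S : {set V}) (a : V -> V -> R) (s0 : V) :
  s0 \in S -> exists x : V -> R,
  [/\ forall v, 0 <= x v, forall v, v \notin S -> x v = 0, \sum_v x v ^+ 2 = 1
    & forall y : V -> R, (forall v, 0 <= y v) -> (forall v, v \notin S -> y v = 0) ->
      \sum_u \sum_v a u v * (y u * y v) <= (\sum_u \sum_v a u v * (x u * x v)) * \sum_v y v ^+ 2].
Proof.
move=> s0S; pose n := #|V|; pose c (w : 'rV[R]_n) v : R := w ord0 (enum_rank v).
pose f w := \sum_u \sum_v a u v * (c w u * c w v).
pose box (i : 'I_n) : set R := `[0, if enum_val i \in S then 1 else 0].
pose K := [set w : 'rV[R]_n | forall i, box i (w ord0 i)] `&` [set w | \sum_v c w v ^+ 2 = 1].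
have ccont v : continuous (fun w => c w v) by move=> w; apply: coord_continuous.
have sum_cont (g : V -> 'rV[R]_n -> R) : (forall v, continuous (g v)) -> continuous (fun w => \sum_v g v w).
  move=> gc w; apply: (@cvg_big R V +%R 0 xpredT _ _ (nbhs w) (index_enum V) g (fun v => g v w)).
    exact: add_continuous.
  by move=> v _; apply: gc.
have cK : compact K.
  apply: compact_closedI.
    by apply: (@rV_compact _ _ box) => i; apply: segment_compact.
  apply: (@preimage_closed _ _ (fun w => \sum_v c w v ^+ 2) [set 1]); last exact: closed_eq.
  move=> w _; apply: (sum_cont (fun v w => c w v ^+ 2)) => v w'.
  exact: (continuousM (ccont v w') (ccont v w')).
have fcont : continuous f.
  apply: (sum_cont (fun u w => \sum_v a u v * (c w u * c w v))) => u.
  apply: (sum_cont (fun v w => a u v * (c w u * c w v))) => v w.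
  have cst_cont : {for w, continuous (fun _ : 'rV[R]_n => a u v : R)} by exact: cst_continuous.
  have prod_cont : {for w, continuous (fun w => c w u * c w v)} by exact: (continuousM (ccont u w) (ccont v w)).
  exact: (continuousM cst_cont prod_cont).
have mkc (y : V -> R) v : c (\row_i y (enum_val i)) v = y v.
  by rewrite /c mxE enum_rankK.
have K0 : K !=set0.
  exists (\row_i (enum_val i == s0)%:R); split=> /=.
    by move=> i; rewrite mxE /box /= in_itv /=; case: (enum_val i =P s0) => [->|_]; [rewrite s0S|case: ifP => _]; rewrite ?mulr1n ?mulr0n ?lexx ?ler01.
  rewrite (bigD1 s0) //= (mkc (fun v => (v == s0)%:R)) eqxx expr1n big1 ?addr0 // => v /negbTE vs.
  by rewrite (mkc (fun v => (v == s0)%:R)) vs expr0n.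
have [w wK wmax] := EVT_max_rV K0 cK (continuous_subspaceT fcont).
have {wK}[wbox wsum] : K w by rewrite inE in wK.
exists (c w); split=> //.
- by move=> v; have := wbox (enum_rank v); rewrite /box /= in_itv /= => /andP[].
- move=> v vS; have := wbox (enum_rank v); rewrite /box /= in_itv /= enum_rankK (negbTE vS) => le0.
  by apply/eqP; rewrite eq_le andbC.
move=> y y0 yS; set s := \sum_v y v ^+ 2.
have s_ge0 : 0 <= s by apply: sumr_ge0 => v _; apply: sqr_ge0.
have y2_le v : y v ^+ 2 <= s.
  by rewrite /s (bigD1 v) //= lerDl; apply: sumr_ge0 => u _; apply: sqr_ge0.
have [s_eq0|s_neq0] := eqVneq s 0.
  rewrite s_eq0 mulr0 big1 // => u _; rewrite big1 // => v _.
  have -> : y u = 0 by apply/eqP; have := y2_le u; rewrite s_eq0 -sqrf_eq0 eq_le sqr_ge0 => ->.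
  by rewrite mul0r mulr0.
have s_gt0 : 0 < s by rewrite lt0r s_neq0.
pose z v := y v / Num.sqrt s.
have sqrt_gt0 : 0 < Num.sqrt s by rewrite sqrtr_gt0.
have := wmax (\row_i z (enum_val i)); rewrite !inE /=.
have fz : f (\row_i z (enum_val i)) = (\sum_u \sum_v a u v * (y u * y v)) / s.
  rewrite /f mulr_suml; apply: eq_bigr => u _; rewrite mulr_suml; apply: eq_bigr => v _.
  by rewrite !mkc /z -[in RHS](sqr_sqrtr s_ge0) expr2 invfM; ring.
rewrite fz ler_pdivrMr // => H; apply: H; split=> /=.
  move=> i; rewrite mxE /box /= in_itv /=; case: ifP => iS; last first.
    by rewrite /z yS ?iS // mul0r lexx.
  rewrite divr_ge0 ?sqrtr_ge0 //= ler_pdivrMr // mul1r.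
  by rewrite -[y _]ger0_norm // -sqrtr_sqr ler_sqrt.
transitivity (\sum_v (y v ^+ 2) / s).
  by apply: eq_bigr => v _; rewrite mkc /z expr_div_n sqr_sqrtr.
by rewrite -mulr_suml divff.
Qed.

End RayleighQuotient.

Section Inequalities.
Variable R : realFieldType.

Lemma sqr_sum_le (V : finType) (A : {set V}) (x : V -> R) :
  (\sum_(v in A) x v) ^+ 2 <= #|A|%:R * \sum_(v in A) x v ^+ 2.
Proof.
have -> : #|A|%:R * \sum_(v in A) x v ^+ 2 = \sum_(u in A) \sum_(v in A) (x u ^+ 2 + x v ^+ 2) / 2.
  have e : \sum_(u in A) \sum_(v in A) x u ^+ 2 = #|A|%:R * \sum_(v in A) x v ^+ 2.
    by under eq_bigr do rewrite sumr_const -mulr_natl; rewrite mulr_sumr.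
  under [RHS]eq_bigr => u _ do rewrite -mulr_suml big_split /=.
  by rewrite -mulr_suml big_split /= [X in _ + X]exchange_big /= e; field.
rewrite expr2 mulr_suml; apply: ler_sum => u _; rewrite mulr_sumr; apply: ler_sum => v _.
rewrite ler_pdivlMr // -subr_ge0.
have -> : x u ^+ 2 + x v ^+ 2 - x u * x v * 2 = (x u - x v) ^+ 2 by ring.
exact: sqr_ge0.
Qed.

Lemma bernoulli (h : R) n : 0 <= 1 + h -> 1 + n%:R * h <= (1 + h) ^+ n.
Proof.
move=> h0; elim: n => [|n IH]; first by rewrite mul0r addr0 expr0.
rewrite exprS; apply: le_trans (ler_wpM2l h0 IH).
rewrite -subr_ge0 -natr1.
have -> : (1 + h) * (1 + n%:R * h) - (1 + (n%:R + 1) * h) = n%:R * h ^+ 2 by ring.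
by rewrite mulr_ge0 // sqr_ge0.
Qed.

(* The entries of a vector maximizing rho(S)^(q+1) / |S|^q cannot be much smaller
   than average. *)
Lemma extremal_entry (X rho rho' : R) (s q : nat) : (0 < q)%N -> (1 < s)%N ->
  (q ^ 2 + q <= s)%N -> 0 <= X -> 0 < rho -> 0 <= rho' ->
  rho * (1 - 2 * X) <= rho' * (1 - X) ->
  rho' ^+ q.+1 * s%:R ^+ q <= rho ^+ q.+1 * (s - 1)%:R ^+ q ->
  q%:R <= (q + 2)%:R * s%:R * X.
Proof.
move=> q0 s1 qs X0 rho0 rho'0 step ext.
have sR : 1 < s%:R :> R by rewrite ltr1n.
have s0 : 0 < s%:R :> R by lra.
have s10 : 0 < (s - 1)%:R :> R by rewrite ltr0n subn_gt0.
have s1E : (s - 1)%:R = s%:R - 1 :> R by rewrite natrB // ltnW.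
have qR : 1 <= q%:R :> R by rewrite ler1n.
have qsR : q%:R ^+ 2 + q%:R <= s%:R :> R by rewrite -natrX -natrD ler_nat.
rewrite natrD.
have [X12|X12] := lerP (1 / 2) X.
  have : s%:R * (1 / 2) <= s%:R * X by rewrite ler_pM2l.
  by move: qsR qR; rewrite expr2; nra.
have pos2 : 0 < 1 - 2 * X by lra.
have pos1 : 0 < 1 - X by lra.
set z := X / (1 - X).
have zE : (1 - 2 * X) / (1 - X) = 1 + - z by rewrite /z; field; lra.
have le1 : ((1 - 2 * X) / (1 - X)) ^+ q.+1 * s%:R ^+ q <= (s - 1)%:R ^+ q.
  have h : rho * ((1 - 2 * X) / (1 - X)) <= rho' by rewrite mulrA ler_pdivrMr.
  have h' : (rho * ((1 - 2 * X) / (1 - X))) ^+ q.+1 <= rho' ^+ q.+1.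
    by apply: lerXn2r; rewrite ?nnegrE // mulr_ge0 ?divr_ge0 ?ltW.
  rewrite -(ler_pM2l (exprn_gt0 q.+1 rho0)) mulrA -exprMn.
  by apply: le_trans ext; rewrite ler_pM2r ?exprn_gt0.
(* Bernoulli's inequality, here and in [b2], linearizes both powers in [le1]. *)
have b1 : 1 - q.+1%:R * z <= ((1 - 2 * X) / (1 - X)) ^+ q.+1.
  by rewrite zE -mulrN; apply: bernoulli; rewrite -zE divr_ge0 ?ltW.
have b2 : 1 + q%:R * (s - 1)%:R^-1 <= (s%:R / (s - 1)%:R) ^+ q :> R.
  have -> : s%:R / (s - 1)%:R = 1 + (s - 1)%:R^-1 :> R.
    by rewrite s1E; field; move: s10; rewrite s1E => h; apply: lt0r_neq0.
  by apply: bernoulli; rewrite addr_ge0 ?invr_ge0 ?ltW.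
have le2 : (1 - q.+1%:R * z) * (1 + q%:R * (s - 1)%:R^-1) <= 1.
  have [neg|pos] := lerP (1 - q.+1%:R * z) 0.
    apply: le_trans (_ : 0 <= 1); last exact: ler01.
    rewrite mulr_le0_ge0 // addr_ge0 // mulr_ge0 ?invr_ge0 ?ltW //; lra.
  apply: le_trans (ler_wpM2l (ltW pos) b2) _.
  apply: le_trans (ler_wpM2r _ b1) _; first by rewrite exprn_ge0 // divr_ge0 ?ltW.
  by rewrite [(s%:R / _) ^+ q]expr_div_n mulrA ler_pdivrMr ?exprn_gt0 // mul1r.
have zX : z * (1 - X) = X by rewrite /z divfK // lt0r_neq0.
have e : (1 + q%:R / (s - 1)%:R) * (s - 1)%:R = s%:R - 1 + q%:R :> R.
  by rewrite mulrDl mul1r divfK ?lt0r_neq0 // s1E.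
have le3 : (1 - q.+1%:R * z) * (s%:R - 1 + q%:R) <= s%:R - 1.
  by rewrite -e mulrA -s1E -[X in _ <= X]mul1r ler_pM2r.
move: le3; rewrite -natr1 -(ler_pM2r pos1) => le3.
have le4 : (1 - (q%:R + 2) * X) * (s%:R - 1 + q%:R) <= (s%:R - 1) * (1 - X).
  apply: le_trans le3; rewrite le_eqVlt; apply/orP; left; apply/eqP.
  transitivity ((1 - X - (q%:R + 1) * (z * (1 - X))) * (s%:R - 1 + q%:R)); last by ring.
  by rewrite zX; ring.
have : q%:R <= X * ((q%:R + 1) * s%:R + (q%:R ^+ 2 + q%:R) - 1) by rewrite expr2; lra.
have : X * (q%:R ^+ 2 + q%:R) <= X * s%:R by rewrite ler_wpM2l.
by rewrite expr2; lra.
Qed.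
End Inequalities.

Section Rayleigh.
Variables (R : realType) (V : finType) (e : rel V).
Hypotheses (e_sym : symmetric e) (e_irr : irreflexive e).
Implicit Types (x y : V -> R) (S : {set V}).

Definition quad x : R := \sum_u \sum_v (e u v)%:R * (x u * x v).
Definition adj_mul x w : R := \sum_u (e w u)%:R * x u.

Lemma quad_add x w (c : R) :
  quad (fun v => x v + (v == w)%:R * c) = quad x + 2 * c * adj_mul x w.
Proof.
have term u v : (e u v)%:R * ((x u + (u == w)%:R * c) * (x v + (v == w)%:R * c)) =
    (e u v)%:R * (x u * x v) + ((v == w)%:R * (c * ((e u v)%:R * x u)) +
    (u == w)%:R * (c * ((e u v)%:R * x v))) :> R.
  have [->|uw] := eqVneq u w; have [->|vw] := eqVneq v w; rewrite ?e_irr /= ?mulr1n ?mulr0n; ring.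
have pick1 (f : V -> R) : \sum_v (v == w)%:R * f v = f w.
  by rewrite (bigD1 w) //= eqxx mul1r big1 ?addr0 // => v /negbTE->; rewrite mul0r.
rewrite /quad; under eq_bigr => u _ do (under eq_bigr => v _ do rewrite term; rewrite big_split /= big_split /=).
rewrite !big_split /=; congr (_ + _).
under eq_bigr => u _ do rewrite (pick1 (fun v => c * ((e u v)%:R * x u))).
under [X in _ + X]eq_bigr => u _ do rewrite -mulr_sumr.
rewrite (pick1 (fun u => \sum_v c * ((e u v)%:R * x v))) -!mulr_sumr /adj_mul.
under eq_bigr => u _ do rewrite e_sym.
ring.
Qed.

Lemma sqnorm_add x w (c : R) :
  \sum_v (x v + (v == w)%:R * c) ^+ 2 = \sum_v x v ^+ 2 + 2 * c * x w + c ^+ 2.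
Proof.
rewrite (bigD1 w) //= [in RHS](bigD1 w) //= eqxx mulr1n.
rewrite (eq_bigr (fun v => x v ^+ 2)); last by move=> v /negbTE->; rewrite mul0r addr0.
ring.
Qed.

Lemma quadE x : quad x = \sum_w x w * adj_mul x w.
Proof.
rewrite /quad; apply: eq_bigr => u _; rewrite mulr_sumr; apply: eq_bigr => v _; ring.
Qed.

Lemma quad_le_card x S : (forall v, 0 <= x v) -> (forall v, v \notin S -> x v = 0) ->
  quad x <= #|S|%:R * \sum_v x v ^+ 2.
Proof.
move=> x0 xS.
have -> : \sum_v x v ^+ 2 = \sum_(v in S) x v ^+ 2.
  rewrite [RHS]big_mkcond; apply: eq_bigr => v _; case: ifPn => // /xS->; by rewrite expr0n.
apply: le_trans (sqr_sum_le S x).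
have -> : \sum_(v in S) x v = \sum_v x v.
  by rewrite big_mkcond; apply: eq_bigr => v _; case: ifPn => // /xS->.
rewrite expr2 mulr_suml; apply: ler_sum => u _; rewrite mulr_sumr; apply: ler_sum => v _.
by rewrite ler_piMl ?mulr_ge0 //; case: (e u v).
Qed.

Definition rayleigh_max S x :=
  [/\ forall v, 0 <= x v, forall v, v \notin S -> x v = 0, \sum_v x v ^+ 2 = 1
    & forall y, (forall v, 0 <= y v) -> (forall v, v \notin S -> y v = 0) ->
      quad y <= quad x * \sum_v y v ^+ 2].

Lemma rayleigh_exists S : S != set0 -> exists x, rayleigh_max S x.
Proof.
move=> /set0Pn[s0 s0S].
by have [x [? ? ? ?]] := quadratic_max (fun u v => (e u v)%:R : R) s0S; exists x.
Qed.

Lemma quad_ge0 x : (forall v, 0 <= x v) -> 0 <= quad x.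
Proof.
by move=> x0; apply: sumr_ge0 => u _; apply: sumr_ge0 => v _; rewrite !mulr_ge0.
Qed.

Section Maximizer.
Variables (S : {set V}) (x : V -> R).
Hypothesis xP : rayleigh_max S x.

(** First-order optimality: raising the entry at [w] keeps the vector admissible, so the derivative
    in that direction is not positive. *)
Lemma adj_mul_le w : w \in S -> adj_mul x w <= quad x * x w.
Proof.
move=> wS; have [x0 xS x1 xmax] := xP.
have rho0 := quad_ge0 x0.
have step (c : R) : 0 < c -> 2 * adj_mul x w <= quad x * (2 * x w + c).
  move=> c0; have := xmax (fun v => x v + (v == w)%:R * c).
  rewrite quad_add sqnorm_add x1 => H.
  have : quad x + 2 * c * adj_mul x w <= quad x * (1 + 2 * c * x w + c ^+ 2).
    apply: H => v; first by rewrite addr_ge0 // mulr_ge0 // ltW.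
    move=> vS; rewrite xS // add0r; case: eqP => [vw|_]; last by rewrite mul0r.
    by rewrite vw wS in vS.
  move=> H'; rewrite -(ler_pM2l c0); move: H'; rewrite expr2; lra.
rewrite -subr_le0 leNgt; apply/negP => pos.
set d := adj_mul x w - quad x * x w in pos.
have := step (d / (quad x + 1)).
have r1 : 0 < quad x + 1 by lra.
have : quad x * (d / (quad x + 1)) <= d.
  by rewrite mulrA ler_pdivrMr // mulrC ler_wpM2l ?ltW //; lra.
move=> h1 /(_ (divr_gt0 pos r1)); rewrite mulrDr => h2.
by move: pos h1 h2; rewrite /d; lra.
Qed.

(** The gaps in [adj_mul_le], weighted by [x], are nonnegative and sum to zero. *)
Lemma adj_mul_eq w : w \in S -> 0 < x w -> adj_mul x w = quad x * x w.
Proof.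
move=> wS xw; have [x0 xS x1 xmax] := xP.
have sum0 : \sum_v x v * (quad x * x v - adj_mul x v) = 0.
  under eq_bigr => v _ do rewrite mulrBr.
  rewrite sumrB -quadE.
  have -> : \sum_v x v * (quad x * x v) = quad x * \sum_v x v ^+ 2.
    by rewrite mulr_sumr; apply: eq_bigr => v _; ring.
  by rewrite x1 mulr1 subrr.
have ge0 v : 0 <= x v * (quad x * x v - adj_mul x v).
  case: (boolP (v \in S)) => vS; last by rewrite xS // mul0r.
  by rewrite mulr_ge0 // subr_ge0 adj_mul_le.
have /eqP : x w * (quad x * x w - adj_mul x w) = 0 := psumr_eq0P (fun v _ => ge0 v) sum0 isT.
by rewrite mulf_eq0 (gt_eqF xw) /= subr_eq0 => /eqP.
Qed.

(** The vector [x] with its entry at [w] set to zero is tested in [S :\ w]. *)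
Lemma remove_vertex w rho' : w \in S ->
  (forall y, (forall v, 0 <= y v) -> (forall v, v \notin S :\ w -> y v = 0) ->
     quad y <= rho' * \sum_v y v ^+ 2) ->
  quad x * (1 - 2 * x w ^+ 2) <= rho' * (1 - x w ^+ 2).
Proof.
move=> wS H; have [x0 xS x1 xmax] := xP.
have := H (fun v => x v + (v == w)%:R * - x w).
rewrite quad_add sqnorm_add x1 => H'.
have {H'} : quad x + 2 * - x w * adj_mul x w <= rho' * (1 + 2 * - x w * x w + (- x w) ^+ 2).
  apply: H' => v.
    by have [->|_] := eqVneq v w; rewrite ?mul1r ?subrr // mul0r addr0.
  rewrite !inE negb_and negbK => /orP[/eqP->|vS]; first by rewrite eqxx mul1r subrr.
  have -> : v == w = false by apply/negbTE; apply: contraNneq vS => ->.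
  by rewrite xS // mul0r addr0.
have : x w * adj_mul x w <= x w * (quad x * x w) by rewrite ler_wpM2l // adj_mul_le.
rewrite !expr2; lra.
Qed.
End Maximizer.

(** Monochromatic pairs carry no edge, so the form is at most the square of the total minus the
    squares of the colour sums; Cauchy-Schwarz is then applied over the colours and over [S]. *)
Lemma colourable_quad k (c : V -> 'I_k) S x : (0 < k)%N -> (forall v, v \notin S -> x v = 0) ->
  (forall u v, u \in S -> v \in S -> e u v -> c u != c v) -> (forall v, 0 <= x v) ->
  quad x <= (1 - k%:R^-1) * #|S|%:R * \sum_v x v ^+ 2.
Proof.
move=> k0 xS cP x0.
have kR : 0 < k%:R :> R by rewrite ltr0n.
have kR1 : 1 <= k%:R :> R by rewrite ler1n.
pose X i := \sum_(v | c v == i) x v.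
have sumX : \sum_i X i = \sum_v x v by rewrite (partition_big c xpredT).
have le1 : quad x <= (\sum_v x v) ^+ 2 - \sum_i X i ^+ 2.
  have -> : \sum_i X i ^+ 2 = \sum_u \sum_v (c u == c v)%:R * (x u * x v).
    rewrite [RHS](partition_big c xpredT) //=; apply: eq_bigr => i _.
    rewrite expr2 mulr_suml; apply: eq_bigr => u /eqP <-.
    rewrite mulr_sumr big_mkcond; apply: eq_bigr => v _.
    by rewrite eq_sym; case: eqP; rewrite ?mul1r ?mul0r.
  rewrite expr2 mulr_suml -sumrB; apply: ler_sum => u _.
  rewrite mulr_sumr -sumrB; apply: ler_sum => v _.
  have xx0 : 0 <= x u * x v by rewrite mulr_ge0.
  case: (boolP (u \in S)) => uS; last by rewrite xS // !mul0r !mulr0 subrr.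
  case: (boolP (v \in S)) => vS; last by rewrite [x v]xS // !mulr0 subrr.
  case: (boolP (e u v)) => [/(cP u v uS vS)/negbTE->|_]; first by rewrite mul1r mul0r subr0.
  by rewrite mul0r; case: eqP => _; rewrite ?mul1r ?mul0r ?subrr ?subr0.
apply: le_trans le1 _.
have le2 : (\sum_v x v) ^+ 2 <= k%:R * \sum_i X i ^+ 2.
  have := sqr_sum_le [set: 'I_k] X; rewrite cardsT card_ord.
  have setT_sum (f : 'I_k -> R) : \sum_(i in [set: 'I_k]) f i = \sum_i f i.
    by apply: eq_bigl => i; rewrite inE.
  by rewrite !setT_sum sumX.
have le3 : (\sum_v x v) ^+ 2 <= #|S|%:R * \sum_v x v ^+ 2.
  have := sqr_sum_le S x.
  have -> : \sum_(v in S) x v = \sum_v x v.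
    by rewrite big_mkcond; apply: eq_bigr => v _; case: ifPn => // /xS->.
  have -> // : \sum_(v in S) x v ^+ 2 = \sum_v x v ^+ 2.
  by rewrite big_mkcond; apply: eq_bigr => v _; case: ifPn => // /xS->; rewrite expr0n.
have le4 : k%:R^-1 * (\sum_v x v) ^+ 2 <= \sum_i X i ^+ 2.
  by rewrite mulrC ler_pdivrMr // mulrC.
have inv1 : 0 <= 1 - k%:R^-1 :> R by rewrite subr_ge0 invf_le1.
apply: le_trans (_ : (1 - k%:R^-1) * (\sum_v x v) ^+ 2 <= _).
  by rewrite mulrBl mul1r; lra.
by rewrite -mulrA ler_wpM2l.
Qed.
End Rayleigh.

Lemma kplus_sub (V : finType) (S : {set V}) (e : rel V) k t :
  kplus (fun u v : {v | v \in S} => e (val u) (val v)) k t -> kplus e k t.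
Proof.
move=> [A [i [u [v [cA jA [ik uA vA uv]]]]]].
exists (fun j => val @: A j), i, (val u), (val v); split.
- by move=> j jk; rewrite card_imset ?cA //; apply: val_inj.
- by move=> a b x y ak bk ab /imsetP[x' xA ->] /imsetP[y' yA ->]; apply: (jA a b).
- by split=> //; apply: imset_f.
Qed.

Section SpectralBound.
Variables (R : realType) (k t : nat).
Hypotheses (k1 : (1 < k)%N) (t0 : (0 < t)%N).

(** Here [d] is the degree of a vertex v inside the extremal set of size [S], [X] its squared entry
    and [A] the sum of squares over its neighbours. Cauchy-Schwarz on the eigenvalue equation gives
    rho^2 X <= d A, and the lower bound on the entries outside the neighbourhood gives the bound on
    [A]. *)
Lemma degree_estimate (Q S d rho X A al : R) (L : nat) : (0 < L)%N -> Q = (4 * k * L)%:R -> 0 < S ->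
  0 <= d -> al = 1 - k%:R^-1 -> al * S < rho -> Q <= (Q + 2) * S * X ->
  rho ^+ 2 * X <= d * A -> (Q + 2) * S * A <= 2 * S + d * Q ->
  (k * L)%:R * (S - d) <= (L%:R + 1) * S.
Proof.
move=> L0 QE S0 d0 alE alS QX XA AS.
have k2 : 2 <= k%:R :> R by rewrite (ler_nat R 2).
have L1 : 1 <= L%:R :> R by rewrite ler1n.
have kL2 : 2 <= k%:R * L%:R :> R by nra.
set eta := (k%:R * L%:R)^-1 : R.
have eta0 : 0 < eta by rewrite invr_gt0; lra.
have etaE : eta * (k%:R * L%:R) = 1 by rewrite mulVf //; lra.
have eta2 : eta <= 1 / 2 by nra.
have al2 : 1 / 2 <= al.
  have : k%:R^-1 <= 2^-1 :> R by rewrite lef_pV2 // posrE; lra.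
  by rewrite alE; lra.
(* This is why q = 4kL: a degree below S (al - eta) would give 0 <= 2 eta - 6 al, which is false. *)
have Qeta : Q * eta = 4.
  by rewrite QE !natrM; nra.
rewrite leNgt; apply/negP => big.
have d_lt : d < S * (al - eta).
  have kE : k%:R * al = k%:R - 1 by rewrite alE mulrBr mulr1 divff //; lra.
  have kL0 : 0 < k%:R * L%:R :> R by lra.
  rewrite -(ltr_pM2l kL0).
  have -> : k%:R * L%:R * (S * (al - eta)) = S * (L%:R * (k%:R * al) - eta * (k%:R * L%:R)) by ring.
  rewrite kE etaE; move: big; rewrite natrM; lra.
have Q0 : 0 < Q by nra.
have be0 : 0 < al - eta by nra.
have h1 : (al * S) ^+ 2 <= rho ^+ 2 by apply: lerXn2r; rewrite ?nnegrE; nra.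
have Q2 : 0 < Q + 2 by lra.
have QS0' : 0 < (Q + 2) * S by exact: mulr_gt0.
have X0 : 0 <= X.
  by rewrite -(pmulr_rge0 X QS0') (le_trans (ltW Q0)).
have h2 : (al * S) ^+ 2 * X <= d * A by apply: le_trans XA; rewrite ler_wpM2r.
have QS0 := ltW QS0'.
have h3 : (al * S) ^+ 2 * Q <= d * (2 * S + d * Q).
  apply: le_trans (_ : (al * S) ^+ 2 * ((Q + 2) * S * X) <= _); first by rewrite ler_wpM2l ?sqr_ge0.
  have -> : (al * S) ^+ 2 * ((Q + 2) * S * X) = (Q + 2) * S * ((al * S) ^+ 2 * X) by ring.
  apply: le_trans (ler_wpM2l QS0 h2) _.
  have -> : (Q + 2) * S * (d * A) = d * ((Q + 2) * S * A) by ring.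
  exact: ler_wpM2l.
have h4 : d * (2 * S + d * Q) <= (S * (al - eta)) * (2 * S + (S * (al - eta)) * Q).
  apply: ler_pM => //; [|exact: ltW|].
    by apply: addr_ge0; apply: mulr_ge0 => //; exact: ltW.
  by rewrite lerD2l ler_wpM2r // ltW.
have h5 : S ^+ 2 * (al ^+ 2 * Q) <= S ^+ 2 * ((al - eta) * (2 + (al - eta) * Q)).
  by move: (le_trans h3 h4); rewrite !expr2; lra.
rewrite ler_pM2l ?exprn_gt0 // in h5.
have : (al - eta) * (2 + (al - eta) * Q) = 2 * (al - eta) + al ^+ 2 * Q - 2 * al * (Q * eta) + eta * (Q * eta) by ring.
rewrite Qeta => h6; rewrite h6 in h5.
lra.
Qed.
End SpectralBound.

Lemma dense_subset_colourable k t : (0 < k)%N -> (0 < t)%N ->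
  exists L N, (0 < L)%N /\ forall (V : finType) (e : rel V) (S : {set V}),
    symmetric e -> (N <= #|S|)%N ->
    (forall v, v \in S -> (k * L * (#|S| - #|S :&: nbr e v|) <= (L + 1) * #|S|)%N) ->
    ~ kplus e k t ->
    exists c : V -> 'I_k, forall u v, u \in S -> v \in S -> e u v -> c u != c v.
Proof.
move=> k0 t0; have [L [N [L0 H]]] := dense_colourable k0 t0.
exists L, N; split=> // V e S e_sym SN deg nkp.
pose W : finType := {v | v \in S}.
pose e' : rel W := fun u v => e (val u) (val v).
have cW : #|W| = #|S| by rewrite card_sig; apply: eq_card.
have [||v||c cP] := H W e'.
- by move=> u v; apply: e_sym.
- by rewrite cW.
- have := deg (val v) (valP v); rewrite cW.
  suff -> : #|~: nbr e' v| = (#|S| - #|S :&: nbr e (val v)|)%N by [].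
  rewrite -cardsD -(card_imset _ val_inj); apply: eq_card => x.
  apply/imsetP/idP => [[y yn ->]|].
    by move: yn; rewrite !inE (valP y) /= andbT.
  rewrite !inE => /andP[nx xS].
  by exists (Sub x xS); rewrite ?inE /e' SubK.
- by move=> /kplus_sub.
exists (fun v => if insub v is Some w then c w else Ordinal k0) => u v uS vS uv.
by rewrite (insubT (fun x => x \in S) uS) (insubT (fun x => x \in S) vS); apply: cP.
Qed.

Theorem spectral_bound (R : realType) k t : (1 < k)%N -> (0 < t)%N ->
  exists N, forall (V : finType) (e : rel V), symmetric e -> irreflexive e -> (N <= #|V|)%N ->
    ~ kplus e k t -> forall (mu : R) (y : V -> R), (forall v, 0 <= y v) -> (exists v, y v != 0) ->
    (forall v, mu * y v <= adj_mul e y v) -> mu <= (1 - k%:R^-1) * #|V|%:R.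
Proof.
move=> k1 t0; have k0 : (0 < k)%N by lia.
have [L [N0 [L0 dense]]] := dense_subset_colourable k0 t0.
pose q := (4 * k * L)%N; pose N1 := (N0 + q ^ 2 + q + 2)%N.
(* The extremal set has more than al^(q+1) n vertices and al >= 1/2, so this threshold gives it at
   least [N1]. *)
exists (2 ^ q.+1 * N1)%N => V e e_sym e_irr VN nkp mu y y0 [v0 yv0] muy.
rewrite leNgt; apply/negP; set al := 1 - k%:R^-1 => lt_mu.
have q0 : (0 < q)%N by rewrite !muln_gt0 k0.
have kR : 2 <= k%:R :> R by rewrite (ler_nat R 2).
have al2 : 2^-1 <= al.
  have : k%:R^-1 <= 2^-1 :> R by rewrite lef_pV2 // posrE; lra.
  by rewrite /al; lra.
have al0 : 0 < al by lra.
have [X XP] : exists X : {set V} -> V -> R, forall S, S != set0 -> rayleigh_max e S (X S).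
  apply: (@fin_all_exists _ (fun=> V -> R) (fun S x => S != set0 -> rayleigh_max e S x)) => S.
  have [->|S0] := eqVneq S set0; first by exists (fun=> 0).
  by have [x xP] := rayleigh_exists R e S0; exists x.
pose rho S := quad e (X S).
have T0 : [set: V] != set0 by apply/set0Pn; exists v0; rewrite inE.
pose Phi S : R := rho S ^+ q.+1 / #|S|%:R ^+ q.
have [S S0 Smax] : exists2 S, S != set0 & forall S', S' != set0 -> Phi S' <= Phi S.
  by case: (@arg_maxP _ _ _ [set: V] (fun S => S != set0) Phi T0) => S S0 H; exists S.
have card0 S' : S' != set0 -> 0 < #|S'|%:R :> R by rewrite ltr0n card_gt0.
have rho_ge0 S' : S' != set0 -> 0 <= rho S'.
  by move=> /XP[x0 _ _ _]; apply: quad_ge0.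
have Smax' S' : S' != set0 -> rho S' ^+ q.+1 * #|S|%:R ^+ q <= rho S ^+ q.+1 * #|S'|%:R ^+ q.
  move=> S'0; have := Smax S' S'0; rewrite /Phi ler_pdivrMr ?exprn_gt0 ?card0 //.
  by rewrite mulrAC ler_pdivlMr ?exprn_gt0 ?card0.
set n := #|V|%:R in lt_mu; set s := #|S|%:R : R.
have s0 : 0 < s by apply: card0.
have n0 : 0 < n by rewrite /n -cardsT card0.
have rhoT : mu <= rho [set: V].
  have [_ _ _ /(_ y y0)] := XP _ T0; rewrite -/(rho _) => H.
  have y2 : 0 < \sum_v y v ^+ 2.
    rewrite lt0r sumr_ge0 ?andbT => [|v _]; last exact: sqr_ge0.
    apply: contra yv0 => /eqP/psumr_eq0P-/(_ (fun v _ => sqr_ge0 _)) H0.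
    by have := H0 v0 isT; move/eqP; rewrite sqrf_eq0.
  rewrite -(ler_pM2r y2); apply: le_trans (H _); last by move=> v; rewrite inE.
  rewrite quadE mulr_sumr; apply: ler_sum => v _.
  by rewrite expr2 mulrCA ler_wpM2l.
have lt1 : (al * n) ^+ q.+1 * s ^+ q < rho S ^+ q.+1 * n ^+ q.
  have h := Smax' _ T0; rewrite cardsT -/n -/s in h; apply: lt_le_trans h.
  rewrite ltr_pM2r ?exprn_gt0 // ltrXn2r // ?nnegrE ?mulr_ge0 ?ltW //.
  - exact: lt_le_trans lt_mu rhoT.
have lt2 : al ^+ q.+1 * n * s ^+ q < rho S ^+ q.+1.
  rewrite -(ltr_pM2r (exprn_gt0 q n0)); apply: le_lt_trans lt1.
  by rewrite exprMn [n ^+ q.+1]exprS le_eqVlt; apply/orP; left; apply/eqP; ring.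
have rho_s : rho S <= s.
  have [x0 xS x1 _] := XP _ S0; have := quad_le_card e x0 xS; by rewrite x1 mulr1.
have s_n : s <= n by rewrite ler_nat max_card.
have lt3 : al ^+ q.+1 * n < s.
  rewrite -(ltr_pM2r (exprn_gt0 q s0)) -exprS; apply: lt_le_trans lt2 _.
  by apply: lerXn2r; rewrite ?nnegrE ?rho_ge0 // ltW.
(* Otherwise [Phi S] would be at most al^(q+1) s, hence at most al^(q+1) n, which [lt2] excludes. *)
have al_rho : al * s < rho S.
  rewrite ltNge; apply/negP => le_rho.
  have : rho S ^+ q.+1 <= (al * s) ^+ q.+1.
    by apply: lerXn2r; rewrite ?nnegrE ?rho_ge0 // mulr_ge0 ?ltW.
  rewrite leNgt => /negP[]; apply: le_lt_trans lt2.
  by rewrite exprMn [s ^+ q.+1]exprS mulrA ler_pM2r ?exprn_gt0 // ler_pM2l ?exprn_gt0.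
have rho0 : 0 < rho S by apply: lt_trans al_rho; apply: mulr_gt0.
have S_big : (N1 <= #|S|)%N.
  rewrite -(ler_nat R); apply: le_trans (ltW lt3).
  have : (2^-1) ^+ q.+1 <= al ^+ q.+1 by apply: lerXn2r; rewrite ?nnegrE ?invr_ge0 // ltW.
  move=> h; apply: le_trans (ler_wpM2r (ltW n0) h).
  rewrite exprVn mulrC ler_pdivlMr ?exprn_gt0 // -natrX -natrM ler_nat mulnC //.
have xP := XP _ S0; have [x0 xS x1 _] := xP.
have entry w : w \in S -> q%:R <= (q + 2)%:R * s * X S w ^+ 2.
  move=> wS; have cS : #|S| = #|S :\ w|.+1 by rewrite (cardsD1 w S) wS.
  have Sw0 : S :\ w != set0 by rewrite -card_gt0; move: S_big cS; rewrite /N1; clear; lia.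
  apply: (@extremal_entry _ _ (rho S) (rho (S :\ w))) => //.
  - by move: S_big; rewrite /N1; clear; lia.
  - by move: S_big; rewrite /N1; clear; lia.
  - exact: sqr_ge0.
  - exact: rho_ge0.
  - apply: (remove_vertex e_sym e_irr xP wS) => z z0 zS.
    by have [_ _ _ H] := XP _ Sw0; apply: H.
  - by have := Smax' _ Sw0; rewrite [in (_ - 1)%N]cS subn1.
have qR : 0 < q%:R :> R by rewrite ltr0n.
have q2s : 0 < (q + 2)%:R * s by rewrite mulr_gt0 // ltr0n addn2.
have xpos w : w \in S -> 0 < X S w.
  move=> wS; rewrite lt0r x0 andbT; apply/eqP => xw0.
  by have := entry w wS; rewrite xw0 expr0n mulr0 leNgt qR.
have deg v : v \in S -> (k * L * (#|S| - #|S :&: nbr e v|) <= (L + 1) * #|S|)%N.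
  move=> vS; set D := S :&: nbr e v.
  have DS : (#|D| <= #|S|)%N by apply: subset_leq_card; apply: subsetIl.
  rewrite -(ler_nat R) !natrM natrB // natrD -!natrM.
  apply: (@degree_estimate _ k _ q%:R s #|D|%:R (rho S) (X S v ^+ 2) (\sum_(u in D) X S u ^+ 2) al) => //.
  - by rewrite -natrD entry.
  - have := sqr_sum_le D (X S); have -> // : \sum_(u in D) X S u = rho S * X S v.
      rewrite -(adj_mul_eq e_sym e_irr xP vS (xpos v vS)) /adj_mul big_mkcond.
      apply: eq_bigr => u _; rewrite !inE; case: (boolP (u \in S)) => uS /=.
        by case: (e v u); rewrite ?mul1r ?mul0r.
      by rewrite xS // mulr0.
    by rewrite exprMn.
  - have : \sum_(u in D) X S u ^+ 2 + \sum_(u in S :\: D) X S u ^+ 2 = 1.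
      rewrite -x1 [RHS](bigID (mem S)) /= [X in _ = _ + X]big1 ?addr0; last first.
        by move=> u uS; rewrite xS // expr0n.
      rewrite [RHS](bigID (mem D)) /=; congr (_ + _); apply: eq_bigl => u; rewrite !inE.
        by case: (u \in S).
      by rewrite andbC.
    have : \sum_(u in S :\: D) q%:R <= (q + 2)%:R * s * \sum_(u in S :\: D) X S u ^+ 2.
      by rewrite mulr_sumr; apply: ler_sum => u; rewrite inE => /andP[_ uS]; apply: entry.
    have cSD : #|S :\: D|%:R = s - #|D|%:R :> R.
      by rewrite -natrB //; congr (_%:R); rewrite cardsD (setIidPr (subsetIl S _ : D \subset S)).
    have -> : \sum_(u in S :\: D) q%:R = q%:R * (s - #|D|%:R) :> R.
      by rewrite -cSD sumr_const mulr_natr.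
    move=> h1 h2; have h3 : \sum_(u in D) X S u ^+ 2 = 1 - \sum_(u in S :\: D) X S u ^+ 2 by lra.
    by rewrite h3 -natrD mulrBr mulr1; move: h1; rewrite natrD; lra.
have [|c cP] := dense V e S e_sym _ deg nkp; first by move: S_big; rewrite /N1; clear; lia.
have := colourable_quad k0 xS cP x0; rewrite -/(rho S) x1 mulr1 -/al -/s.
by rewrite leNgt al_rho.
Qed.

(** * From tensors to shadows *)

Section Normc.
Variable R : realType.
Implicit Types (z : R[i]).

Lemma normc_ge0 z : 0 <= Normc.normc z.
Proof. by case: z => a b; rewrite /Normc.normc sqrtr_ge0. Qed.

Lemma normcX z n : Normc.normc (z ^+ n) = Normc.normc z ^+ n.
Proof.
elim: n => [|n IH]; first by rewrite !expr0 Normc.normc1.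
by rewrite !exprS Normc.normcM IH.
Qed.

Lemma normc_nat n : Normc.normc (n%:R : R[i]) = n%:R.
Proof.
have -> : n%:R = (n%:R)%:C%C :> R[i] by rewrite rmorph_nat.
by rewrite /Normc.normc /= expr0n addr0 sqrtr_sqr ger0_norm.
Qed.

Lemma le_normc_sum (I : finType) (P : pred I) (F : I -> R[i]) :
  Normc.normc (\sum_(i | P i) F i) <= \sum_(i | P i) Normc.normc (F i).
Proof.
elim/big_rec2: _ => [|i a b _ le]; first by rewrite Normc.normc0.
by apply: le_trans (le_normcD (F i) b) _; rewrite lerD2l.
Qed.

Lemma normc_prod (I : finType) (P : pred I) (F : I -> R[i]) :
  Normc.normc (\prod_(i | P i) F i) = \prod_(i | P i) Normc.normc (F i).
Proof. by apply: (big_morph _ (@Normc.normcM R) (Normc.normc1 R)). Qed.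
End Normc.

Lemma prod_le_mean (R : realType) (I : finType) (A : {set I}) (a : I -> R) p :
  (0 < p)%N -> #|A| = p -> (forall i, 0 <= a i) ->
  \prod_(i in A) a i <= (\sum_(i in A) a i ^+ p) / p%:R.
Proof.
move=> p0 cA a0.
have [+ _] := leif_AGM (A := A) (E := fun i => a i ^+ p) (fun i _ => exprn_ge0 p (a0 i)).
rewrite cA prodrXl => le; have mean0 : 0 <= (\sum_(i in A) a i ^+ p) / p%:R.
  by rewrite divr_ge0 // sumr_ge0 // => i _; apply: exprn_ge0.
by rewrite -(ler_pXn2r p0) ?nnegrE ?prodr_ge0.
Qed.

Section TensorApply.
Variables (R : realType) (n r : nat) (H : {set {set 'I_n}}).
Hypotheses (r0 : (0 < r)%N) (uH : uniform r H).

(** Each edge through [i] arises from the (r-1)! orderings of its other vertices, which cancel the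
    normalizing factor of the tensor. *)
Lemma tensor_applyE (x : 'I_n -> R[i]) i :
  tensor_apply r H x i = \sum_(h in H | i \in h) \prod_(j in h :\ i) x j.
Proof.
case: r r0 uH => // p _ uHp; rewrite /tensor_apply.
rewrite (eq_bigl (fun s : {ffun 'I_p.+1 -> 'I_n} => s ord0 == i)); last first.
  move=> s; apply/forallP/idP => [/(_ ord0)|s0 j]; first by [].
  by apply/implyP => /eqP j0; have -> : j = ord0 by apply: val_inj.
pose img (s : {ffun 'I_p.+1 -> 'I_n}) := [set s j | j : 'I_p.+1].
pose P (s : {ffun 'I_p.+1 -> 'I_n}) := \prod_(j | val j != 0%N) x (s j).
transitivity (\sum_(s : {ffun 'I_p.+1 -> 'I_n} | (s ord0 == i) && (img s \in H)) (p`!)%:R^-1 * P s).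
  rewrite [RHS]big_mkcondr; apply: eq_bigr => s _; rewrite /adj_entry -/(img s) -/(P s).
  by case: ifP => // _; rewrite mul0r.
rewrite (partition_big img (mem H)) /=; last by move=> s /andP[].
rewrite [RHS]big_mkcondr; apply: eq_bigr => h hH.
case: ifP => ih; last first.
  rewrite big_pred0 // => s; apply/negbTE/negP => /andP[/andP[/eqP s0 _] /eqP sh].
  by case/negP: (negbT ih); rewrite -sh -s0; apply: imset_f.
have ch : #|h :\ i| = p by have := cardsD1 i h; rewrite ih uHp // => -[].
pose lift_f (f : {ffun 'I_p -> 'I_n}) : {ffun 'I_p.+1 -> 'I_n} :=
  [ffun j => if unlift ord0 j is Some j' then f j' else i].
pose Inj := [set f : {ffun 'I_p -> 'I_n} in ffun_on (mem (h :\ i)) | injectiveb f].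
have lift0 f : lift_f f ord0 = i by rewrite ffunE unlift_none.
have liftS f j : lift_f f (lift ord0 j) = f j by rewrite ffunE liftK.
have lift_f_inj : injective lift_f.
  by move=> f g e; apply/ffunP => j; rewrite -!liftS e.
have ord_cases (j : 'I_p.+1) : j = ord0 \/ exists j', j = lift ord0 j'.
  by case: (unliftP ord0 j) => [j' ->|->]; [right; exists j' | left].
have setE : [set s : {ffun 'I_p.+1 -> 'I_n} | (s ord0 == i) && (img s \in H) && (img s == h)] = lift_f @: Inj.
  apply/setP => s; rewrite inE; apply/idP/imsetP => [/andP[/andP[/eqP s0 _] /eqP sh]|[f]].
    have s_inj : injective s.
      have /imset_injP inj : #|s @: [set: 'I_p.+1]| == #|[set: 'I_p.+1]|.
        have -> : s @: [set: 'I_p.+1] = h by rewrite -sh; apply/setP => v; apply/imsetP/imsetP => -[j _ ->]; exists j.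
        by rewrite uHp // cardsT card_ord.
      by move=> j j'; apply: inj; rewrite inE.
    exists [ffun j => s (lift ord0 j)].
      rewrite inE; apply/andP; split.
        apply/ffun_onP => j; rewrite ffunE !inE -s0 (inj_eq s_inj) eq_sym neq_lift /=.
        by rewrite -sh; apply: imset_f.
      by apply/injectiveP => j j'; rewrite !ffunE => /s_inj/lift_inj.
    by apply/ffunP => j; case: (ord_cases j) => [->|[j' ->]]; rewrite ?lift0 // liftS ffunE.
  rewrite inE => /andP[/ffun_onP fon /injectiveP finj] ->; rewrite lift0 eqxx /=.
  suff -> : img (lift_f f) = h by rewrite hH eqxx.
  apply/eqP; rewrite eqEcard; apply/andP; split.
    apply/subsetP => v /imsetP[j _ ->]; case: (ord_cases j) => [->|[j' ->]]; first by rewrite lift0.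
    by rewrite liftS; have := fon j'; rewrite !inE => /andP[].
  rewrite card_imset ?uHp ?card_ord // => j j'.
  case: (ord_cases j) => [->|[a ->]]; case: (ord_cases j') => [->|[b ->]] //; rewrite ?lift0 ?liftS.
  - by move=> e; have := fon b; rewrite -e !inE eqxx.
  - by move=> e; have := fon a; rewrite e !inE eqxx.
  - by move/finj->.
have cardE : #|[set s : {ffun 'I_p.+1 -> 'I_n} | (s ord0 == i) && (img s \in H) && (img s == h)]| = p`!.
  rewrite setE card_imset // card_inj_ffuns_on card_ord.
  have -> : #|[eta mem (h :\ i)]| = p by rewrite -[RHS]ch; apply: eq_card.
  exact: ffactnn.
have PE (s : {ffun 'I_p.+1 -> 'I_n}) : (s ord0 == i) && (img s \in H) && (img s == h) -> P s = \prod_(j in h :\ i) x j.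
  move=> sP; have : s \in lift_f @: Inj by rewrite -setE inE.
  move=> /imsetP[f]; rewrite inE => /andP[/ffun_onP fon /injectiveP finj] ->.
  have -> : h :\ i = f @: [set: 'I_p].
    apply/esym/eqP; rewrite eqEcard card_imset // cardsT card_ord ch leqnn andbT.
    by apply/subsetP => v /imsetP[j _ ->]; apply: fon.
  rewrite big_imset /=; last by move=> a b _ _; apply: finj.
  rewrite /P big_mkcond big_ord_recl /= mul1r [RHS]big_mkcond; apply: eq_bigr => j _.
  by rewrite inE liftS.
rewrite (eq_bigr (fun=> (p`!)%:R^-1 * \prod_(j in h :\ i) x j)); last by move=> s /PE->.
rewrite sumr_const.
have -> : #|[pred s : {ffun 'I_p.+1 -> 'I_n} | (s ord0 == i) && (img s \in H) && (img s == h)]| = p`!.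
  by rewrite -[RHS]cardE; apply: eq_card => s; rewrite !inE.
by rewrite -mulrnAl -[_ *+ _]mulr_natr mulVf ?mul1r // pnatr_eq0 -lt0n fact_gt0.
Qed.
End TensorApply.

Section Hypergraph.
Variables (R : realType) (n r : nat) (H : {set {set 'I_n}}).
Hypotheses (r1 : (1 < r)%N) (uH : uniform r H) (lH : linear_hg H).

(** By linearity a pair of vertices lies in at most one edge, so no shadow neighbour is counted
    twice. *)
Lemma sum_edges_shadow (y : 'I_n -> R) i :
  \sum_(h in H | i \in h) \sum_(j in (h :\ i)) y j = adj_mul (shadow H) y i.
Proof.
rewrite /adj_mul (exchange_big_dep xpredT) //=; apply: eq_bigr => j _.
rewrite (eq_bigl (fun h => (h \in H) && ((i != j) && (i \in h) && (j \in h)))); last first.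
  by move=> h; rewrite !inE eq_sym; case: (i \in h); case: (i == j); rewrite ?andbF ?andbT.
rewrite sumr_const -[LHS]mulr_natl; apply: (congr1 (fun c : nat => c%:R * y j)).
rewrite /shadow; have [->|ij] /= := eqVneq i j.
  by apply: eq_card0 => h; rewrite unfold_in /= ?eqxx ?andbF.
case: (boolP [exists h in H, _]) => [/exists_inP[h hH /andP[ih jh]]|no].
  rewrite -[RHS](cards1 h); apply: eq_card => h'; rewrite in_set1 unfold_in /=.
  apply/idP/eqP => [/andP[h'H /andP[ih' jh']]|->]; last by rewrite hH ih jh.
  by apply: (edge_uniq lH h'H hH ij).
apply: eq_card0 => h; rewrite unfold_in /=; apply/negbTE; apply: contra no => /andP[hH ijh].
by apply/exists_inP; exists h.
Qed.

Lemma eigenvalue_shadow (lam : R[i]) : is_eigenvalue r H lam ->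
  exists y : 'I_n -> R, [/\ forall v, 0 <= y v, exists v, y v != 0 &
    forall v, ((r - 1)%:R * Normc.normc lam) * y v <= adj_mul (shadow H) y v].
Proof.
move=> [x [[j0 xj0] eigen]]; pose a v := Normc.normc (x v).
have a0 v : 0 <= a v by apply: normc_ge0.
have rp : (0 < r - 1)%N by rewrite subn_gt0.
exists (fun v => a v ^+ (r - 1)); split.
- by move=> v; apply: exprn_ge0.
- by exists j0; rewrite expf_neq0 //; apply: contra xj0 => /eqP/Normc.eq0_normc->.
move=> i; rewrite -mulrA -sum_edges_shadow.
have -> : Normc.normc lam * a i ^+ (r - 1) = Normc.normc (lam * x i ^+ r.-1).
  by rewrite Normc.normcM normcX subn1.
rewrite -eigen (tensor_applyE (ltnW r1) uH).
apply: le_trans (_ : (r - 1)%:R * (\sum_(h in H | i \in h) \prod_(j in (h :\ i)) a j) <= _).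
  rewrite ler_wpM2l //; apply: le_trans (le_normc_sum _ _) _.
  by apply: ler_sum => h _; rewrite normc_prod.
rewrite mulr_sumr; apply: ler_sum => h /andP[hH ih].
have ch : #|(h :\ i)| = (r - 1)%N by have := cardsD1 i h; rewrite ih (uH hH) => e; rewrite e addKn.
have r1R : 0 < (r - 1)%:R :> R by rewrite ltr0n.
by have := prod_le_mean rp ch a0; rewrite ler_pdivlMr // mulrC.
Qed.
End Hypergraph.

(** * The eigenvalue bound and the extremal hypergraphs *)

Section Main.
Import boolp.
Variables (R : realType) (r k : nat) (V : finType) (F : rel V).
Hypotheses (r2 : (2 <= r)%N) (rk : (r <= k)%N).
Hypotheses (F_simple : simple_graph F) (F_critical : color_critical F k).

Let bound n : R := (n%:R * (k - 1)%:R) / (k%:R * (r - 1)%:R).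

Lemma eigenvalue_le : exists N, forall n (H : {set {set 'I_n}}), (N <= n)%N ->
  uniform r H -> linear_hg H -> free_of H (expansion F r) ->
  forall lam : R[i], is_eigenvalue r H lam -> Normc.normc lam <= bound n.
Proof.
have k1 : (1 < k)%N by apply: leq_trans rk.
have [N HN] := @spectral_bound R k (span_bound r (span_bound r #|V|)).+1 k1 isT.
exists N => n H nN uH lH freeH lam /(eigenvalue_shadow r2 uH lH)[y [y0 yn0 yP]].
have := HN 'I_n (shadow H) (@shadow_sym _ H) _ _ _ _ y y0 yn0 yP.
rewrite card_ord => le; have {le} : (r - 1)%:R * Normc.normc lam <= (1 - k%:R^-1) * n%:R.
  apply: le => //; first by move=> x; rewrite /shadow eqxx.
  by move=> kp; apply: freeH; apply: (kplus_contains_expansion uH lH F_simple F_critical r2 (ltnW k1) kp).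
have rR : 0 < (r - 1)%:R :> R by rewrite ltr0n subn_gt0.
have kR : 0 < k%:R :> R by rewrite ltr0n ltnW.
rewrite mulrC -ler_pdivlMr // => /le_trans; apply.
suff -> : (1 - k%:R^-1) * n%:R / (r - 1)%:R = bound n by [].
by rewrite /bound (natrB _ (ltnW k1)); field; rewrite !lt0r_neq0.
Qed.

Lemma bound_ge0 n : 0 <= bound n.
Proof. by rewrite divr_ge0 // mulr_ge0. Qed.

(* The blocks of the design are the edges of a linear hypergraph whose shadow is
   complete k-partite, hence k-colourable, so that no copy of F^r can occur. *)
Lemma multipartite_hypergraph m : gdd 'I_k r m 0 ->
  exists H : {set {set 'I_(k * m)}}, [/\ uniform r H, linear_hg H, free_of H (expansion F r)
    & forall i, #|[set j | shadow H i j]| = ((k - 1) * m)%N].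
Proof.
move=> [T [W [cT /cards0_eq W0 dec]]].
have cV : #|{: 'I_k * T}| = (k * m)%N by rewrite card_prod card_ord cT.
pose f (p : 'I_k * T) : 'I_(k * m) := cast_ord cV (enum_rank p).
pose g (i : 'I_(k * m)) : 'I_k * T := enum_val (cast_ord (esym cV) i).
have fK : cancel f g by move=> p; rewrite /g /f cast_ordK enum_rankK.
have gK : cancel g f by move=> i; rewrite /g /f enum_valK cast_ordKV.
have [|Phi [Pr Padj Pex Puniq]] := @decomposable_bij _ _ _ (fun i j : 'I_(k * m) => (g i).1 != (g j).1) r f g fK gK _ dec.
  by move=> u v; rewrite !fK /multipartite W0 !inE andbT.
pose H := [set X : {set 'I_(k * m)} | `[< Phi X >]].
have HP X : X \in H -> Phi X by rewrite inE => /asboolP.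
have uH : uniform r H by move=> X /HP/Pr.
have lH : linear_hg H.
  move=> X Y /HP PX /HP PY; apply: contraNT; rewrite -ltnNge => /card_gt1P[u [v [+ + uv]]].
  by rewrite !inE => /andP[uX uY] /andP[vX vY]; apply/eqP; apply: (Puniq X Y u v).
have shE i j : shadow H i j = ((g i).1 != (g j).1).
  apply/idP/idP => [/andP[ij /exists_inP[X /HP PX /andP[iX jX]]]|gij].
    exact: Padj PX iX jX ij.
  have [X [PX iX jX]] := Pex i j gij.
  apply/andP; split; first by apply: contraNneq gij => ->.
  by apply/exists_inP; exists X; rewrite ?iX // inE; apply/asboolP.
exists H; split=> //.
- move=> [h [h_inj hP]]; have [F_sym F_irr] := F_simple; have [chiF _] := F_critical.
  have [_ /(_ k (ltnSn k)) /negP[]] := chromatic_numberP F_irr chiF.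
  apply/existsP; exists [ffun x => (g (h (inl x))).1].
  apply/forallP => x; apply/forallP => y; apply/implyP => Fxy; rewrite !ffunE.
  have exy : is_graph_edge F [set x; y].
    by apply/existsP; exists x; apply/existsP; exists y; rewrite Fxy eqxx.
  pose e : graph_edge F := Sub [set x; y] exy.
  have /HP PX : [set h z | z in expansion_edge r e] \in H by apply: hP; apply: imset_f.
  apply: (Padj _ _ _ PX).
  + by apply: imset_f; rewrite inE imset_f //= !inE eqxx.
  + by apply: imset_f; rewrite inE imset_f //= !inE eqxx orbT.
  + by rewrite (inj_eq h_inj); apply: contraTneq Fxy => -[->]; rewrite F_irr.
- move=> i; transitivity #|setX [set~ (g i).1] [set: T]|.
    rewrite -(card_imset _ (can_inj gK)); apply: eq_card => -[a x].
    rewrite !inE andbT eq_sym; apply/imsetP/idP => [[j]|ai].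
      by rewrite inE shE => /negbTE + e; rewrite -e => ->.
    by exists (f (a, x)); rewrite ?inE ?shE fK.
  by rewrite cardsX cardsC1 card_ord cardsT cT subn1.
Qed.

(** The eigenvalue of the all-ones vector is the common vertex degree: each edge through a vertex
    accounts for r-1 of its shadow neighbours. *)
Lemma regular_eigenvalue n (H : {set {set 'I_n}}) d : (0 < n)%N -> uniform r H -> linear_hg H ->
  (forall i, #|[set j | shadow H i j]| = d) ->
  exists2 lam : R[i], is_eigenvalue r H lam & Normc.normc lam = d%:R / (r - 1)%:R.
Proof.
move=> n0 uH lH reg.
have rR : (r - 1)%:R != 0 :> R by rewrite pnatr_eq0 subn_eq0 -ltnNge.
pose deg i := #|[set h in H | i \in h]|.
have degE i : (deg i)%:R = d%:R / (r - 1)%:R :> R.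
  apply: (mulIf rR); rewrite divfK //.
  have := sum_edges_shadow lH (fun=> 1 : R) i.
  have -> : adj_mul (shadow H) (fun=> 1 : R) i = d%:R.
    rewrite -(reg i) /adj_mul -sum1_card natr_sum [RHS]big_mkcond; apply: eq_bigr => j _.
    by rewrite inE mulr1; case: (shadow H i j).
  move=> <-; rewrite (eq_bigr (fun=> (r - 1)%:R)); last first.
    move=> h /andP[hH ih]; rewrite sumr_const; congr (_%:R).
    by have := cardsD1 i h; rewrite ih (uH h hH) => e; rewrite e addKn.
  rewrite sumr_const mulr_natl; congr (_ *+ _).
  by apply: eq_card => h; rewrite !inE.
pose i0 := Ordinal n0.
exists (deg i0)%:R; last by rewrite normc_nat degE.
exists (fun=> 1); split; first by exists i0; rewrite oner_neq0.
move=> i; rewrite (tensor_applyE (ltnW r2) uH) expr1n mulr1.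
have -> : deg i0 = deg i by apply/eqP; rewrite -(eqr_nat R) !degE.
rewrite (eq_bigr (fun=> 1)); last by move=> h _; rewrite big1.
by rewrite sumr_const; congr (_%:R); apply: eq_card => h; rewrite !inE.
Qed.
End Main.

Import boolp classical_sets.

(** The supremum of the empty set is 0 by convention, whence [0 <= b]. *)
Lemma sup_le_bound (R : realType) (E : set R) b : 0 <= b -> (forall x, E x -> x <= b) -> sup E <= b.
Proof.
move=> b0 Eb; have [->|/set0P E0] := eqVneq E set0; first by rewrite sup0.
by apply: ge_sup.
Qed.

Theorem theorem1p1 (R : realType) (r k : nat) (V : finType) (F : rel V) :
  (2 <= r)%N -> (r <= k)%N ->
  simple_graph F -> color_critical F k ->
  (exists N : nat, forall n : nat, (N <= n)%N ->
     spex_lin R r n (expansion F r)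
       <= (n%:R * (k - 1)%:R) / (k%:R * (r - 1)%:R)) /\
  (exists M : nat, forall m : nat, (M <= m)%N ->
     (m * (k - 1) = 0 %[mod r - 1])%N ->
     (m ^ 2 * k * (k - 1) = 0 %[mod r * (r - 1)])%N ->
     spex_lin R r (k * m) (expansion F r)
       = ((k * m)%:R * (k - 1)%:R) / (k%:R * (r - 1)%:R)).
Proof.
move=> r2 rk F_simple F_critical.
have [N HN] := eigenvalue_le R r2 rk F_simple F_critical.
have k1 : (1 < k)%N by apply: leq_trans rk.
have radius_le n (H : {set {set 'I_n}}) : (N <= n)%N -> uniform r H -> linear_hg H ->
    free_of H (expansion F r) ->
    spectral_radius R r H <= (n%:R * (k - 1)%:R) / (k%:R * (r - 1)%:R).
  move=> nN uH lH fH; apply: sup_le_bound; first exact: bound_ge0.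
  by move=> _ [lam lamP <-]; apply: HN lamP.
have upper n : (N <= n)%N -> spex_lin R r n (expansion F r) <= (n%:R * (k - 1)%:R) / (k%:R * (r - 1)%:R).
  move=> nN; apply: sup_le_bound; first exact: bound_ge0.
  by move=> _ [H [uH [lH fH]] <-]; apply: radius_le.
split; first by exists N.
have [M HM] := gdd_eventually r2 rk.
(* The successor keeps [m] positive, so that there is a vertex to carry the eigenvector. *)
exists (maxn M N).+1 => m mM dv1 dv2.
have kmN : (N <= k * m)%N.
  by apply: leq_trans (leq_pmull _ (ltnW k1)); apply: leq_trans (leq_maxr M N) (ltnW mM).
apply/eqP; rewrite eq_le upper //=.
have /(multipartite_hypergraph F_simple F_critical)[H [uH lH fH reg]] : gdd 'I_k r m 0.
  apply: HM; first by apply: leq_trans (leq_maxl M N) (ltnW mM).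
    by rewrite /dvdn dv1 mod0n.
  by rewrite mulnA /dvdn dv2 mod0n.
have km0 : (0 < k * m)%N by rewrite muln_gt0 (ltnW k1) (leq_ltn_trans _ mM).
have [lam lamP lamE] := regular_eigenvalue R r2 km0 uH lH reg.
have kR : k%:R != 0 :> R by rewrite pnatr_eq0 -lt0n ltnW.
have rR : (r - 1)%:R != 0 :> R by rewrite pnatr_eq0 subn_eq0 -ltnNge.
have -> : (k * m)%:R * (k - 1)%:R / (k%:R * (r - 1)%:R) = Normc.normc lam :> R.
  by rewrite lamE !natrM; field; rewrite kR rR.
(* Both suprema exceed their members only because the sets are bounded above; the upper bound
   already proved provides this. *)
apply: (@le_trans _ _ (spectral_radius R r H)).
  apply: ub_le_sup; last by exists lam.
  exists ((k * m)%:R * (k - 1)%:R / (k%:R * (r - 1)%:R)) => _ [mu muP <-].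
  exact: HN muP.
apply: ub_le_sup; last by exists H.
exists ((k * m)%:R * (k - 1)%:R / (k%:R * (r - 1)%:R)) => _ [H' [uH' [lH' fH']] <-].
exact: radius_le.
Qed.
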